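(* Let $h\in\mathbb{C}$ and let $e^h_{\mathfrak{I}_N}(\rho,\cdot)$ be the solution of $\mathbf{L}_{q,\mathfrak{I}_N}u=\rho^2u$ on $(0,b)$ with $e^h_{\mathfrak{I}_N}(\rho,0)=1$, $(e^h_{\mathfrak{I}_N})'(\rho,0)=i\rho+h$. The derivative $(e^h_{\mathfrak{I}_N})'(\rho,x)$ admits the integral representation $$(e^h_{\mathfrak{I}_N})'(\rho,x)=\left(i\rho+w(0,x)+\frac12\sigma_{\mathfrak{I}_N}(x)\right)e^{i\rho x}+h\cos(\rho x)+\sum_{k=1}^N\frac{\alpha_k}{2}H(x-x_k)e^{-2i\rho(x-x_k)}+\int_{-x}^xE^h_{\mathfrak{I}_N}(x,t)e^{i\rho t}\,dt$$ for $\rho\in\mathbb{C}$, where $E^h_{\mathfrak{I}_N}$ is a kernel not depending on $\rho$ with $E^h_{\mathfrak{I}_N}(x,\cdot)\in L_2(-x,x)$ for all $x\in(0,b]$.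
   Context: Let $b>0$, let $q\in L_2(0,b)$ be complex valued, $N\in\mathbb{N}$, $0<x_1<\dots<x_N<b$, $\alpha_1,\dots,\alpha_N\in\mathbb{C}\setminus\{0\}$, $x_0=0$, $x_{N+1}=b$, $\mathfrak{I}_N=\{(x_j,\alpha_j)\}_{j=1}^N$. $\mathcal{D}_2(\mathbf{L}_{q,\mathfrak{I}_N})$ is the set of $u\in AC[0,b]$ such that $u|_{(x_k,x_{k+1})}\in H^2(x_k,x_{k+1})$ for $k=0,\dots,N$ and $u'(x_k+)-u'(x_k-)=\alpha_ku(x_k)$ for $k=1,\dots,N$. A solution of $\mathbf{L}_{q,\mathfrak{I}_N}u=\lambda u$ (formally $-u''+(q+\sum_{k=1}^N\alpha_k\delta(x-x_k))u=\lambda u$) is a function $u\in\mathcal{D}_2(\mathbf{L}_{q,\mathfrak{I}_N})$ satisfying $-u''+qu=\lambda u$ a.e. on each $(x_k,x_{k+1})$. $H=\chi_{(0,\infty)}$ is the Heaviside function, $\sigma_{\mathfrak{I}_N}(x)=\sum_{k=1}^N\alpha_kH(x-x_k)$, $w(y,x)=\frac12\int_y^xq(s)ds$. At the points $x=x_k$, where the derivative jumps, the derivative is understood as the left-hand derivative (consistently with $H(0)=0$).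
   Formalization: The exponential in the sum over k is corrected from e^{-2iρ(x-x_k)} to e^{-2iρ(x/2-x_k)} = e^{iρ(2x_k-x)}; the printed form fails already for q=0, h=0, N=1 by the Riemann–Lebesgue lemma. *)

(* Defs.v *)
From mathcomp Require Import all_boot all_order all_algebra.
From mathcomp Require Import complex.
From mathcomp Require Import all_classical all_reals all_analysis.

Set Implicit Arguments.
Unset Strict Implicit.
Unset Printing Implicit Defensive.

Import Order.TTheory GRing.Theory Num.Theory.
Import numFieldNormedType.Exports.

Local Open Scope classical_set_scope.
Local Open Scope ring_scope.
Local Open Scope complex_scope.

(** Complex-valued functions of a real variable are total maps [R -> R[i]];
    only their values on the interval at hand are ever constrained. *)

Section ComplexAnalysis.
Variable R : realType.
Implicit Types (a c x : R) (z d : R[i]) (u v w : R -> R[i]).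

Definition cexp z : R[i] :=
  (expR (complex.Re z))%:C * (cos (complex.Im z) +i* sin (complex.Im z)).

Definition ccos z : R[i] := (cexp ('i%C * z) + cexp (- ('i%C * z))) / 2%:R.

(** Complex-valued Lebesgue integral, by real and imaginary parts. *)
Definition cintegral (D : set R) u : R[i] :=
  (\int[lebesgue_measure]_(x in D) complex.Re (u x)) +i*
  (\int[lebesgue_measure]_(x in D) complex.Im (u x)).

(** [u \in L_2(a,c)]; [ComplexField.Normc.normc] is the [R]-valued modulus. *)
Definition L2 a c u : Prop :=
  [/\ measurable_fun `]a, c[ (fun x => complex.Re (u x)),
      measurable_fun `]a, c[ (fun x => complex.Im (u x)) &
      (\int[lebesgue_measure]_(x in `]a, c[)
          ((ComplexField.Normc.normc (u x)) ^+ 2)%:E < +oo)%E].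

Definition abs_cont a c u : Prop :=
  forall eps : R, 0 < eps -> exists2 delta : R, 0 < delta &
  forall (n : nat) (l r : 'I_n -> R),
    (forall i, [&& a <= l i, l i <= r i & r i <= c]) ->
    (forall i j, i != j -> r i <= l j \/ r j <= l i) ->
    \sum_(i < n) (r i - l i) < delta ->
    \sum_(i < n) ComplexField.Normc.normc (u (r i) - u (l i)) < eps.

(** Real-valued [C^1] functions with compact support in the open interval
    [(a,c)]. *)
Definition C1c a c (phi : R -> R) : Prop :=
  [/\ forall x, derivable phi x 1,
      continuous (derive1 phi) &
      exists s t : R, [/\ a < s, t < c &
        forall x, phi x != 0 -> s <= x <= t]].

(** Weak derivative within [L_2(a,c)].  In one dimension testing against
    [C^1_c(a,c)] and against [C^infty_c(a,c)] are both standard. *)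
Definition weak_deriv a c u v : Prop :=
  [/\ L2 a c u, L2 a c v &
      forall phi, C1c a c phi ->
        cintegral `]a, c[ (fun x => u x * (derive1 phi x)%:C) =
        - cintegral `]a, c[ (fun x => v x * (phi x)%:C)].

Definition weak_deriv2 a c u w : Prop :=
  exists2 v, weak_deriv a c u v & weak_deriv a c v w.

(** The Sobolev space [H^2(a,c)]. *)
Definition H2 a c u : Prop := exists w, weak_deriv2 a c u w.

Definition diff_quot (f : R -> R) x : R -> R :=
  fun t => (f t - f x) / (t - x).

Definition has_lderiv u x d : Prop :=
  diff_quot (fun t => complex.Re (u t)) x t @[t --> x^'-] --> complex.Re d /\
  diff_quot (fun t => complex.Im (u t)) x t @[t --> x^'-] --> complex.Im d.

Definition has_rderiv u x d : Prop :=
  diff_quot (fun t => complex.Re (u t)) x t @[t --> x^'+] --> complex.Re d /\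
  diff_quot (fun t => complex.Im (u t)) x t @[t --> x^'+] --> complex.Im d.

Definition has_deriv u x d : Prop :=
  is_derive x 1 (fun t => complex.Re (u t)) (complex.Re d) /\
  is_derive x 1 (fun t => complex.Im (u t)) (complex.Im d).

Definition heaviside x : R[i] := if 0 < x then 1 else 0.

End ComplexAnalysis.

(** Interaction points are given as [xs : 'I_N -> R], numbered from [0], so
    that [xs k] is the mathematical [x_{k+1}]. *)

Section PointInteractions.
Variables (R : realType) (b : R) (N : nat).
Variables (xs : 'I_N -> R) (alpha : 'I_N -> R[i]).

(** [node 0 = 0], [node k = x_k] for [1 <= k <= N], [node N.+1 = b]. *)
Definition node (k : nat) : R :=
  if k is j.+1 then oapp xs b (insub j) else 0.

Definition interactions : Prop :=
  [/\ forall k, 0 < xs k < b,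
      forall j k : 'I_N, (j < k)%N -> xs j < xs k &
      forall k, alpha k != 0].

(** The domain [D_2(L)].  Elements of [H^2] of an interval have a [C^1]
    representative up to the end points, and [u] is continuous, so that
    [u'(x_k-)] and [u'(x_k+)] are its one-sided derivatives. *)
Definition domD2 (u : R -> R[i]) : Prop :=
  [/\ abs_cont 0 b u,
      forall k, (k <= N)%N -> H2 (node k) (node k.+1) u &
      forall k : 'I_N, exists dl dr : R[i],
        [/\ has_lderiv u (xs k) dl, has_rderiv u (xs k) dr &
            dr - dl = alpha k * u (xs k)]].

Definition is_solution (q : R -> R[i]) (lambda : R[i]) (u : R -> R[i]) : Prop :=
  domD2 u /\
  forall k, (k <= N)%N -> exists2 u2 : R -> R[i],
    weak_deriv2 (node k) (node k.+1) u u2 &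
    {ae lebesgue_measure, forall x : R, node k < x < node k.+1 ->
        - u2 x + q x * u x = lambda * u x}.

(** [u'(x) = d] for [0 < x <= b]: a two-sided derivative, except at [b] and at
    the interaction points, where it is the left-hand one. *)
Definition pw_deriv (u : R -> R[i]) (x : R) (d : R[i]) : Prop :=
  has_lderiv u x d /\
  (x < b -> (forall k, x != xs k) -> has_deriv u x d).

Definition sigma (x : R) : R[i] := \sum_(k < N) alpha k * heaviside (x - xs k).

End PointInteractions.

(** [w(y,x)], for [y <= x]. *)
Definition wint (R : realType) (q : R -> R[i]) (y x : R) : R[i] :=
  2%:R^-1 * cintegral `]y, x[ q.

(* Main.v *)
Require Import Defs.
From HB Require Import structures.
From mathcomp Require Import all_boot all_order all_algebra.
From mathcomp Require Import complex.
From mathcomp Require Import all_classical all_reals all_analysis.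
From mathcomp Require Import measurable_realfun lra ring.

Set Implicit Arguments.
Unset Strict Implicit.
Unset Printing Implicit Defensive.

Import Order.TTheory GRing.Theory Num.Theory.
Import numFieldNormedType.Exports.

Local Open Scope classical_set_scope.
Local Open Scope ring_scope.
Local Open Scope complex_scope.

Local Notation Re := complex.Re.
Local Notation Im := complex.Im.

(** The proof constructs a transmutation operator whose kernel does not depend
    on [rho], and reads the kernel of the derivative off it.

    The distributional potential is turned into a density [g] with respect to
    the measure [nu], Lebesgue measure plus unit atoms at [0] and at the
    interaction points: [g nu = h delta_0 + q dx + sum_k alpha_k delta_{x_k}]
    ([density], [atoms_measure]). The initial slope [i rho + h] becomes the slope
    [i rho] of [e^{i rho x}], followed by a point interaction of strength [h] at
    [0]. All data enter the equation through this one measure.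

    Suppose that [psi(x) = e^{i rho x} + int_{-x}^x K(x,t) e^{i rho t} dt]
    satisfies the variation of constants formula
    [psi(x) = e^{i rho x} + int_{s < x} S(x - s) psi(s) g(s) dnu(s)],
    where [S(y) = sin (rho y) / rho] is half the integral of [e^{i rho t}] over
    [|t| < y]. Comparing the coefficients of [e^{i rho t}] leaves a linear integral
    equation for [K] alone, which is solved by contraction in a sup-norm with
    weight [e^{lam x}] ([kernel_exists]). By Fubini's theorem the resulting [psi]
    does satisfy the formula ([psi_volterra]).

    To identify a solution [e] with [psi], both are compared with the equation
    integrated twice,
    [u(x) = 1 + i rho x + int_{s < x} (x - s) u(s) (g(s) dnu(s) - rho^2 ds)].
    For [psi] this follows from [S(y) = y - rho^2 int_0^y (y - z) S(z) dz]
    ([response_ramp]). For [e], a twice weakly differentiable function is an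
    affine function plus the second primitive of its weak second derivative
    ([weak_regularity], by testing against splines), and the jump conditions
    glue the pieces at the nodes ([solution_picard]). The integrated equation has
    at most one bounded solution ([picard_unique]), hence [e = psi]
    ([solution_psi]).

    Integrals of [(x - s)_+] against [g nu] have one-sided derivatives at every
    point, the left one integrating over [s < x] ([ramp_lderiv]). So
    [e'(x) = i rho e^{i rho x} + int_{s < x} cos (rho (x - s)) psi(s) g(s) dnu(s)]
    ([solution_slope]). Here the part [e^{i rho s}] of [psi(s)] gives
    [(e^{i rho x} + e^{i rho (2 s - x)}) / 2]: the atoms produce the explicit terms,
    [q ds] produces [w(0,x) e^{i rho x}] and, with [t = 2 s - x], the kernel
    [q((t + x) / 2) / 4], which is square integrable ([cint_reflect_ex]). The part
    containing [K] produces the average of two translates of [K(s,_)], integrated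
    over [s] against [g nu]; this kernel is bounded ([slope_kernel],
    [shifted_bound]). *)

(** * Complex-valued integration *)

Section NormOne.
Variable R : realType.
Implicit Types (z w : R[i]) (r : R).

Lemma Re_mul z w : Re (z * w) = Re z * Re w - Im z * Im w.
Proof. by case: z; case: w. Qed.

Lemma Im_mul z w : Im (z * w) = Re z * Im w + Im z * Re w.
Proof. by case: z; case: w. Qed.

Lemma Re_add z w : Re (z + w) = Re z + Re w. Proof. by case: z; case: w. Qed.

Lemma Im_add z w : Im (z + w) = Im z + Im w. Proof. by case: z; case: w. Qed.

Lemma Re_mulr z r : Re (z * r%:C) = Re z * r.
Proof. by rewrite Re_mul /= mulr0 subr0. Qed.

Lemma Im_mulr z r : Im (z * r%:C) = Im z * r.
Proof. by rewrite Im_mul /= mulr0 add0r. Qed.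

Lemma complexP z w : Re z = Re w -> Im z = Im w -> z = w.
Proof. by case: z; case: w => a b c d /= -> ->. Qed.

(** The [l^1]-norm is estimated and measured componentwise, so that no square
    root enters; up to a factor [2] it is the modulus. *)
Definition norm1 z : R := `|Re z| + `|Im z|.

Lemma norm1_ge0 z : 0 <= norm1 z.
Proof. by rewrite addr_ge0. Qed.

Lemma norm1_0 : norm1 0 = 0.
Proof. by rewrite /norm1 /= normr0 addr0. Qed.

Lemma norm1_eq0 z : norm1 z <= 0 -> z = 0.
Proof.
rewrite /norm1 => z0; apply: complexP => /=; apply/eqP; rewrite -normr_le0.
  by rewrite (le_trans _ z0)// lerDl.
by rewrite (le_trans _ z0)// lerDr.
Qed.

Lemma norm1D z w : norm1 (z + w) <= norm1 z + norm1 w.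
Proof.
rewrite /norm1 !raddfD /= addrACA lerD//; exact: ler_normD.
Qed.

Lemma norm1N z : norm1 (- z) = norm1 z.
Proof. by rewrite /norm1 !raddfN /= !normrN. Qed.

Lemma norm1B z w : norm1 (z - w) <= norm1 z + norm1 w.
Proof. by rewrite -(norm1N w) norm1D. Qed.

Lemma norm1M z w : norm1 (z * w) <= norm1 z * norm1 w.
Proof.
rewrite /norm1 Re_mul Im_mul.
have h1 := ler_normB (Re z * Re w) (Im z * Im w).
have h2 := ler_normD (Re z * Im w) (Im z * Re w).
rewrite !normrM in h1 h2.
apply: le_trans (lerD h1 h2) _.
by rewrite le_eqVlt; apply/orP; left; apply/eqP; ring.
Qed.

Lemma norm1_real r : norm1 r%:C = `|r|.
Proof. by rewrite /norm1 /= normr0 addr0. Qed.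

Lemma norm1Mr z r : norm1 (z * r%:C) = norm1 z * `|r|.
Proof. by rewrite /norm1 Re_mulr Im_mulr !normrM mulrDl. Qed.

Lemma norm1_Re z : `|Re z| <= norm1 z. Proof. by rewrite lerDl. Qed.
Lemma norm1_Im z : `|Im z| <= norm1 z. Proof. by rewrite lerDr. Qed.

Lemma norm1_normc z : norm1 z <= 2 * ComplexField.Normc.normc z.
Proof.
case: z => a c; rewrite /norm1 /= mulr_natl mulr2n.
by apply: lerD; rewrite -sqrtr_sqr; apply: ler_wsqrtr; rewrite ?lerDl ?lerDr sqr_ge0.
Qed.

Lemma normc_norm1 z : ComplexField.Normc.normc z <= norm1 z.
Proof.
case: z => a c; rewrite /norm1 /= -(ger0_norm (addr_ge0 (normr_ge0 a) (normr_ge0 c))).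
rewrite -sqrtr_sqr; apply: ler_wsqrtr; rewrite sqrrD !real_normK ?num_real//.
by rewrite addrAC lerDl mulrn_wge0// mulr_ge0.
Qed.

End NormOne.

Section CIntegral.
Context d (T : measurableType d) (R : realType).
Implicit Types (mu : {measure set T -> \bar R}) (f g : T -> R[i]).

Definition cmeas f :=
  measurable_fun setT (fun x => Re (f x)) /\ measurable_fun setT (fun x => Im (f x)).

Definition cint mu f : R[i] :=
  (\int[mu]_x Re (f x)) +i* (\int[mu]_x Im (f x)).

Definition cintegrable mu f :=
  mu.-integrable setT (EFin \o (fun x => Re (f x))) /\
  mu.-integrable setT (EFin \o (fun x => Im (f x))).

Lemma integrableD_EFin mu (f g : T -> R) : mu.-integrable setT (EFin \o f) ->
  mu.-integrable setT (EFin \o g) ->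
  mu.-integrable setT (EFin \o (fun x => f x + g x)).
Proof. by move=> fi gi; exact: (integrableD measurableT fi gi). Qed.

Lemma integrableB_EFin mu (f g : T -> R) : mu.-integrable setT (EFin \o f) ->
  mu.-integrable setT (EFin \o g) ->
  mu.-integrable setT (EFin \o (fun x => f x - g x)).
Proof. by move=> fi gi; exact: (integrableB measurableT fi gi). Qed.

Lemma integrableZ_EFin mu (r : R) (f : T -> R) : mu.-integrable setT (EFin \o f) ->
  mu.-integrable setT (EFin \o (fun x => r * f x)).
Proof. by move=> fi; have := @integrableZl _ _ _ mu setT measurableT r _ fi. Qed.

Lemma cmeas_cst z : cmeas (fun _ => z).
Proof. by split; exact: measurable_cst. Qed.

Lemma cmeas_real (f : T -> R) : measurable_fun setT f -> cmeas (fun x => (f x)%:C).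
Proof. by split => //=; exact: measurable_cst. Qed.

Lemma cmeasD f g : cmeas f -> cmeas g -> cmeas (fun x => f x + g x).
Proof.
move=> [f1 f2] [g1 g2]; split.
  by under eq_fun do rewrite raddfD; apply: measurable_funD.
by under eq_fun do rewrite raddfD; apply: measurable_funD.
Qed.

Lemma cmeasN f : cmeas f -> cmeas (fun x => - f x).
Proof.
move=> [f1 f2]; split.
  by under eq_fun do rewrite raddfN; apply: measurable_funN.
by under eq_fun do rewrite raddfN; apply: measurable_funN.
Qed.

Lemma cmeasB f g : cmeas f -> cmeas g -> cmeas (fun x => f x - g x).
Proof. by move=> mf mg; apply: cmeasD => //; exact: cmeasN. Qed.

Lemma cmeasM f g : cmeas f -> cmeas g -> cmeas (fun x => f x * g x).
Proof.
move=> [f1 f2] [g1 g2]; split.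
  under eq_fun do rewrite Re_mul.
  by apply: measurable_funB; apply: measurable_funM.
under eq_fun do rewrite Im_mul.
by apply: measurable_funD; apply: measurable_funM.
Qed.

Lemma cmeas_norm1 f : cmeas f -> measurable_fun setT (fun x => norm1 (f x)).
Proof.
by move=> [f1 f2]; apply: measurable_funD; apply: measurableT_comp => //; exact: normr_measurable.
Qed.

Lemma cmeas_if (b : T -> bool) f g : measurable_fun setT b -> cmeas f -> cmeas g ->
  cmeas (fun x => if b x then f x else g x).
Proof.
move=> mb [f1 f2] [g1 g2]; split.
  under eq_fun => x do rewrite (fun_if (@complex.Re R)).
  by apply: measurable_fun_ifT.
under eq_fun => x do rewrite (fun_if (@complex.Im R)).
by apply: measurable_fun_ifT.
Qed.

Lemma cintegrable_le mu f (G : T -> R) : cmeas f ->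
  mu.-integrable setT (EFin \o G) -> (forall x, norm1 (f x) <= G x) ->
  cintegrable mu f.
Proof.
move=> [mf1 mf2] iG fG; split; apply: le_integrable iG => //=.
- exact/measurable_EFinP.
- move=> x _; rewrite lee_fin (le_trans (norm1_Re _))// (le_trans (fG x))// ler_norm//.
- exact/measurable_EFinP.
- move=> x _; rewrite lee_fin (le_trans (norm1_Im _))// (le_trans (fG x))// ler_norm//.
Qed.

Lemma cintegrable_norm1 mu f : cintegrable mu f ->
  mu.-integrable setT (EFin \o (fun x => norm1 (f x))).
Proof.
move=> [i1 i2].
apply: (@integrableD_EFin mu (fun x => `|Re (f x)|) (fun x => `|Im (f x)|)); exact: integrable_norm.
Qed.

Lemma cintegrable_cmeas mu f : cintegrable mu f -> cmeas f.
Proof. by move=> [i1 i2]; split; apply/measurable_EFinP; [exact: measurable_int i1|exact: measurable_int i2]. Qed.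

Lemma cint_norm1 mu f : cintegrable mu f ->
  norm1 (cint mu f) <= \int[mu]_x norm1 (f x).
Proof.
move=> [i1 i2]; rewrite /norm1 /cint /= RintegralD//; try exact: integrable_norm.
by apply: lerD; apply: le_normr_Rintegral.
Qed.

Lemma cintegrable_mulb mu g (u : T -> R[i]) (M : R) : cintegrable mu g -> cmeas u ->
  (forall s, norm1 (u s) <= M) -> cintegrable mu (fun s => g s * u s).
Proof.
move=> ig md dM; apply: (@cintegrable_le mu _ (fun s => M * norm1 (g s))).
- exact: (cmeasM (cintegrable_cmeas ig) md).
- by apply: integrableZ_EFin; exact: cintegrable_norm1.
- move=> s; rewrite mulrC; apply: le_trans (norm1M _ _) _.
  by apply: ler_wpM2r; [exact: norm1_ge0|exact: dM].
Qed.

Lemma cintegrableD mu f g : cintegrable mu f -> cintegrable mu g ->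
  cintegrable mu (fun x => f x + g x).
Proof.
move=> [f1 f2] [g1 g2]; split.
  under [fun x => Re _]eq_fun do rewrite raddfD.
  exact: integrableD_EFin.
under [fun x => Im _]eq_fun do rewrite raddfD.
exact: integrableD_EFin.
Qed.

Lemma cintegrableZ mu z f : cintegrable mu f -> cintegrable mu (fun x => z * f x).
Proof.
move=> [f1 f2]; split.
  under [fun x => Re _]eq_fun do rewrite Re_mul.
  by apply: integrableB_EFin; apply: integrableZ_EFin.
under [fun x => Im _]eq_fun do rewrite Im_mul.
by apply: integrableD_EFin; apply: integrableZ_EFin.
Qed.

Lemma cintD mu f g : cintegrable mu f -> cintegrable mu g ->
  cint mu (fun x => f x + g x) = cint mu f + cint mu g.
Proof.
move=> [f1 f2] [g1 g2]; apply: complexP => /=.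
  by under eq_Rintegral do rewrite raddfD; rewrite RintegralD.
by under eq_Rintegral do rewrite raddfD; rewrite RintegralD.
Qed.

Lemma cintZ mu z f : cintegrable mu f ->
  cint mu (fun x => z * f x) = z * cint mu f.
Proof.
move=> [f1 f2].
apply: complexP; rewrite ?Re_mul ?Im_mul /=.
  under eq_Rintegral do rewrite Re_mul.
  by rewrite RintegralB//; [rewrite !RintegralZl| exact: integrableZ_EFin| exact: integrableZ_EFin].
under eq_Rintegral do rewrite Im_mul.
by rewrite RintegralD//; [rewrite !RintegralZl| exact: integrableZ_EFin| exact: integrableZ_EFin].
Qed.

Lemma cintZr mu z f : cintegrable mu f ->
  cint mu (fun x => f x * z) = cint mu f * z.
Proof. by move=> fi; under [fun _ => _]eq_fun do rewrite mulrC; rewrite cintZ// mulrC. Qed.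

Lemma cintegrableN mu f : cintegrable mu f -> cintegrable mu (fun x => - f x).
Proof.
by move=> fi; under eq_fun do rewrite -mulN1r; exact: cintegrableZ.
Qed.

Lemma cintB mu f g : cintegrable mu f -> cintegrable mu g ->
  cint mu (fun x => f x - g x) = cint mu f - cint mu g.
Proof.
move=> fi gi; rewrite cintD//; last exact: cintegrableN.
by under [X in _ + cint _ X]eq_fun do rewrite -mulN1r; rewrite cintZ// mulN1r.
Qed.

Lemma eq_cint mu f g : f =1 g -> cint mu f = cint mu g.
Proof. by move/funext => ->. Qed.

Lemma cint0 mu : cint mu (fun=> 0) = 0.
Proof. by rewrite /cint /= Rintegral_cst// mul0r. Qed.

Lemma cintegrable0 mu : cintegrable mu (fun=> 0).
Proof. by split; apply: integrable0. Qed.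

Lemma cint_le mu f (G : T -> R) : cmeas f ->
  mu.-integrable setT (EFin \o G) -> (forall x, norm1 (f x) <= G x) ->
  norm1 (cint mu f) <= \int[mu]_x G x.
Proof.
move=> mf iG fG.
have fi : cintegrable mu f by exact: cintegrable_le fG.
rewrite (le_trans (cint_norm1 fi))// le_Rintegral//.
exact: cintegrable_norm1.
Qed.

End CIntegral.

(** * Fubini's theorem and affine substitutions *)

Section Fubini.
Context d1 d2 (T1 : measurableType d1) (T2 : measurableType d2) (R : realType).
Variable m1 : {sigma_finite_measure set T1 -> \bar R}.
Variable m2 : {sigma_finite_measure set T2 -> \bar R}.

Lemma cmeas_comp (phi : T1 -> T2) (f : T2 -> R[i]) :
  cmeas f -> measurable_fun setT phi -> cmeas (f \o phi).
Proof.
by move=> [f1 f2] mphi; split;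
  [exact: (measurableT_comp f1 mphi)|exact: (measurableT_comp f2 mphi)].
Qed.

Lemma measurable_param (h : T1 * T2 -> R) : measurable_fun setT h ->
  measurable_fun setT (fun x => \int[m2]_y h (x, y)).
Proof.
move=> mh; have mh' : measurable_fun setT (EFin \o h) by exact/measurable_EFinP.
apply: (measurableT_comp (@fine_measurable R setT measurableT)) => //.
have -> : (fun x => \int[m2]_y (h (x, y))%:E)%E =
  ((fun x => \int[m2]_y (EFin \o h)^\+ (x, y)) \-
   (fun x => \int[m2]_y (EFin \o h)^\- (x, y)))%E.
  apply/funext => x; rewrite integralE.
  by congr (_ - _)%E; apply: eq_integral => y _; rewrite ?funeposE ?funenegE.
apply: emeasurable_funB.
  by apply: measurable_fun_fubini_tonelli_F => //; exact: measurable_funepos.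
by apply: measurable_fun_fubini_tonelli_F => //; exact: measurable_funeneg.
Qed.

Lemma cmeas_param (f : T1 * T2 -> R[i]) :
  cmeas f -> cmeas (fun x => cint m2 (fun y => f (x, y))).
Proof.
move=> [f1 f2]; split => /=.
  exact: (measurable_param f1).
exact: (measurable_param f2).
Qed.

(** A dominating product of integrable functions makes [h] integrable for the
    product measure. Every kernel below is controlled in this way. *)
Lemma RFubini (h : T1 * T2 -> R) (G : T1 -> R) (H : T2 -> R) :
  measurable_fun setT h ->
  m1.-integrable setT (EFin \o G) -> m2.-integrable setT (EFin \o H) ->
  (forall x y, `|h (x, y)| <= G x * H y) ->
  \int[m1]_x (\int[m2]_y h (x, y)) = \int[m2]_y (\int[m1]_x h (x, y)) /\
  m1.-integrable setT (EFin \o (fun x => \int[m2]_y h (x, y))).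
Proof.
move=> mh iG iH hGH.
have mh' : measurable_fun setT (EFin \o h) by exact/measurable_EFinP.
have i2 x : m2.-integrable setT (EFin \o (fun y => h (x, y))).
  apply: (@le_integrable _ _ _ m2 _ _ _ (EFin \o (fun y => G x * H y))) => //.
  - by apply/measurable_EFinP; exact: measurableT_comp mh _.
  - by move=> y _ /=; rewrite lee_fin (le_trans (hGH x y))// ler_norm.
  - exact: integrableZ_EFin.
have i1 y : m1.-integrable setT (EFin \o (fun x => h (x, y))).
  apply: (@le_integrable _ _ _ m1 _ _ _ (EFin \o (fun x => H y * G x))) => //.
  - by apply/measurable_EFinP; exact: measurableT_comp mh _.
  - by move=> x _ /=; rewrite lee_fin mulrC (le_trans (hGH x y))// ler_norm.
  - exact: integrableZ_EFin.
have ih : (m1 \x m2)%E.-integrable setT (EFin \o h).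
  apply/integrable12ltyP => //.
  apply: (@le_lt_trans _ _ (\int[m1]_x (\int[m2]_y (`|G x| * `|H y|)%:E))%E).
    apply: ge0_le_integral => //.
    - by move=> x _; exact: integral_ge0.
    - apply: (measurable_fun_fubini_tonelli_F (abse \o (EFin \o h))) => //=.
      exact: measurableT_comp.
    - apply: (measurable_fun_fubini_tonelli_F (fun z => (`|G z.1| * `|H z.2|)%:E)).
        apply/measurable_EFinP; apply: measurable_funM.
          apply: measurableT_comp => //; apply: (measurableT_comp (f := G)) => //.
          by apply/measurable_EFinP; exact: measurable_int iG.
        apply: measurableT_comp => //; apply: (measurableT_comp (f := H)) => //.
        by apply/measurable_EFinP; exact: measurable_int iH.
      by move=> z; rewrite lee_fin mulr_ge0.
    - move=> x _; apply: ge0_le_integral => //.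
      + by apply: measurableT_comp => //; case/integrableP: (i2 x).
      + apply/measurable_EFinP; apply: measurable_funM => //.
        apply: measurableT_comp => //.
        by apply/measurable_EFinP; exact: measurable_int iH.
      + move=> y _; rewrite /= lee_fin (le_trans (hGH x y))//.
        by rewrite (le_trans (ler_norm _))// normrM.
  have -> : (fun x => (\int[m2]_y (`|G x| * `|H y|)%:E))%E =
      (fun x => (`|G x| * \int[m2]_y `|H y|)%:E).
    apply/funext => x; rewrite EFinM.
    under eq_integral do rewrite EFinM.
    rewrite ge0_integralZl//.
    + congr (_ * _)%E; rewrite /Rintegral fineK//.
      by apply: integrable_fin_num => //; exact: (integrable_norm iH).
    + apply/measurable_EFinP; apply: measurableT_comp => //.
      by apply/measurable_EFinP; exact: measurable_int iH.
  apply: integrable_lty => //; set I := Rintegral _ _ _.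
  rewrite (_ : (fun x => _) = EFin \o (fun x => I * `|G x|)).
    by apply: integrableZ_EFin; exact: (integrable_norm iG).
  by apply/funext => x /=; rewrite mulrC.
have F1 x : (\int[m2]_y (h (x, y))%:E)%E = (\int[m2]_y h (x, y))%:E.
  by rewrite /Rintegral fineK//; apply: integrable_fin_num => //; exact: i2.
have F2 y : (\int[m1]_x (h (x, y))%:E)%E = (\int[m1]_x h (x, y))%:E.
  by rewrite /Rintegral fineK//; apply: integrable_fin_num => //; exact: i1.
split.
  have := Fubini ih; rewrite /=.
  under eq_integral do rewrite F1.
  under [X in _ = X -> _]eq_integral do rewrite F2.
  by move=> E; have := congr1 fine E.
have := integrable_fubini_F ih.
by congr (integrable _ _ _); apply/funext => x; rewrite /= -F1.
Qed.

Lemma cFubini (f : T1 * T2 -> R[i]) (G : T1 -> R) (H : T2 -> R) : cmeas f ->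
  m1.-integrable setT (EFin \o G) -> m2.-integrable setT (EFin \o H) ->
  (forall x y, norm1 (f (x, y)) <= G x * H y) ->
  cint m1 (fun x => cint m2 (fun y => f (x, y))) =
  cint m2 (fun y => cint m1 (fun x => f (x, y))).
Proof.
move=> [f1 f2] iG iH fGH; apply: complexP => /=.
  have := RFubini f1 iG iH _; case=> //.
  by move=> x y; rewrite (le_trans (norm1_Re _)).
have := RFubini f2 iG iH _; case=> //.
by move=> x y; rewrite (le_trans (norm1_Im _)).
Qed.

Lemma cintegrable_param (f : T1 * T2 -> R[i]) (G : T1 -> R) (H : T2 -> R) : cmeas f ->
  m1.-integrable setT (EFin \o G) -> m2.-integrable setT (EFin \o H) ->
  (forall x y, norm1 (f (x, y)) <= G x * H y) ->
  cintegrable m1 (fun x => cint m2 (fun y => f (x, y))).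
Proof.
move=> [f1 f2] iG iH fGH; split.
  have := RFubini f1 iG iH _; case=> //.
  by move=> x y; rewrite (le_trans (norm1_Re _)).
have := RFubini f2 iG iH _; case=> //.
by move=> x y; rewrite (le_trans (norm1_Im _)).
Qed.

End Fubini.

Section Affine.
Variable R : realType.
Notation leb := (@lebesgue_measure R).
Variables (a c : R) (a0 : 0 < a).

Let phi (t : R) : measurableTypeR R := a * t + c.

Let mphi : measurable_fun setT phi.
Proof. by apply: measurable_funD => //; exact: measurable_funM. Qed.

Let phi_itv (x y : R) : phi @^-1` `]x, y]%classic = `](x - c) / a, (y - c) / a]%classic.
Proof.
apply/seteqP; split => t /=; rewrite !in_itv /= /phi.
  by rewrite ltr_pdivrMr// ler_pdivlMr// ltrBlDr lerBrDr mulrC.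
by rewrite ltr_pdivrMr// ler_pdivlMr// ltrBlDr lerBrDr mulrC.
Qed.

Let push : {measure set (measurableTypeR R) -> \bar R}.
Proof.
refine (HB.pack_for {measure set (measurableTypeR R) -> \bar R} (pushforward leb phi)
  (Measure.on (pushforward leb phi))); exact: mphi.
Defined.

Let leb_phi (A : set R) : measurable A ->
  leb A = mscale (NngNum (ltW a0)) push A.
Proof.
move=> mA; apply: lebesgue_measure_unique => // X [[x y]] _ <-.
rewrite [RHS](_ : _ = (a%:E * leb (phi @^-1` `]x, y]%classic))%E)//.
rewrite phi_itv !lebesgue_measure_itv /= !lte_fin.
rewrite ltr_pM2r ?invr_gt0// ltrD2r; case: ifPn => xy; last by rewrite mule0.
rewrite -!EFinB -EFinM; congr EFin; field; exact: lt0r_neq0.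
Qed.

(** Lebesgue measure is [a] times its push-forward under [x |-> a * x + c]: the
    two measures agree on half-open intervals. *)
Lemma ge0_integral_affine (f : R -> \bar R) : measurable_fun setT f ->
  (forall x, 0 <= f x)%E ->
  (\int[leb]_x f x = a%:E * \int[leb]_x f (a * x + c)%R)%E.
Proof.
move=> mf f0; rewrite [LHS](eq_measure_integral (mscale (NngNum (ltW a0)) push)); last first.
  by move=> A mA _; exact: leb_phi.
rewrite ge0_integral_mscale// ge0_integral_pushforward//.
Qed.

Lemma Rintegral_affine (f : R -> R) : measurable_fun setT f ->
  \int[leb]_x f x = a * \int[leb]_x f (a * x + c).
Proof.
move=> mf; have mf' : measurable_fun setT (EFin \o f) by exact/measurable_EFinP.
pose P := (\int[leb]_x (fun x => (f (a * x + c))%:E)^\+ x)%E.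
pose N := (\int[leb]_x (fun x => (f (a * x + c))%:E)^\- x)%E.
have EP : (\int[leb]_x (EFin \o f)^\+ x = a%:E * P)%E.
  rewrite (ge0_integral_affine (measurable_funepos mf'))//.
  by congr (_ * _)%E; apply: eq_integral => x _; rewrite !funeposE.
have EN : (\int[leb]_x (EFin \o f)^\- x = a%:E * N)%E.
  rewrite (ge0_integral_affine (measurable_funeneg mf'))//.
  by congr (_ * _)%E; apply: eq_integral => x _; rewrite !funenegE.
have -> : \int[leb]_x f x = fine (a%:E * P - a%:E * N)%E.
  by rewrite /Rintegral integralE EP EN.
have -> : \int[leb]_x f (a * x + c) = fine (P - N)%E.
  by rewrite /Rintegral integralE.
have : (0 <= P)%E by apply: integral_ge0.
have : (0 <= N)%E by apply: integral_ge0.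
have a0' : (0 < a%:E)%E by rewrite lte_fin.
case: P {EP} => [p| |]; case: N {EN} => [n| |] //= _ _;
  by rewrite ?gt0_muley//= ?mulr0 ?mulrBr.
Qed.

Lemma cint_affine (f : R -> R[i]) : cmeas f ->
  cint leb f = a%:C * cint leb (fun x => f (a * x + c)).
Proof.
move=> [f1 f2]; rewrite [RHS]mulrC; apply: complexP; rewrite /= mulr0 ?subr0 ?add0r [RHS]mulrC.
  exact: (Rintegral_affine f1).
exact: (Rintegral_affine f2).
Qed.

End Affine.

(** * Fixed points in weighted sup-norms *)

Section Halving.
Variable R : realType.

Lemma le0_halving (a C : R) : (forall n : nat, a <= C / 2 ^+ n) -> a <= 0.
Proof.
move=> aC.
have h : geometric C (2^-1 : R) @ \oo --> (0 : R).
  by apply: cvg_geometric; rewrite ger0_norm// invf_lt1// ltr1n.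
apply: (cvgr_to_ge h); apply: nearW => n; rewrite /= exprVn; exact: aC.
Qed.

Lemma halving_dist (u : R ^nat) (C : R) :
  (forall n, `|u n.+1 - u n| <= C / 2 ^+ n) ->
  forall n k, `|u (n + k)%N - u n| <= C * 2 * (2 ^- n - 2 ^- (n + k)).
Proof.
move=> uC n; elim=> [|k IH]; first by rewrite addn0 !subrr normr0 mulr0.
have -> : u (n + k.+1)%N - u n = (u (n + k).+1 - u (n + k)%N) + (u (n + k)%N - u n).
  by rewrite addnS; ring.
apply: le_trans (ler_normD _ _) _; apply: le_trans (lerD (uC _) IH) _.
rewrite addnS exprS invfM le_eqVlt; apply/orP; left; apply/eqP.
have : (2 : R) ^+ (n + k) != 0 by rewrite expf_neq0.
have : (2 : R) ^+ n != 0 by rewrite expf_neq0.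
by move=> h1 h2; field; rewrite h1 h2.
Qed.

Lemma halving_cvg (u : R ^nat) (C : R) :
  (forall n, `|u n.+1 - u n| <= C / 2 ^+ n) ->
  exists2 l, u n @[n --> \oo] --> l & forall n, `|l - u n| <= C * 2 / 2 ^+ n.
Proof.
move=> uC.
have C0 : 0 <= C by have := le_trans (normr_ge0 _) (uC 0%N); rewrite expr0 divr1.
have cu : cvgn u.
  have : cvgn (series (telescope u)).
    apply: normed_cvg; apply: (@series_le_cvg _ _ (geometric C 2^-1)).
    - by move=> n; rewrite /= normr_ge0.
    - by move=> n; rewrite /= mulr_ge0// exprn_ge0.
    - by move=> n; rewrite /= exprVn; exact: uC.
    - by apply: is_cvg_geometric_series; rewrite ger0_norm// invf_lt1// ltr1n.
  rewrite telescopeK => h.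
  have -> : u = (fun n => [sequence u n - u 0%N]_n n + u 0%N).
    by apply/funext => n /=; rewrite subrK.
  by apply: is_cvgD; [exact: h|exact: is_cvg_cst].
exists (limn u) => // n; rewrite distrC.
have h : `|u n - u m| @[m --> \oo] --> `|u n - limn u|.
  by apply: cvg_norm; apply: cvgB => //; exact: cvg_cst.
apply: (cvgr_to_le h); exists n => // m /= nm.
rewrite distrC -(subnKC nm) (le_trans (halving_dist uC _ _))//.
by rewrite ler_wpM2l ?mulr_ge0// gerBl invr_ge0 exprn_ge0.
Qed.

End Halving.

Section FixedPoint.
Context d (T : measurableType d) (R : realType).
Variable om : T -> R.

Definition wbound (C : R) (K : T -> R[i]) := forall z, norm1 (K z) <= C * om z.

Definition good (K : T -> R[i]) := cmeas K /\ exists C, wbound C K.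

Lemma goodB K L : good K -> good L -> good (fun z => K z - L z).
Proof.
move=> [mK [C KC]] [mL [D LD]]; split; first exact: cmeasB.
exists (C + D) => z; rewrite (le_trans (norm1B _ _))// mulrDl lerD//.
Qed.

(** The uniqueness half of the contraction principle. *)
Lemma halving_eq0 (K : T -> R[i]) (C : R) : wbound C K ->
  (forall C, wbound C K -> wbound (C / 2) K) -> forall z, K z = 0.
Proof.
move=> KC Kh z; apply: norm1_eq0.
have H n : wbound (C / 2 ^+ n) K.
  elim: n => [|n IH]; first by rewrite expr0 divr1.
  by rewrite exprSr invfM mulrA; exact: Kh.
apply: (@le0_halving _ _ (C * om z)) => n.
by rewrite mulrAC; exact: H.
Qed.

(** Banach's fixed point theorem for the norm [sup (norm1 K / om)]. The limit is
    taken pointwise, so that measurability in all variables survives. *)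
Lemma weighted_fixpoint (Phi : (T -> R[i]) -> (T -> R[i])) :
  good (Phi (fun=> 0)) ->
  (forall K, good K -> cmeas (Phi K)) ->
  (forall K L C, good K -> good L -> wbound C (fun z => K z - L z) ->
     wbound (C / 2) (fun z => Phi K z - Phi L z)) ->
  exists2 K, good K & forall z, K z = Phi K z.
Proof.
move=> [_ [C0 P0]] Pm Pc.
have g0 : good (fun=> 0).
  split; first exact: cmeas_cst.
  by exists 0 => z; rewrite norm1_0 mul0r.
have Pg K : good K -> good (Phi K).
  move=> gK; split; first exact: Pm.
  have [mK [C KC]] := gK; exists (C / 2 + C0) => z.
  have -> : Phi K z = (Phi K z - Phi (fun=> 0) z) + Phi (fun=> 0) z by rewrite subrK.
  rewrite (le_trans (norm1D _ _))// mulrDl lerD//.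
  by apply: Pc => // w; rewrite subr0.
pose Kn n := iter n Phi (fun=> 0).
have gn n : good (Kn n) by elim: n => [//|n IH]; rewrite /Kn iterS; exact: Pg.
have dn n : wbound (C0 / 2 ^+ n) (fun z => Kn n.+1 z - Kn n z).
  elim: n => [|n IH].
    by rewrite expr0 divr1 => z; rewrite /Kn /= subr0.
  by move=> z; have := Pc _ _ _ (gn n.+1) (gn n) IH z; rewrite exprSr invfM mulrA.
have hR z : exists2 l, Re (Kn n z) @[n --> \oo] --> l &
    forall n, `|l - Re (Kn n z)| <= C0 * om z * 2 / 2 ^+ n.
  apply: halving_cvg => n; rewrite -raddfB (le_trans (norm1_Re _))//.
  by rewrite (le_trans (dn n z))// mulrAC.
have hI z : exists2 l, Im (Kn n z) @[n --> \oo] --> l &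
    forall n, `|l - Im (Kn n z)| <= C0 * om z * 2 / 2 ^+ n.
  apply: halving_cvg => n; rewrite -raddfB (le_trans (norm1_Im _))//.
  by rewrite (le_trans (dn n z))// mulrAC.
pose lR z := projT1 (cid2 (hR z)); pose lI z := projT1 (cid2 (hI z)).
have lR1 z : Re (Kn n z) @[n --> \oo] --> lR z by rewrite /lR; case: cid2.
have lI1 z : Im (Kn n z) @[n --> \oo] --> lI z by rewrite /lI; case: cid2.
have lR2 z n : `|lR z - Re (Kn n z)| <= C0 * om z * 2 / 2 ^+ n.
  by rewrite /lR; case: cid2.
have lI2 z n : `|lI z - Im (Kn n z)| <= C0 * om z * 2 / 2 ^+ n.
  by rewrite /lI; case: cid2.
pose K z := lR z +i* lI z.
have KKn n : wbound (C0 * 4 / 2 ^+ n) (fun z => K z - Kn n z).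
  move=> z; rewrite /norm1 !raddfB /= (le_trans (lerD (lR2 z n) (lI2 z n)))//.
  by rewrite le_eqVlt; apply/orP; left; apply/eqP; field; rewrite expf_neq0.
have gK : good K.
  split.
    split; rewrite /K /=.
      by apply: (@measurable_fun_cvg _ _ _ _ (fun n z => Re (Kn n z))) => // n; case: (gn n) => -[].
    by apply: (@measurable_fun_cvg _ _ _ _ (fun n z => Im (Kn n z))) => // n; case: (gn n) => -[].
  exists (C0 * 4 / 2 ^+ 0) => z.
  by have := KKn 0%N z; rewrite /Kn /= subr0.
exists K => // z; apply/eqP; rewrite -subr_eq0; apply/eqP; apply: norm1_eq0.
apply: (@le0_halving _ _ (C0 * om z * 4)) => n.
have -> : K z - Phi K z = (K z - Kn n.+1 z) - (Phi K z - Phi (Kn n) z).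
  by rewrite /Kn iterS; ring.
rewrite (le_trans (norm1B _ _))//.
rewrite (le_trans (lerD (KKn n.+1 z) (Pc _ _ _ gK (gn n) (KKn n) z)))//.
by rewrite exprS le_eqVlt; apply/orP; left; apply/eqP; field; rewrite expf_neq0.
Qed.

End FixedPoint.

(** * The transmutation kernel *)

Section Window.
Variable R : realType.
Notation leb := (@lebesgue_measure R).
Implicit Types (t y C x : R).

Lemma integrable_cst_itv (a b C : R) :
  leb.-integrable setT (EFin \o (fun x => C * \1_(`]a, b[%classic) x)).
Proof. by apply: integrableZ_EFin; exact: integrable_indic_itv. Qed.

Lemma Rintegral_cst_itv (a b C : R) :
  \int[leb]_x (C * \1_(`]a, b[%classic) x) = C * Num.max (b - a) 0.
Proof.
rewrite RintegralZl//; last exact: integrable_indic_itv.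
congr (_ * _); rewrite /Rintegral integral_indic// setIT.
transitivity (fine (lebesgue_measure ([set` `]a, b[] : set R))) => //.
rewrite lebesgue_measure_itv /= lte_fin maxC /Num.max.
by case: (ltP a b) => ab; rewrite -?EFinB /=; case: ltP => // h; lra.
Qed.

Lemma window_le (f : R -> R[i]) t y C : (forall x, norm1 (f x) <= C) -> forall x,
  norm1 (if `|t - x| < y then f x else 0) <= C * \1_(`](t - y), (t + y)[%classic) x.
Proof.
move=> fC x; rewrite indicE mem_setE in_itv /= -ltr_distl distrC.
by case: ifP => _; rewrite ?mulr1// norm1_0 mulr0.
Qed.

Lemma measurable_window t y : measurable_fun setT (fun x : R => `|t - x| < y).
Proof.
apply: measurable_fun_ltr => //; apply: measurableT_comp => //.
by apply: measurable_funB.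
Qed.

Lemma cmeas_window (f : R -> R[i]) t y : cmeas f ->
  cmeas (fun x => if `|t - x| < y then f x else 0).
Proof.
move=> mf; apply: (@cmeas_if _ _ _ (fun x : R => `|t - x| < y) f (fun=> 0)) => //.
exact: measurable_window.
Qed.

Lemma cintegrable_window (f : R -> R[i]) t y C : cmeas f ->
  (forall x, norm1 (f x) <= C) ->
  cintegrable leb (fun x => if `|t - x| < y then f x else 0).
Proof.
move=> mf fC; apply: (@cintegrable_le _ _ _ leb _ _ (cmeas_window t y mf) (integrable_cst_itv _ _ C)).
exact: window_le.
Qed.

Lemma cint_window (f : R -> R[i]) t y C : cmeas f -> (forall x, norm1 (f x) <= C) ->
  norm1 (cint leb (fun x => if `|t - x| < y then f x else 0)) <=
  C * (2 * Num.max y 0).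
Proof.
move=> mf fC.
have le := @cint_le _ _ _ leb _ _ (cmeas_window t y mf) (integrable_cst_itv _ _ C) (window_le t y fC).
apply: le_trans le _.
rewrite Rintegral_cst_itv.
have -> : t + y - (t - y) = 2 * y by ring.
have C0 : 0 <= C by rewrite (le_trans (norm1_ge0 (f 0))).
rewrite ler_wpM2l// maxr_pMr ?mulr0//; lra.
Qed.

End Window.

Section Triple.
Context d1 d2 d3 (X : measurableType d1) (Y : measurableType d2) (Z : measurableType d3).

Lemma measurable_fst3 : measurable_fun [set: (X * Y) * Z] (fun p => p.1.1).
Proof. exact: measurableT_comp. Qed.

Lemma measurable_snd3 : measurable_fun [set: (X * Y) * Z] (fun p => p.1.2).
Proof. exact: measurableT_comp. Qed.

Context d4 (W : measurableType d4).

Lemma measurable_fst4 : measurable_fun [set: ((X * Y) * Z) * W] (fun p => p.1.1.1).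
Proof. exact: (measurableT_comp measurable_fst3 measurable_fst). Qed.

Lemma measurable_snd4 : measurable_fun [set: ((X * Y) * Z) * W] (fun p => p.1.1.2).
Proof. exact: (measurableT_comp measurable_snd3 measurable_fst). Qed.

End Triple.

Section Kernel.
Variables (R : realType) (nu : {sigma_finite_measure set (measurableTypeR R) -> \bar R}).
Variables (g : R -> R[i]).
Notation leb := (@lebesgue_measure R).

(** Half the integral of [e^{i rho t}] over [|t - tau| < y] equals
    [e^{i rho tau} sin (rho y) / rho]. Hence inserting
    [u(x) = e^{i rho x} + int K(x,t) e^{i rho t} dt] in
    [u(x) = e^{i rho x} + int_{s < x} sin (rho (x - s)) / rho g(s) u(s) dnu(s)]
    and comparing the coefficients of [e^{i rho t}] gives the equation
    [K = source + transport K], from which [rho] has disappeared. *)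
Definition transport (K : R * R -> R[i]) (z : R * R) : R[i] := (2^-1)%:C *
  cint nu (fun s => g s *
    cint leb (fun tau => if `|z.2 - tau| < z.1 - s then K (s, tau) else 0)).

Definition source (z : R * R) : R[i] := (2^-1)%:C *
  cint nu (fun s => if `|z.2 - s| < z.1 - s then g s else 0).

Hypothesis ig : cintegrable nu g.

Let mg : cmeas g. Proof. exact: cintegrable_cmeas ig. Qed.

Definition mass := \int[nu]_s norm1 (g s).

Lemma mass_ge0 : 0 <= mass.
Proof. by apply: Rintegral_ge0 => s _; exact: norm1_ge0. Qed.

(** The rate is twice the mass of [g nu], which makes [transport] a contraction;
    the summand [1] only keeps it positive. *)
Definition weight (z : R * R) : R := expR ((2 * mass + 1) * z.1).

Lemma weight_gt0 z : 0 < weight z. Proof. exact: expR_gt0. Qed.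

Lemma cmeas_source : cmeas source.
Proof.
apply: cmeasM; first exact: cmeas_cst.
apply: (@cmeas_param _ _ _ _ _ nu (fun p : (R * R) * measurableTypeR R =>
  if `|p.1.2 - p.2| < p.1.1 - p.2 then g p.2 else 0)).
apply: cmeas_if; [|exact: (cmeas_comp mg)|exact: cmeas_cst].
apply: measurable_fun_ltr.
  apply: measurableT_comp => //; apply: measurable_funB => //; exact: measurable_snd3.
apply: measurable_funB => //; exact: measurable_fst3.
Qed.

Lemma cmeas_transport_inner K : cmeas K -> cmeas (fun p : (R * R) * R =>
  cint leb (fun tau => if `|p.1.2 - tau| < p.1.1 - p.2 then K (p.2, tau) else 0)).
Proof.
move=> mK.
apply: (@cmeas_param _ _ _ _ _ leb (fun p : ((R * R) * R) * measurableTypeR R =>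
  if `|p.1.1.2 - p.2| < p.1.1.1 - p.1.2 then K (p.1.2, p.2) else 0)).
apply: cmeas_if; [|apply: (cmeas_comp mK)|exact: cmeas_cst].
  apply: measurable_fun_ltr.
    apply: measurableT_comp => //; apply: measurable_funB => //.
    exact: measurable_snd4.
  apply: measurable_funB => //; last exact: measurable_snd3.
  exact: measurable_fst4.
apply: measurable_fun_pair => //; exact: measurable_snd3.
Qed.

Lemma cmeas_transport K : cmeas K -> cmeas (transport K).
Proof.
move=> mK; apply: cmeasM; first exact: cmeas_cst.
apply: (@cmeas_param _ _ _ _ _ nu (fun p : (R * R) * measurableTypeR R =>
  g p.2 * cint leb (fun tau => if `|p.1.2 - tau| < p.1.1 - p.2 then K (p.2, tau) else 0))).
apply: cmeasM; first exact: (cmeas_comp mg).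
exact: cmeas_transport_inner.
Qed.

Lemma ramp_le_expR (y lam : R) : 0 < lam -> Num.max y 0 <= expR (lam * y) / lam.
Proof.
move=> l0; rewrite ge_max; apply/andP; split.
  by rewrite ler_pdivlMr// mulrC (le_trans _ (expR_ge1Dx _))// lerDr.
by rewrite divr_ge0 ?expR_ge0 ?ltW.
Qed.

Lemma wbound_ge0 C K : wbound weight C K -> 0 <= C.
Proof.
move=> KC; have := le_trans (norm1_ge0 _) (KC (0, 0)).
by rewrite pmulr_lge0// weight_gt0.
Qed.

Lemma inner_le K C (x t s : R) : cmeas K -> wbound weight C K ->
  norm1 (cint leb (fun tau => if `|t - tau| < x - s then K (s, tau) else 0)) <=
  C * 2 / (2 * mass + 1) * weight (x, t).
Proof.
move=> mK KC; have C0 := wbound_ge0 KC.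
have mKs : cmeas (fun tau : R => K (s, tau)) by apply: (cmeas_comp mK).
have l0 : 0 < 2 * mass + 1 by have := mass_ge0; lra.
have Ks tau : norm1 (K (s, tau)) <= C * weight (s, 0) by exact: (KC (s, tau)).
apply: le_trans (cint_window _ _ mKs Ks) _.
apply: (@le_trans _ _ (C * weight (s, 0) * (2 * (expR ((2 * mass + 1) * (x - s)) / (2 * mass + 1))))).
  rewrite ler_wpM2l//; first by rewrite mulr_ge0// ltW// weight_gt0.
  by rewrite ler_wpM2l// ramp_le_expR.
rewrite /weight /= (_ : (2 * mass + 1) * x = (2 * mass + 1) * s + (2 * mass + 1) * (x - s)); last by ring.
rewrite expRD le_eqVlt; apply/orP; left; apply/eqP; field; exact: lt0r_neq0.
Qed.

Lemma transport_integrable K z : good weight K -> cintegrable nu (fun s => g s *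
    cint leb (fun tau => if `|z.2 - tau| < z.1 - s then K (s, tau) else 0)).
Proof.
move=> [mK [C KC]].
apply: (@cintegrable_le _ _ _ nu _ (fun s => C * 2 / (2 * mass + 1) * weight z * norm1 (g s))).
- apply: (cmeasM mg).
  apply: (cmeas_comp (cmeas_transport_inner mK) (phi := fun s : R => (z, s))).
  exact: measurable_fun_pair.
- by apply: integrableZ_EFin; exact: cintegrable_norm1.
- move=> s; rewrite (le_trans (norm1M _ _))// mulrC ler_wpM2r ?norm1_ge0//.
  by case: z => x t; exact: inner_le.
Qed.

(** A window of half-width [x - s] has length at most [2 e^{lam (x - s)} / lam],
    which turns the weight at [s] into the weight at [x] and gains [mass / lam],
    at most [1 / 2]. *)
Lemma transport_le K C : cmeas K -> wbound weight C K ->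
  wbound weight (C / 2) (transport K).
Proof.
move=> mK KC z; have C0 := wbound_ge0 KC.
have gK : good weight K by split => //; exists C.
have l0 : 0 < 2 * mass + 1 by have := mass_ge0; lra.
rewrite /transport mulrC norm1Mr ger0_norm ?invr_ge0//.
apply: (@le_trans _ _ (C * 2 / (2 * mass + 1) * weight z * mass * 2^-1)).
  rewrite ler_wpM2r ?invr_ge0//.
  apply: le_trans (cint_norm1 (transport_integrable z gK)) _.
  rewrite -RintegralZl//; last exact: cintegrable_norm1.
  apply: le_Rintegral => //.
  - exact: cintegrable_norm1 (transport_integrable z gK).
  - by apply: integrableZ_EFin; exact: cintegrable_norm1.
  - move=> s _; rewrite (le_trans (norm1M _ _))// mulrC ler_wpM2r ?norm1_ge0//.
    by case: z => x t; exact: inner_le.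
rewrite (_ : _ * 2^-1 = (C * weight z) * (mass / (2 * mass + 1))); last by field; rewrite lt0r_neq0.
have Cw : 0 <= C * weight z by rewrite mulr_ge0// ltW// weight_gt0.
rewrite [leRHS]mulrAC (ler_wpM2l Cw)// ler_pdivrMr//; have := mass_ge0; lra.
Qed.

Lemma transportB K L : good weight K -> good weight L -> forall z,
  transport (fun z => K z - L z) z = transport K z - transport L z.
Proof.
move=> gK gL z; rewrite /transport -mulrBr -cintB; try exact: transport_integrable.
congr (_ * _); apply: eq_cint => s; rewrite -mulrBr; congr (_ * _).
have [[mK [C KC]] [mL [D LD]]] := (gK, gL).
have mKs : cmeas (fun tau : R => K (s, tau)) by apply: (cmeas_comp mK).
have mLs : cmeas (fun tau : R => L (s, tau)) by apply: (cmeas_comp mL).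
have Ks tau : norm1 (K (s, tau)) <= C * weight (s, 0) by exact: (KC (s, tau)).
have Ls tau : norm1 (L (s, tau)) <= D * weight (s, 0) by exact: (LD (s, tau)).
rewrite -cintB.
- by apply: eq_cint => tau; case: ifP => // _; rewrite subr0.
- exact: (cintegrable_window _ _ mKs Ks).
- exact: (cintegrable_window _ _ mLs Ls).
Qed.

Lemma transport0 z : transport (fun=> 0) z = 0.
Proof.
rewrite /transport (_ : (fun s => _) = (fun=> 0)) ?cint0 ?mulr0//.
apply/funext => s; rewrite (_ : (fun tau => _) = (fun=> 0)) ?cint0 ?mulr0//.
by apply/funext => tau; case: ifP.
Qed.

Lemma source_le z : norm1 (source z) <= 2^-1 * mass.
Proof.
rewrite /source mulrC norm1Mr ger0_norm ?invr_ge0// mulrC ler_wpM2l ?invr_ge0//.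
apply: cint_le; last 2 first.
- exact: cintegrable_norm1.
- by move=> s; case: ifP => // _; rewrite norm1_0 norm1_ge0.
apply: (@cmeas_if _ _ _ (fun s : R => `|z.2 - s| < z.1 - s) g (fun=> 0)) => //.
apply: measurable_fun_ltr; last by apply: measurable_funB.
by apply: measurableT_comp => //; apply: measurable_funB.
Qed.

Hypothesis g_ge0 : forall s, s < 0 -> g s = 0.

(** Imposing [|t| < x] on the iterates puts the support condition into the fixed
    point. *)
Definition cut_step (K : R * R -> R[i]) (z : R * R) : R[i] :=
  if `|z.2| < z.1 then source z + transport K z else 0.

Lemma cut_step_meas K : good weight K -> cmeas (cut_step K).
Proof.
move=> [mK _]; apply: (@cmeas_if _ _ _ (fun z : R * R => `|z.2| < z.1)
  (fun z => source z + transport K z) (fun=> 0)) => //.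
  by apply: measurable_fun_ltr => //; exact: measurableT_comp.
by apply: cmeasD; [exact: cmeas_source|exact: cmeas_transport].
Qed.

Lemma cut_step0 : good weight (cut_step (fun=> 0)).
Proof.
split.
  apply: cut_step_meas; split; first exact: cmeas_cst.
  by exists 0 => z; rewrite norm1_0 mul0r.
exists (2^-1 * mass) => z; rewrite /cut_step transport0 addr0.
have m0 : 0 <= 2^-1 * mass by rewrite mulr_ge0 ?invr_ge0 ?mass_ge0.
case: ifP => zc; last by rewrite norm1_0 mulr_ge0// ltW// weight_gt0.
rewrite (le_trans (source_le z))// ler_peMr// /weight (le_trans _ (expR_ge1Dx _))// lerDl.
have z0 : 0 <= z.1 by rewrite (le_trans (normr_ge0 z.2))// ltW.
by rewrite mulr_ge0//; have := mass_ge0; lra.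
Qed.

Lemma cut_step_contract (K L : R * R -> R[i]) (C : R) :
  good weight K -> good weight L -> wbound weight C (fun z => K z - L z) ->
  wbound weight (C / 2) (fun z => cut_step K z - cut_step L z).
Proof.
move=> gK gL KL z; rewrite /cut_step; case: (_ < _).
  rewrite opprD addrACA subrr add0r -transportB//; apply: transport_le => //.
  by have [mB _] := goodB gK gL.
rewrite subrr norm1_0 mulr_ge0 ?divr_ge0 ?(wbound_ge0 KL)//.
exact/ltW/weight_gt0.
Qed.

(** For [|t| >= x] the windows in [source] and [transport] meet only [s < 0], where
    [g] vanishes, or [|tau| >= s], where [K] vanishes; so the fixed point of the
    truncated map solves the full equation. *)
Lemma kernel_exists : exists K : R * R -> R[i], [/\ good weight K,
  forall z, ~~ (`|z.2| < z.1) -> K z = 0 &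
  forall z, K z = source z + transport K z].
Proof.
have [K gK KE] := weighted_fixpoint cut_step0 cut_step_meas cut_step_contract.
have Ksupp z : ~~ (`|z.2| < z.1) -> K z = 0.
  by move=> zc; rewrite KE /cut_step (negbTE zc).
exists K; split => // z; rewrite {1}KE /cut_step; case: ifPn => // zc; apply/esym.
rewrite -leNgt in zc.
rewrite /source (_ : (fun s => _) = (fun=> 0)); last first.
  apply/funext => s; case: ifPn => // h; apply: g_ge0.
  rewrite ltNge; apply/negP => s0.
  have := ler_normD (z.2 - s) s; rewrite subrK (ger0_norm s0) => h'; lra.
rewrite cint0 mulr0 add0r /transport (_ : (fun s => _) = (fun=> 0)) ?cint0 ?mulr0//.
apply/funext => s; rewrite (_ : (fun tau => _) = (fun=> 0)) ?cint0 ?mulr0//.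
apply/funext => tau; case: ifPn => // h; apply: Ksupp => /=; rewrite -leNgt.
have := ler_normD (z.2 - tau) tau; rewrite subrK => h'; lra.
Qed.

End Kernel.

(** * Exponentials and trigonometric kernels *)

Section ComplexDerivative.
Variable R : realType.
Implicit Types (F f : R -> R[i]) (x : R).
Notation leb := (@lebesgue_measure R).

Lemma patch_itv (h : R -> R) (a c x : R) :
  (h \_ `]a, c[%classic) x = if a < x < c then h x else 0.
Proof. by rewrite /patch mem_setE in_itv. Qed.

Lemma has_deriv_cst z x : has_deriv (fun=> z) x 0.
Proof. by split => /=; exact: is_derive_cst. Qed.

Lemma has_derivD F f x (d e : R[i]) : has_deriv F x d -> has_deriv f x e ->
  has_deriv (fun t => F t + f t) x (d + e).
Proof.
move=> [F1 F2] [f1 f2]; split.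
  by under eq_fun do rewrite raddfD; rewrite raddfD; apply: is_deriveD.
by under eq_fun do rewrite raddfD; rewrite raddfD; apply: is_deriveD.
Qed.

Lemma has_derivM F f x (d e : R[i]) : has_deriv F x d -> has_deriv f x e ->
  has_deriv (fun t => F t * f t) x (d * f x + F x * e).
Proof.
move=> [F1 F2] [f1 f2]; split.
  under eq_fun do rewrite Re_mul.
  apply: (is_derive_eq (is_deriveB (is_deriveM F1 f1) (is_deriveM F2 f2))).
  by rewrite Re_add !Re_mul /GRing.scale /=; ring.
under eq_fun do rewrite Im_mul.
apply: (is_derive_eq (is_deriveD (is_deriveM F1 f2) (is_deriveM F2 f1))).
by rewrite Im_add !Im_mul /GRing.scale /=; ring.
Qed.

Lemma has_derivZ F x (z d : R[i]) : has_deriv F x d ->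
  has_deriv (fun t => z * F t) x (z * d).
Proof.
move=> dF; have := has_derivM (has_deriv_cst z x) dF.
by rewrite mul0r add0r.
Qed.

Lemma has_deriv_affine x (a c : R) : has_deriv (fun t => (a * t + c)%:C) x a%:C.
Proof.
split => /=; last exact: is_derive_cst.
apply: (is_derive_eq (is_deriveD (is_deriveZ a (is_derive_id x 1)) (is_derive_cst c x 1))).
by rewrite /GRing.scale /= mulr1 addr0.
Qed.

Lemma has_deriv_comp F x (a c : R) (d : R[i]) : has_deriv F (a * x + c) d ->
  has_deriv (fun t => F (a * t + c)) x (a%:C * d).
Proof.
move=> [F1 F2].
have A : is_derive x (1 : R) (fun t => a * t + c) a.
  apply: (is_derive_eq (is_deriveD (is_deriveZ a (is_derive_id x 1)) (is_derive_cst c x 1))).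
  by rewrite /GRing.scale /= mulr1 addr0.
rewrite mulrC; split; rewrite ?Re_mulr ?Im_mulr.
  exact: (@is_derive1_comp _ (fun t => Re (F t)) (fun t => a * t + c)).
exact: (@is_derive1_comp _ (fun t => Im (F t)) (fun t => a * t + c)).
Qed.

Lemma has_deriv_continuous F x (d : R[i]) : has_deriv F x d ->
  {for x, continuous (fun t => Re (F t))} /\ {for x, continuous (fun t => Im (F t))}.
Proof.
by move=> [[F1 _] [F2 _]]; split; apply/differentiable_continuous/derivable1_diffP.
Qed.

Lemma cmeas_deriv F f : (forall x, has_deriv F x (f x)) -> cmeas F.
Proof.
move=> dF; split; apply: continuous_measurable_fun => x;
  by have [] := has_deriv_continuous (dF x).
Qed.

Lemma Rint_FTC (H h : R -> R) (a c : R) : a <= c ->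
  (forall x, is_derive x (1 : R) H (h x)) -> continuous h ->
  \int[leb]_x (if a < x < c then h x else 0) = H c - H a.
Proof.
rewrite le_eqVlt => /predU1P[<- _ _|ac dH ch].
  rewrite subrr (_ : (fun x => _) = (fun=> 0)) ?Rintegral_cst ?mul0r//.
  by apply/funext => x; case: ifP => // /andP[h1 h2]; have := lt_trans h1 h2; rewrite ltxx.
have cH : continuous H.
  by move=> x; apply/differentiable_continuous/derivable1_diffP; case: (dH x).
transitivity (\int[leb]_(x in `]a, c[) h x).
  rewrite [RHS]Rintegral_mkcond; congr (Rintegral _ _ _); apply/funext => x.
  exact/esym/patch_itv.
have ih : leb.-integrable `[a, c] (EFin \o h).
  apply: continuous_compact_integrable; first exact: segment_compact.
  by apply: continuous_subspaceT => x; exact: ch.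
rewrite Rintegral_itv_obnd_cbnd; last by apply: integrableS ih => //; exact: subset_itvW.
rewrite Rintegral_itv_bndo_bndc; last first.
  by apply: integrableS ih => // x /=; rewrite !in_itv /= => /andP[-> /ltW ->].
rewrite /Rintegral (@continuous_FTC2 _ h H)//.
- by apply: continuous_subspaceT => x; exact: ch.
- split.
  + by move=> x _; case: (dH x).
  + by apply: cvg_at_right_filter; exact: cH.
  + by apply: cvg_at_left_filter; exact: cH.
- by move=> x _; rewrite derive1E; case: (dH x).
Qed.

Lemma cFTC F f f' (a c : R) : a <= c -> (forall x, has_deriv F x (f x)) ->
  (forall x, has_deriv f x (f' x)) ->
  cint leb (fun x => if a < x < c then f x else 0) = F c - F a.
Proof.
move=> ac dF df; apply: complexP; rewrite /= raddfB /=.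
  under eq_Rintegral do rewrite (fun_if (@complex.Re R)).
  apply: (Rint_FTC ac (H := fun x => Re (F x)) (h := fun x => Re (f x))) => x.
    by have [] := dF x.
  by have [] := has_deriv_continuous (df x).
under eq_Rintegral do rewrite (fun_if (@complex.Im R)).
apply: (Rint_FTC ac (H := fun x => Im (F x)) (h := fun x => Im (f x))) => x.
  by have [] := dF x.
by have [] := has_deriv_continuous (df x).
Qed.

End ComplexDerivative.

Section Exponential.
Variables (R : realType) (rho : R[i]).
Implicit Types s t x y : R.

Definition ex t : R[i] := cexp ('i%C * rho * t%:C).

Lemma exE t : ex t = (expR (- Im rho * t))%:C * (cos (Re rho * t) +i* sin (Re rho * t)).
Proof.
rewrite /ex /cexp Re_mulr Im_mulr Re_mul Im_mul /=.
by rewrite !mul0r !mul1r !add0r.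
Qed.

Lemma ex0 : ex 0 = 1.
Proof. by rewrite exE !mulr0 expR0 cos0 sin0 mul1r. Qed.

Lemma exD s t : ex (s + t) = ex s * ex t.
Proof.
rewrite !exE !mulrDr expRD cosD sinD.
by apply: complexP; rewrite ?Re_mul ?Im_mul /= ?Re_mul ?Im_mul /=; ring.
Qed.

Lemma has_deriv_ex x : has_deriv ex x ('i%C * rho * ex x).
Proof.
have dl (a : R) : is_derive x (1 : R) (fun t => a * t) a.
  apply: (is_derive_eq (is_deriveZ a (is_derive_id x 1))).
  by rewrite /GRing.scale /= mulr1.
have dE := @is_derive1_comp _ expR (fun t => - Im rho * t) x _ _ (is_derive_expR _) (dl _).
have dC := @is_derive1_comp _ cos (fun t => Re rho * t) x _ _ (is_derive_cos _) (dl _).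
have dS := @is_derive1_comp _ sin (fun t => Re rho * t) x _ _ (is_derive_sin _) (dl _).
split.
  have -> : (fun t => Re (ex t)) = (expR \o (fun t => - Im rho * t)) * (cos \o (fun t => Re rho * t)).
    by apply/funext => t; rewrite exE Re_mul /= mul0r subr0.
  apply: (is_derive_eq (is_deriveM dE dC)).
  by rewrite exE !(Re_mul, Im_mul) /= /GRing.scale /=; ring.
have -> : (fun t => Im (ex t)) = (expR \o (fun t => - Im rho * t)) * (sin \o (fun t => Re rho * t)).
  by apply/funext => t; rewrite exE Im_mul /= mul0r addr0.
apply: (is_derive_eq (is_deriveM dE dS)).
by rewrite exE !(Re_mul, Im_mul) /= /GRing.scale /=; ring.
Qed.

Lemma cmeas_ex : cmeas ex. Proof. exact: cmeas_deriv has_deriv_ex. Qed.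

(** [cos (rho y)] *)
Definition Cs y : R[i] := (2^-1)%:C * (ex y + ex (- y)).

(** [sin (rho y) / rho], continued by [y] to [rho = 0] *)
Definition Sn y : R[i] :=
  if rho == 0 then y%:C else (2^-1)%:C * ('i%C * rho)^-1 * (ex y - ex (- y)).

Lemma has_deriv_exN x : has_deriv (fun t => ex (- t)) x (- ('i%C * rho * ex (- x))).
Proof.
have h : has_deriv ex (-1 * x + 0) ('i%C * rho * ex (- x)).
  by rewrite mulN1r addr0; exact: has_deriv_ex.
have := has_deriv_comp h.
under [fun t => ex (_ * t + 0)]eq_fun do rewrite mulN1r addr0.
by rewrite rmorphN1 mulN1r.
Qed.

Lemma i_neq0 : 'i%C != 0 :> R[i].
Proof. by rewrite eq_complex /= oner_eq0 andbF. Qed.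

Lemma has_deriv_Sn x : has_deriv Sn x (Cs x).
Proof.
rewrite /Sn; have [r0|r0] := eqVneq rho 0.
  have -> : Cs x = 1.
    rewrite /Cs !exE r0 /= !oppr0 !mul0r expR0 cos0 sin0 mul1r.
    by apply: complexP; rewrite ?Re_mul ?Im_mul /=; [field|ring].
  have := has_deriv_affine x 1 0.
  by under [fun t => (_ * t + _)%:C]eq_fun do rewrite mul1r addr0.
have := has_derivZ ((2^-1)%:C * ('i%C * rho)^-1)
  (has_derivD (has_deriv_ex x) (has_derivZ (-1) (has_deriv_exN x))).
under [fun t => _ * (_ + _)]eq_fun do rewrite mulN1r.
by congr has_deriv; rewrite /Cs; field; rewrite r0 i_neq0.
Qed.

Lemma has_deriv_Cs x : has_deriv Cs x (- rho ^+ 2 * Sn x).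
Proof.
have := has_derivZ (2^-1)%:C (has_derivD (has_deriv_ex x) (has_deriv_exN x)).
congr has_deriv; rewrite -mulrBr /Sn; case: eqP => [->|/eqP r0].
  by rewrite mulr0 mul0r mulr0 expr2 mul0r oppr0 mul0r.
have -> : - rho ^+ 2 = ('i%C * rho) ^+ 2 by rewrite exprMn sqr_i mulN1r.
by field; rewrite r0 i_neq0.
Qed.

End Exponential.

Section ExponentialIntegrals.
Variables (R : realType) (rho : R[i]).
Notation leb := (@lebesgue_measure R).
Notation ex := (ex rho).
Notation Cs := (Cs rho).
Notation Sn := (Sn rho).
Implicit Types s t x y r : R.

Lemma Sn0 : Sn 0 = 0.
Proof. by rewrite /Sn; case: eqP => // _; rewrite oppr0 subrr mulr0. Qed.

Lemma Cs0 : Cs 0 = 1.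
Proof.
by rewrite /Cs oppr0 ex0; field.
Qed.

Definition ex_primitive t : R[i] := if rho == 0 then t%:C else ('i%C * rho)^-1 * ex t.

Lemma has_deriv_ex_primitive x : has_deriv ex_primitive x (ex x).
Proof.
rewrite /ex_primitive; have [r0|r0] := eqVneq rho 0.
  have -> : ex x = 1 by rewrite /ex r0 mulr0 mul0r /cexp /= expR0 cos0 sin0 mul1r.
  have := has_deriv_affine x 1 0.
  by under [fun t => (_ * t + _)%:C]eq_fun do rewrite mul1r addr0.
have := has_derivZ ('i%C * rho)^-1 (has_deriv_ex rho x).
by congr has_deriv; field; rewrite r0 i_neq0.
Qed.

Lemma ex_primitive_sym t y : ex_primitive (t + y) - ex_primitive (t - y) = 2 * (ex t * Sn y).
Proof.
rewrite /ex_primitive /Sn; have [r0|r0] := eqVneq rho 0.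
  have -> : ex t = 1 by rewrite /ex r0 mulr0 mul0r /cexp /= expR0 cos0 sin0 mul1r.
  by apply: complexP; rewrite /=; ring.
by rewrite !exD; field; rewrite r0 i_neq0.
Qed.

(** The identity that turns variation of constants into the equation of the
    kernel. *)
Lemma cint_window_ex t y : 0 <= y ->
  cint leb (fun x => if `|x - t| < y then ex x else 0) = 2 * (ex t * Sn y).
Proof.
move=> y0; rewrite -ex_primitive_sym -(@cFTC _ ex_primitive ex _ (t - y) (t + y) _ has_deriv_ex_primitive (has_deriv_ex rho)); last lra.
by apply: eq_cint => x; rewrite -ltr_distl.
Qed.

Lemma has_deriv_shift (F : R -> R[i]) x r (d : R[i]) : has_deriv F (x - r) d ->
  has_deriv (fun t => F (t - r)) x d.
Proof.
move=> dF; have dF' : has_deriv F (1 * x + - r) d by rewrite mul1r.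
have := has_deriv_comp dF'; rewrite rmorph1 mul1r.
by under [fun t => F _]eq_fun do rewrite mul1r.
Qed.

Lemma has_deriv_ramp x y : has_deriv (fun t => (y - t)%:C) x (-1).
Proof.
have := has_deriv_affine x (-1) y; rewrite rmorphN1.
by under [fun t => _%:C]eq_fun do rewrite mulN1r addrC.
Qed.

Lemma cint_ramp_Sn r x : r <= x ->
  cint leb (fun s => if r < s < x then - rho ^+ 2 * ((x - s)%:C * Sn (s - r)) else 0) =
  Sn (x - r) - (x - r)%:C.
Proof.
move=> rx.
pose F s := (x - s)%:C * Cs (s - r) + Sn (s - r).
have dS s := has_deriv_shift (has_deriv_Sn rho (s - r)).
have dC s := has_deriv_shift (has_deriv_Cs rho (s - r)).
have dF s : has_deriv F s (- rho ^+ 2 * ((x - s)%:C * Sn (s - r))).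
  have := has_derivD (has_derivM (has_deriv_ramp s x) (dC s)) (dS s).
  by congr has_deriv; ring.
rewrite (cFTC rx dF (fun s => has_derivZ _ (has_derivM (has_deriv_ramp s x) (dS s)))).
by rewrite /F !subrr Cs0 Sn0 mul0r add0r mulr1 addr0.
Qed.

Lemma cint_Sn r x : r <= x ->
  cint leb (fun s => if r < s < x then - rho ^+ 2 * Sn (s - r) else 0) = Cs (x - r) - 1.
Proof.
move=> rx.
have dS s := has_deriv_shift (has_deriv_Sn rho (s - r)).
have dC s := has_deriv_shift (has_deriv_Cs rho (s - r)).
by rewrite (cFTC rx dC (fun s => has_derivZ _ (dS s))) subrr Cs0.
Qed.

Lemma cint_ramp_ex x : 0 <= x ->
  cint leb (fun s => if 0 < s < x then - rho ^+ 2 * ((x - s)%:C * ex s) else 0) =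
  ex x - 1 - 'i%C * rho * x%:C.
Proof.
move=> x0.
pose F s := (x - s)%:C * ('i%C * rho * ex s) + ex s.
have dE s := has_deriv_ex rho s.
have dF s : has_deriv F s (- rho ^+ 2 * ((x - s)%:C * ex s)).
  have := has_derivD (has_derivM (has_deriv_ramp s x) (has_derivZ ('i%C * rho) (dE s))) (dE s).
  have -> : - rho ^+ 2 = ('i%C * rho) ^+ 2 by rewrite exprMn sqr_i mulN1r.
  by congr has_deriv; ring.
rewrite (cFTC x0 dF (fun s => has_derivZ _ (has_derivM (has_deriv_ramp s x) (dE s)))).
by rewrite /F subrr subr0 ex0 mul0r add0r; ring.
Qed.

Lemma cint_ex x : 0 <= x ->
  cint leb (fun s => if 0 < s < x then - rho ^+ 2 * ex s else 0) =
  'i%C * rho * ex x - 'i%C * rho.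
Proof.
move=> x0; have dE s := has_deriv_ex rho s.
have dF s : has_deriv (fun t => 'i%C * rho * ex t) s (- rho ^+ 2 * ex s).
  have := has_derivZ ('i%C * rho) (dE s).
  have -> : - rho ^+ 2 = ('i%C * rho) ^+ 2 by rewrite exprMn sqr_i mulN1r.
  by congr has_deriv; ring.
by rewrite (cFTC x0 dF (fun s => has_derivZ _ (dE s))) ex0 mulr1.
Qed.

Definition expbound x := 2 * expR (`|Im rho| * x).

Lemma expbound_ge0 x : 0 <= expbound x.
Proof. by rewrite /expbound mulr_ge0// expR_ge0. Qed.

Lemma ex_bound t x : `|t| <= x -> norm1 (ex t) <= expbound x.
Proof.
move=> tx; rewrite exE mulrC norm1Mr mulrC [leRHS]mulrC.
rewrite ger0_norm ?expR_ge0// ler_pM ?expR_ge0 ?norm1_ge0//.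
  rewrite ler_expR (le_trans (ler_norm _))// normrM normrN ler_wpM2l//.
rewrite /norm1 /= -[leRHS]/(1 + 1) lerD// ler_norml ?cos_le1 ?cos_geN1 ?sin_le1 ?sin_geN1//.
Qed.

Lemma norm1_half : norm1 ((2^-1)%:C : R[i]) = 2^-1.
Proof. by rewrite norm1_real ger0_norm// invr_ge0. Qed.

Lemma Cs_bound t x : `|t| <= x -> norm1 (Cs t) <= expbound x.
Proof.
move=> tx; rewrite /Cs (le_trans (norm1M _ _))// norm1_half ler_pdivrMl// mulr_natl mulr2n.
by rewrite (le_trans (norm1D _ _))// lerD// ex_bound// normrN.
Qed.

Lemma Sn_bound t x : 0 <= t <= x -> norm1 (Sn t) <= expbound x * t.
Proof.
move=> /andP[t0 tx].
have E0 := expbound_ge0 x.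
have := @cint_window _ (fun s => if `|s| <= x then ex s else 0) 0 t (expbound x).
have -> : (fun s => if `|0 - s| < t then if `|s| <= x then ex s else 0 else 0) =
  (fun s => if `|s - 0| < t then ex s else 0).
  by apply/funext => s; rewrite distrC subr0; case: ifP => // /ltW st; rewrite (le_trans st tx).
rewrite cint_window_ex// ex0 mul1r => h.
have {h} := h _ _; rewrite max_l// => h.
have : norm1 (2 * Sn t) <= expbound x * (2 * t).
  apply: h.
    apply: (@cmeas_if _ _ _ (fun s : R => `|s| <= x)) => //; last exact: cmeas_ex.
    by apply: measurable_fun_ler => //; exact: normr_measurable.
  by move=> s; case: ifP => [|_]; [exact: ex_bound|rewrite norm1_0].
have -> : 2 * Sn t = Sn t * (2%:R)%:C by rewrite mulrC; congr (_ * _); rewrite rmorph_nat.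
rewrite norm1Mr ger0_norm// => h2; rewrite -(ler_pM2r (ltr0n R 2)); lra.
Qed.

Lemma cmeas_Sn : cmeas Sn. Proof. exact: cmeas_deriv (has_deriv_Sn rho). Qed.

Lemma cmeas_Cs : cmeas Cs. Proof. exact: cmeas_deriv (has_deriv_Cs rho). Qed.

End ExponentialIntegrals.

(** * The transmuted exponential *)

Section Swap.
Variables (R : realType) (nu : {sigma_finite_measure set (measurableTypeR R) -> \bar R}).
Variables (g : R -> R[i]) (ig : cintegrable nu g).
Notation leb := (@lebesgue_measure R).
Variables (F : R * R -> R[i]) (D : R) (mF : cmeas F) (FD : forall z, norm1 (F z) <= D).
Variables (e : R -> R[i]) (M x : R) (me : cmeas e).
Hypothesis eM : forall t, norm1 (e t) <= M * \1_(`]- x, x[%classic) t.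

Let mg : cmeas g. Proof. exact: cintegrable_cmeas ig. Qed.

Let f (z : R * R) := (2^-1)%:C * (g z.1 * F z) * e z.2.

Let mf : cmeas f.
Proof.
apply: cmeasM; last exact: (cmeas_comp me).
apply: cmeasM; first exact: cmeas_cst.
by apply: cmeasM => //; exact: (cmeas_comp mg).
Qed.

Let fle s t : norm1 (f (s, t)) <= (D * norm1 (g s)) * (M * \1_(`]- x, x[%classic) t).
Proof.
rewrite /f /= (le_trans (norm1M _ _))// ler_pM ?norm1_ge0//.
rewrite (le_trans (norm1M _ _))// norm1_half.
have h : norm1 (g s * F (s, t)) <= D * norm1 (g s).
  by rewrite (le_trans (norm1M _ _))// mulrC ler_wpM2r ?norm1_ge0.
by have := norm1_ge0 (g s * F (s, t)); lra.
Qed.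

Let iG : nu.-integrable setT (EFin \o (fun s => D * norm1 (g s))).
Proof. by apply: integrableZ_EFin; exact: cintegrable_norm1. Qed.

Let iH : leb.-integrable setT (EFin \o (fun t => M * \1_(`]- x, x[%classic) t)).
Proof. exact: integrable_cst_itv. Qed.

Let inner_nu t : cint nu (fun s => f (s, t)) =
  ((2^-1)%:C * cint nu (fun s => g s * F (s, t))) * e t.
Proof.
have i1 : cintegrable nu (fun s => g s * F (s, t)).
  apply: (@cintegrable_le _ _ _ nu _ (fun s => D * norm1 (g s))) => //.
    apply: (cmeasM mg); apply: (cmeas_comp mF); exact: measurable_fun_pair.
  by move=> s; rewrite (le_trans (norm1M _ _))// mulrC ler_wpM2r ?norm1_ge0.
by rewrite -cintZ// -cintZr//; exact: cintegrableZ.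
Qed.

Let iFe s : cintegrable leb (fun t => F (s, t) * e t).
Proof.
apply: (@cintegrable_le _ _ _ leb _ (fun t => D * (M * \1_(`]- x, x[%classic) t))).
- apply: cmeasM => //; apply: (cmeas_comp mF); exact: measurable_fun_pair.
- exact: integrableZ_EFin.
- by move=> t; rewrite (le_trans (norm1M _ _))// ler_pM ?norm1_ge0.
Qed.

Let inner_leb s : cint leb (fun t => f (s, t)) =
  (2^-1)%:C * (g s * cint leb (fun t => F (s, t) * e t)).
Proof.
rewrite mulrA -cintZ//; apply: eq_cint => t; rewrite /f /=; ring.
Qed.

Lemma swap_integrable_nu :
  cintegrable nu (fun s => (2^-1)%:C * (g s * cint leb (fun t => F (s, t) * e t))).
Proof.
have := @cintegrable_param _ _ _ _ _ nu leb f _ _ mf iG iH fle.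
by congr cintegrable; apply/funext => s; exact: inner_leb.
Qed.

Lemma swap_integrable_leb :
  cintegrable leb (fun t => ((2^-1)%:C * cint nu (fun s => g s * F (s, t))) * e t).
Proof.
have mf' : cmeas (fun z : R * R => f (z.2, z.1)).
  by apply: (cmeas_comp mf (phi := fun z => (z.2, z.1))); exact: measurable_fun_pair.
have := @cintegrable_param _ _ _ _ _ leb nu (fun z => f (z.2, z.1)) _ _ mf' iH iG.
have h t s : norm1 (f (s, t)) <= (M * \1_(`]- x, x[%classic) t) * (D * norm1 (g s)).
  by rewrite mulrC.
by move=> /(_ h); congr cintegrable; apply/funext => t; exact: inner_nu.
Qed.

(** The two terms of the equation of [K] and the kernel of the derivative are all
    superpositions of this form, integrated against a truncated exponential. *)
Lemma swap :
  cint leb (fun t => ((2^-1)%:C * cint nu (fun s => g s * F (s, t))) * e t) =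
  cint nu (fun s => (2^-1)%:C * (g s * cint leb (fun t => F (s, t) * e t))).
Proof.
have := @cFubini _ _ _ _ _ nu leb f _ _ mf iG iH fle.
have -> : (fun x => cint leb (fun y => f (x, y))) =
  (fun s => (2^-1)%:C * (g s * cint leb (fun t => F (s, t) * e t))).
  by apply/funext => s; exact: inner_leb.
have -> : (fun y => cint nu (fun x => f (x, y))) =
  (fun t => ((2^-1)%:C * cint nu (fun s => g s * F (s, t))) * e t).
  by apply/funext => t; exact: inner_nu.
by [].
Qed.

End Swap.

Section Transmutation.
Variables (R : realType) (nu : {sigma_finite_measure set (measurableTypeR R) -> \bar R}).
Variables (g : R -> R[i]) (ig : cintegrable nu g).
Hypothesis g_ge0 : forall s, s < 0 -> g s = 0.
Notation leb := (@lebesgue_measure R).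
Notation wt := (weight nu g).
Variables (K : R * R -> R[i]) (gK : good wt K).
Hypothesis Ksupp : forall z, ~~ (`|z.2| < z.1) -> K z = 0.
Hypothesis KE : forall z, K z = source nu g z + transport nu g K z.
Variable rho : R[i].
Notation ex := (ex rho).
Notation Sn := (Sn rho).

Let mK : cmeas K. Proof. by case: gK. Qed.

(** The truncation of [ex] to the support of [K (x, _)] is integrable on the whole
    line. *)
Definition cut x t : R[i] := if `|t| < x then ex t else 0.

Lemma cmeas_cut x : cmeas (cut x).
Proof.
apply: (@cmeas_if _ _ _ (fun t : R => `|t| < x)) => //; last exact: cmeas_ex.
by apply: measurable_fun_ltr => //; exact: normr_measurable.
Qed.

Lemma cut_le x t : norm1 (cut x t) <= expbound rho x * \1_(`]- x, x[%classic) t.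
Proof.
rewrite indicE mem_setE in_itv /= -ltr_norml /cut.
by case: ifP => [/ltW tx|_]; rewrite ?mulr1 ?ex_bound// norm1_0 mulr0.
Qed.

Lemma cut_bound x t : norm1 (cut x t) <= expbound rho x.
Proof.
apply: le_trans (cut_le x t) _; apply: ler_piMr; first exact: expbound_ge0.
by rewrite indicE; case: (_ \in _).
Qed.

Definition psiK x := cint leb (fun t => K (x, t) * ex t).

(** The image of [e^{i rho x}] under the transmutation operator with kernel [K]. *)
Definition psi x := ex x + psiK x.

Lemma psiK_cut x : psiK x = cint leb (fun t => K (x, t) * cut x t).
Proof.
apply: eq_cint => t; rewrite /cut; case: ifPn => // tx.
by rewrite Ksupp// !mul0r.
Qed.

Lemma cint_cut x s t : `|t| <= s ->
  cint leb (fun u => if `|u - t| < x - s then cut x u else 0) =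
  if s < x then 2 * (ex t * Sn (x - s)) else 0.
Proof.
move=> ts; case: ifPn => sx; last first.
  rewrite (_ : (fun u => _) = (fun=> 0)) ?cint0//; apply/funext => u.
  rewrite ltNge (le_trans _ (normr_ge0 _))// subr_le0 leNgt//.
rewrite -cint_window_ex ?subr_ge0 ?ltW//; apply: eq_cint => u; rewrite /cut.
case: ifP => // h; rewrite ifT//.
have := ler_normD (u - t) t; rewrite subrK => h'; lra.
Qed.

Lemma source_cint z : source nu g z = (2^-1)%:C *
  cint nu (fun s => g s * (if `|z.2 - s| < z.1 - s then 1 else 0)).
Proof.
by congr (_ * _); apply: eq_cint => s; case: ifP; rewrite ?mulr1 ?mulr0.
Qed.

Lemma cmeas_cone (x : R) : cmeas (fun z : R * R => (if `|z.2 - z.1| < x - z.1 then 1 else 0 : R[i])).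
Proof.
apply: (@cmeas_if _ _ _ (fun z : R * R => `|z.2 - z.1| < x - z.1)); try exact: cmeas_cst.
apply: measurable_fun_ltr; last exact: measurable_funB.
by apply: measurableT_comp => //; exact: measurable_funB.
Qed.

Definition inner x (z : R * R) : R[i] :=
  cint leb (fun tau => if `|z.2 - tau| < x - z.1 then K (z.1, tau) else 0).

Lemma cmeas_inner x : cmeas (inner x).
Proof.
apply: (cmeas_comp (cmeas_transport_inner mK) (phi := fun z : R * R => ((x, z.2), z.1))).
by apply: measurable_fun_pair => //; exact: measurable_fun_pair.
Qed.

Lemma inner_cut x s : cint leb (fun t => inner x (s, t) * cut x t) =
  if s < x then 2 * (Sn (x - s) * psiK s) else 0.
Proof.
have [_ [C KC]] := gK.
have mKs : cmeas (fun t : R => K (s, t)) by apply: (cmeas_comp mK); exact: measurable_fun_pair.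
have Ks tau : norm1 (K (s, tau)) <= C * wt (s, 0) by exact: (KC (s, tau)).
have Ks' tau : norm1 (K (s, tau)) <= C * wt (s, 0) * \1_(`]- s, s[%classic) tau.
  rewrite indicE mem_setE in_itv /= -ltr_norml.
  by case: (boolP (`|tau| < s)) => h; rewrite ?mulr1// Ksupp// norm1_0 mulr0.
pose f (z : R * R) := (if `|z.1 - z.2| < x - s then K (s, z.2) else 0) * cut x z.1.
have mf : cmeas f.
  apply: cmeasM; last exact: (cmeas_comp (cmeas_cut x)).
  apply: (@cmeas_if _ _ _ (fun z : R * R => `|z.1 - z.2| < x - s)).
  - apply: measurable_fun_ltr => //; apply: measurableT_comp => //.
    exact: measurable_funB.
  - exact: (cmeas_comp mKs).
  - exact: cmeas_cst.
have fle t tau : norm1 (f (t, tau)) <=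
    (expbound rho x * \1_(`]- x, x[%classic) t) * (C * wt (s, 0) * \1_(`]- s, s[%classic) tau).
  rewrite /f /= mulrC (le_trans (norm1M _ _))// ler_pM ?norm1_ge0 ?cut_le//.
  case: ifP => // _; rewrite norm1_0; exact: le_trans (norm1_ge0 _) (Ks' tau).
have FB := @cFubini _ _ _ _ _ leb leb f _ _ mf (integrable_cst_itv _ _ _) (integrable_cst_itv _ _ _) fle.
transitivity (cint leb (fun t => cint leb (fun tau => f (t, tau)))).
  apply: eq_cint => t.
  exact: esym (cintZr (cut x t) (cintegrable_window t (x - s) mKs Ks)).
rewrite FB.
have h tau : cint leb (fun t => f (t, tau)) = K (s, tau) * (if s < x then 2 * (ex tau * Sn (x - s)) else 0).
  case: (boolP (`|tau| < s)) => taus; last first.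
    have Kz : K (s, tau) = 0 by exact: Ksupp.
    have -> : (fun t => f (t, tau)) = (fun=> 0).
      by apply/funext => t; rewrite /f /= Kz; case: (_ < _); rewrite mul0r.
    by rewrite cint0 Kz mul0r.
  rewrite -(@cint_cut x s tau (ltW taus)) -cintZ.
    by apply: eq_cint => t; rewrite /f /=; case: ifP => _; rewrite ?mulr0 ?mul0r.
  have := cintegrable_window tau (x - s) (cmeas_cut x) (cut_bound x).
  by under [fun t => if `|tau - t| < _ then _ else _]eq_fun do rewrite distrC.
under [fun y => cint leb _]eq_fun do rewrite h.
case: ifP => sx; last by under [fun y => _]eq_fun do rewrite mulr0; rewrite cint0.
rewrite psiK_cut mulrA -cintZ.
  apply: eq_cint => tau; rewrite /cut; case: ifPn => taus; first ring.
  have Kz : K (s, tau) = 0 by exact: Ksupp.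
  by rewrite Kz !mul0r mulr0.
apply: (@cintegrable_le _ _ _ leb _ (fun t => C * wt (s, 0) * (expbound rho s * \1_(`]- s, s[%classic) t))).
- exact: (cmeasM mKs (cmeas_cut s)).
- by apply: integrableZ_EFin; exact: integrable_cst_itv.
- move=> t; apply: le_trans (norm1M _ _) _.
  exact: (ler_pM (norm1_ge0 _) (norm1_ge0 _) (Ks t) (cut_le s t)).
Qed.

(** The equation of the kernel, integrated against [e^{i rho t}]. *)
Lemma psi_volterra x : psi x = ex x +
  cint nu (fun s => if s < x then Sn (x - s) * (g s * psi s) else 0).
Proof.
rewrite /psi; congr (_ + _).
have [_ [C KC]] := gK.
pose F1 (z : R * R) : R[i] := if `|z.2 - z.1| < x - z.1 then 1 else 0.
have F1le z : norm1 (F1 z) <= 1.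
  by rewrite /F1; case: ifP => _; rewrite ?norm1_0// /norm1 /= normr0 normr1 addr0.
have F2le z : norm1 (inner x z) <= C * 2 / (2 * mass nu g + 1) * wt (x, 0).
  exact: (inner_le x z.2 z.1 mK KC).
have S1 := swap ig (cmeas_cone x) F1le (cmeas_cut x) (cut_le x).
have S2 := swap ig (cmeas_inner x) F2le (cmeas_cut x) (cut_le x).
have I1 := swap_integrable_leb ig (cmeas_cone x) F1le (cmeas_cut x) (cut_le x).
have I2 := swap_integrable_leb ig (cmeas_inner x) F2le (cmeas_cut x) (cut_le x).
have J1 := swap_integrable_nu ig (cmeas_cone x) F1le (cmeas_cut x) (cut_le x).
have J2 := swap_integrable_nu ig (cmeas_inner x) F2le (cmeas_cut x) (cut_le x).
rewrite psiK_cut.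
transitivity (cint leb (fun t => ((2^-1)%:C * cint nu (fun s => g s * F1 (s, t))) * cut x t
   + ((2^-1)%:C * cint nu (fun s => g s * inner x (s, t))) * cut x t)).
  by apply: eq_cint => t; rewrite -mulrDl KE source_cint.
rewrite cintD// S1 S2 -cintD//; apply: eq_cint => s.
have [s0|s0] := ltP s 0; first by rewrite g_ge0// !mul0r !mulr0 addr0; case: ifP.
rewrite inner_cut.
have -> : cint leb (fun t => F1 (s, t) * cut x t) =
    if s < x then 2 * (ex s * Sn (x - s)) else 0.
  rewrite -(@cint_cut x s s) ?ger0_norm//; apply: eq_cint => t.
  by rewrite /F1 /=; case: ifP => _; rewrite ?mul1r ?mul0r.
case: ifP => _; last by rewrite !mulr0 addr0.
by field.
Qed.

End Transmutation.

(** * From variation of constants to the integrated equation *)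

Section Duhamel.
Variables (R : realType) (nu : {sigma_finite_measure set (measurableTypeR R) -> \bar R}).
Variables (rho : R[i]) (phi : R -> R[i]) (iphi : cintegrable nu phi).
Hypothesis phi_ge0 : forall s, s < 0 -> phi s = 0.
Notation leb := (@lebesgue_measure R).
Notation ex := (ex rho).
Notation Sn := (Sn rho).
Notation Cs := (Cs rho).

Let mphi : cmeas phi. Proof. exact: cintegrable_cmeas iphi. Qed.

Lemma cintegrable_tail (k : R -> R[i]) (x W : R) : cmeas k -> 0 <= W ->
  (forall r, 0 <= r < x -> norm1 (k (x - r)) <= W) ->
  cintegrable nu (fun r => if r < x then k (x - r) * phi r else 0).
Proof.
move=> mk W0 kW; apply: (@cintegrable_le _ _ _ nu _ (fun r => W * norm1 (phi r))).
- apply: (@cmeas_if _ _ _ (fun r : R => r < x)); first exact: measurable_fun_ltr.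
    apply: (cmeasM _ mphi); apply: (cmeas_comp mk (phi := fun r : R => x - r)).
    exact: measurable_funB.
  exact: cmeas_cst.
- by apply: integrableZ_EFin; exact: cintegrable_norm1.
- move=> r; have [r0|r0] := ltP r 0.
    by rewrite phi_ge0// mulr0 norm1_0 mulr0; case: ifP => _; rewrite norm1_0.
  case: ifP => rx; last by rewrite norm1_0 mulr_ge0// norm1_ge0.
  apply: le_trans (norm1M _ _) _; apply: ler_wpM2r; first exact: norm1_ge0.
  by apply: kW; rewrite r0 rx.
Qed.

(** Variation of constants: the solution of [u'' + rho^2 u = phi nu] that agrees
    with [e^{i rho s}] for [s < 0]. *)
Definition response s := ex s + cint nu (fun r => if r < s then Sn (s - r) * phi r else 0).

Lemma response_split (w : R -> R[i]) (x W : R) : cmeas w -> 0 <= x -> 0 <= W ->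
  (forall s, 0 < s < x -> norm1 (w s) <= W) ->
  cint leb (fun s => if 0 < s < x then w s * response s else 0) =
  cint leb (fun s => if 0 < s < x then w s * ex s else 0) +
  cint nu (fun r => cint leb (fun s => if r < s < x then w s * Sn (s - r) else 0) * phi r).
Proof.
move=> mw x0 W0 wW.
pose wc s : R[i] := if 0 < s < x then w s else 0.
have mwc : cmeas wc.
  apply: (@cmeas_if _ _ _ (fun s : R => 0 < s < x)) => //.
  by apply: measurable_and; exact: measurable_fun_ltr.
have wcle s : norm1 (wc s) <= W * \1_(`]0, x[%classic) s.
  rewrite indicE mem_setE in_itv /= /wc; case: ifP => h; last by rewrite norm1_0 mulr0.
  by rewrite mulr1 wW.
pose f (z : R * R) := wc z.1 * ((if z.2 < z.1 then Sn (z.1 - z.2) else 0) * phi z.2).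
have E0 := expbound_ge0 rho x.
have fle s r : norm1 (f (s, r)) <= (W * \1_(`]0, x[%classic) s) * (expbound rho x * x * norm1 (phi r)).
  rewrite /f /= indicE mem_setE in_itv /=.
  have [sx|sx] := boolP (0 < s < x); last first.
    by rewrite /wc (negbTE sx) mul0r norm1_0 mulr0 mul0r.
  have [r0|r0] := ltP r 0; first by rewrite phi_ge0// !mulr0 norm1_0 !mulr0.
  rewrite mulr1 (le_trans (norm1M _ _))// ler_pM ?norm1_ge0//.
    by rewrite /wc sx wW.
  rewrite (le_trans (norm1M _ _))// ler_wpM2r ?norm1_ge0//.
  case: ifP => [rs|_]; last by rewrite norm1_0 mulr_ge0.
  have /andP[s0 s1] := sx.
  rewrite (le_trans (Sn_bound (x := x) rho (t := s - r) _))//; last by rewrite ler_wpM2l//; lra.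
  by apply/andP; split; lra.
have mf : cmeas f.
  apply: cmeasM; first exact: (cmeas_comp mwc).
  apply: cmeasM; last exact: (cmeas_comp mphi).
  apply: (@cmeas_if _ _ _ (fun z : R * R => z.2 < z.1)); first exact: measurable_fun_ltr.
    apply: (cmeas_comp (cmeas_Sn rho) (phi := fun z : R * R => z.1 - z.2)).
    exact: measurable_funB.
  exact: cmeas_cst.
have iG : leb.-integrable setT (EFin \o (fun s => W * \1_(`]0, x[%classic) s)) by exact: integrable_cst_itv.
have iH : nu.-integrable setT (EFin \o (fun r => expbound rho x * x * norm1 (phi r))).
  by apply: integrableZ_EFin; exact: cintegrable_norm1.
have FB := @cFubini _ _ _ _ _ leb nu f _ _ mf iG iH fle.
have IB := @cintegrable_param _ _ _ _ _ leb nu f _ _ mf iG iH fle.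
have inn s : cint nu (fun r => f (s, r)) =
    wc s * cint nu (fun r => if r < s then Sn (s - r) * phi r else 0).
  have [sx|sx] := boolP (0 < s < x); last first.
    by rewrite /f /wc /= (negbTE sx) mul0r; under eq_fun do rewrite mul0r; rewrite cint0.
  rewrite -cintZ; first by apply: eq_cint => r; rewrite /f /=; case: ifP; rewrite ?mul0r.
  have /andP[s0 s1] := sx.
  apply: (@cintegrable_tail Sn s (expbound rho x * x) (cmeas_Sn rho)); first exact: mulr_ge0.
  move=> r /andP[r0 rs].
  rewrite (le_trans (Sn_bound (x := x) rho (t := s - r) _))//; last by rewrite ler_wpM2l//; lra.
  by apply/andP; split; lra.
transitivity (cint leb (fun s => wc s * ex s + cint nu (fun r => f (s, r)))).
  apply: eq_cint => s; rewrite inn -mulrDr /wc; case: ifP => //; by rewrite mul0r.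
rewrite cintD//; last first.
  apply: (@cintegrable_le _ _ _ leb _ (fun s => expbound rho x * (W * \1_(`]0, x[%classic) s))).
  - exact: (cmeasM mwc (cmeas_ex rho)).
  - exact: integrableZ_EFin.
  - move=> s; rewrite indicE mem_setE in_itv /= /wc; case: ifP => h; last by rewrite mul0r norm1_0 !mulr0.
    rewrite mulr1 mulrC (le_trans (norm1M _ _))// ler_pM ?norm1_ge0 ?wW//.
    by have /andP[s0 s1] := h; rewrite ex_bound// ger0_norm ltW.
congr (_ + _).
  by apply: eq_cint => s; rewrite /wc; case: ifP; rewrite ?mul0r.
rewrite FB; apply: eq_cint => r.
have [r0|r0] := ltP r 0.
  rewrite phi_ge0// mulr0 (_ : (fun s => _) = (fun=> 0)) ?cint0//.
  by apply/funext => s; rewrite /f /= phi_ge0// !mulr0.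
have /andP[xr xr'] : (0 <= Num.max x r) && (r <= Num.max x r) by rewrite le_max x0 le_max lexx orbT.
rewrite -cintZr; first last.
  apply: (@cintegrable_le _ _ _ leb _ (fun s => (expbound rho x * x) * (W * \1_(`]0, x[%classic) s))).
  - apply: (@cmeas_if _ _ _ (fun s : R => r < s < x)); last exact: cmeas_cst.
      by apply: measurable_and; exact: measurable_fun_ltr.
    apply: (cmeasM mw); apply: (cmeas_comp (cmeas_Sn rho) (phi := fun s : R => s - r)).
    exact: measurable_funB.
  - exact: integrableZ_EFin.
  - move=> s; rewrite indicE mem_setE in_itv /=; case: ifP => [/andP[s0 s1]|_]; last first.
      by rewrite norm1_0 !mulr_ge0.
    have s01 : 0 < s < x by rewrite s1 (le_lt_trans r0 s0).
    rewrite s01 mulr1 mulrC (le_trans (norm1M _ _))// ler_pM ?norm1_ge0 ?wW//.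
    rewrite (le_trans (Sn_bound (x := x) rho (t := s - r) _))//; last by rewrite ler_wpM2l//; lra.
    by apply/andP; split; lra.
apply: eq_cint => s; rewrite /f /= /wc.
have [rs|rs] := boolP (r < s); last by rewrite /= !mul0r mulr0.
by rewrite (le_lt_trans r0 rs) /=; case: (s < x); rewrite /= ?mul0r// mulrA.
Qed.

(** With [S(y) = sin (rho y) / rho] one has [S(y) = y - rho^2 int_0^y (y - z) S(z) dz];
    integrated against [phi nu], this is the equation of [response] integrated twice. *)
Lemma response_ramp x : 0 <= x ->
  cint leb (fun s => if 0 < s < x then - rho ^+ 2 * ((x - s)%:C * response s) else 0) =
  response x - 1 - 'i%C * rho * x%:C -
  cint nu (fun r => if r < x then (x - r)%:C * phi r else 0).
Proof.
move=> x0; pose w s : R[i] := - rho ^+ 2 * (x - s)%:C.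
have mid (t : R) : cmeas (fun s : R => (t - s)%:C).
  by apply: cmeas_real; exact: measurable_funB.
have mw : cmeas w by apply: cmeasM; [exact: cmeas_cst|exact: mid].
have W0 : 0 <= norm1 (- rho ^+ 2) * x by rewrite mulr_ge0// norm1_ge0.
have wW s : 0 < s < x -> norm1 (w s) <= norm1 (- rho ^+ 2) * x.
  move=> /andP[s0 sx]; rewrite /w norm1Mr ler_wpM2l ?norm1_ge0//.
  by rewrite ger0_norm; lra.
have := response_split mw x0 W0 wW.
under [fun s => if _ then w s * response s else _]eq_fun do rewrite -mulrA.
under [fun s => if _ then w s * ex s else _]eq_fun do rewrite -mulrA.
rewrite cint_ramp_ex// => ->.
have -> : (fun r => cint leb (fun s => if r < s < x then w s * Sn (s - r) else 0) * phi r) =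
   (fun r => (if r < x then Sn (x - r) * phi r else 0) - (if r < x then (x - r)%:C * phi r else 0)).
  apply/funext => r.
  under [fun s => if _ then _ else _]eq_fun do rewrite -mulrA.
  case: ifPn => rx; first by rewrite cint_ramp_Sn ?ltW// mulrBl.
  rewrite (_ : (fun s => _) = (fun=> 0)) ?cint0 ?mul0r ?subrr//.
  apply/funext => s; case: ifP => // /andP[h1 h2].
  by rewrite (lt_trans h1 h2) in rx.
rewrite cintB.
- by rewrite /response; ring.
- apply: (@cintegrable_tail Sn x (expbound rho x * x) (cmeas_Sn rho)).
    by rewrite mulr_ge0// expbound_ge0.
  move=> r /andP[r0 rx].
  have E0 := expbound_ge0 rho x.
  rewrite (le_trans (Sn_bound (x := x) rho (t := x - r) _))//; last by rewrite ler_wpM2l//; lra.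
  by apply/andP; split; lra.
- apply: (@cintegrable_tail (fun s => s%:C) x x) => //; first exact: cmeas_real.
  by move=> r /andP[r0 rx]; rewrite norm1_real ger0_norm; lra.
Qed.

(** The same for [cos (rho y) = 1 - rho^2 int_0^y S(z) dz]: the equation of
    [response], integrated once. *)
Lemma response_slope x : 0 <= x ->
  cint leb (fun s => if 0 < s < x then - rho ^+ 2 * response s else 0) =
  'i%C * rho * ex x - 'i%C * rho +
  cint nu (fun r => if r < x then Cs (x - r) * phi r else 0) -
  cint nu (fun r => if r < x then phi r else 0).
Proof.
move=> x0.
have W0 : 0 <= norm1 (- rho ^+ 2) by exact: norm1_ge0.
rewrite (@response_split (fun=> - rho ^+ 2) x _ (cmeas_cst _ _) x0 W0)//.
rewrite cint_ex// -[RHS]addrA; congr (_ + _).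
transitivity (cint nu (fun r => (if r < x then Cs (x - r) * phi r else 0) -
    (if r < x then 1 * phi r else 0))).
  apply: eq_cint => r.
  case: ifPn => rx; first by rewrite cint_Sn ?ltW// mulrBl.
  rewrite (_ : (fun s => _) = (fun=> 0)) ?cint0 ?mul0r ?subrr//.
  apply/funext => s; case: ifP => // /andP[h1 h2].
  by rewrite (lt_trans h1 h2) in rx.
rewrite cintB.
- by under [X in _ - cint _ X]eq_fun do rewrite mul1r.
- apply: (@cintegrable_tail Cs x (expbound rho x) (cmeas_Cs rho)).
    exact: expbound_ge0.
  by move=> r /andP[r0 rx]; apply: Cs_bound; rewrite ger0_norm; lra.
- apply: (@cintegrable_tail (fun=> 1) x 1 (cmeas_cst _ _)) => //.
  by move=> r _; rewrite /norm1 /= normr0 addr0 normr1.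
Qed.

End Duhamel.

(** * One-sided derivatives of ramp integrals *)

Section RampDerivative.
Variables (R : realType) (nu : {measure set (measurableTypeR R) -> \bar R}).

Lemma Rdominated_cvg (f_ : nat -> R -> R) (f G : R -> R) :
  (forall n, measurable_fun setT (f_ n)) ->
  (forall s, f_ n s @[n --> \oo] --> f s) ->
  nu.-integrable setT (EFin \o G) -> (forall n s, `|f_ n s| <= G s) ->
  \int[nu]_s f_ n s @[n --> \oo] --> \int[nu]_s f s.
Proof.
move=> mf_ f_f iG fG.
have mf : measurable_fun setT f by apply: (measurable_fun_cvg mf_) => s _; exact: f_f.
have [] := @dominated_convergence _ _ _ nu setT measurableT
  (fun n => EFin \o f_ n) (EFin \o f) (EFin \o G).
- by move=> n; apply/measurable_EFinP; exact: mf_.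
- by apply/measurable_EFinP; exact: mf.
- by apply: aeW => s _; apply: cvg_EFin; [exact: nearW|exact: f_f].
- by [].
- by apply: aeW => s n _; rewrite lee_fin.
move=> iF _ h; apply: fine_cvg; rewrite fineK; last exact: integrable_fin_num.
exact: h.
Qed.

Variables (phi : R -> R) (iphi : nu.-integrable setT (EFin \o phi)).
Variables (a : R) (phi0 : forall s, s < a -> phi s = 0).

Let mphi : measurable_fun setT phi.
Proof. by apply/measurable_EFinP; exact: measurable_int iphi. Qed.

(** The second primitive of the measure [phi nu]. *)
Definition ramp x := \int[nu]_s (if s < x then (x - s) * phi s else 0).

Lemma measurable_ramp_kernel x :
  measurable_fun setT (fun s : R => if s < x then (x - s) * phi s else 0).
Proof.
apply: measurable_fun_ifT => //; first exact: measurable_fun_ltr.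
by apply: measurable_funM => //; exact: measurable_funB.
Qed.

Lemma integrable_ramp x :
  nu.-integrable setT (EFin \o (fun s => if s < x then (x - s) * phi s else 0)).
Proof.
apply: (@le_integrable _ _ _ nu _ _ _ (EFin \o (fun s => Num.max (x - a) 0 * `|phi s|))) => //.
- by apply/measurable_EFinP; exact: measurable_ramp_kernel.
- move=> s _ /=; rewrite lee_fin [leRHS]ger0_norm; last by rewrite mulr_ge0// le_max lexx orbT.
  have [sa|sa] := ltP s a.
    by rewrite phi0// normr0 !mulr0; case: ifP => _; rewrite normr0.
  case: ifP => sx; last by rewrite normr0 mulr_ge0// le_max lexx orbT.
  rewrite normrM ler_wpM2r// ger0_norm; last lra.
  by rewrite le_max; apply/orP; left; lra.
- by apply: integrableZ_EFin; exact: integrable_norm.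
Qed.

Definition ramp_quot (x t s : R) :=
  ((if s < t then t - s else 0) - (if s < x then x - s else 0)) / (t - x).

Lemma ramp_quot_le x t s : t != x -> `|ramp_quot x t s| <= 1.
Proof.
move=> tx; have tx0 : t - x != 0 by rewrite subr_eq0.
rewrite /ramp_quot normrM normfV ler_pdivrMr ?normr_gt0// mul1r.
case: ltP => h1; case: ltP => h2; rewrite ler_norml.
- have -> : t - s - (x - s) = t - x by ring.
  by rewrite -ler_norml.
- rewrite subr0; have := ler_norm (t - x); have := normr_ge0 (t - x).
  by move=> h3 h4; apply/andP; split; lra.
- rewrite sub0r distrC; have := ler_norm (x - t); have := normr_ge0 (x - t).
  by move=> h3 h4; apply/andP; split; lra.
- by rewrite subrr oppr_le0 normr_ge0.
Qed.

Lemma diff_quot_ramp x t : t != x ->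
  diff_quot ramp x t = \int[nu]_s (ramp_quot x t s * phi s).
Proof.
move=> tx; rewrite /diff_quot /ramp -RintegralB//; try exact: integrable_ramp.
rewrite -RintegralZr//; last by apply: integrableB_EFin; exact: integrable_ramp.
apply: eq_Rintegral => s _; rewrite /ramp_quot.
by do 2 case: ifP => _; ring.
Qed.

Lemma ramp_seq x (u : R^nat) (ind : R -> R) : (forall n, u n != x) ->
  (forall s, ramp_quot x (u n) s @[n --> \oo] --> ind s) ->
  diff_quot ramp x (u n) @[n --> \oo] --> \int[nu]_s (ind s * phi s).
Proof.
move=> ux cu; under eq_fun do rewrite diff_quot_ramp//.
apply: (@Rdominated_cvg _ _ (fun s => `|phi s|)).
- move=> n; apply: measurable_funM => //; apply: measurable_funM => //.
  apply: measurable_funB; apply: measurable_fun_ifT => //;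
    by [exact: measurable_fun_ltr|exact: measurable_funB].
- by move=> s; apply: cvgM => //; exact: cvg_cst.
- exact: integrable_norm.
- by move=> n s; rewrite normrM ler_piMl// ramp_quot_le.
Qed.

(** The difference quotients of [x |-> (x - s)_+] are bounded by [1] and converge,
    from the left to the indicator of [s < x], from the right to that of [s <= x].
    Hence an atom at [x] makes the slope jump. *)
Lemma ramp_lderiv x :
  diff_quot ramp x t @[t --> x^'-] --> \int[nu]_s (if s < x then phi s else 0).
Proof.
have -> : \int[nu]_s (if s < x then phi s else 0) =
    \int[nu]_s ((if s < x then 1 else 0) * phi s).
  by apply: eq_Rintegral => s _; case: ifP; rewrite ?mul1r ?mul0r.
apply/cvg_at_leftP => u [ux ucvg].
have un n : u n != x by rewrite lt_eqF.
apply: ramp_seq => // s; apply: cvg_near_cst; case: ltP => sx.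
  near=> n; rewrite /ramp_quot ifT; last by near: n; apply: (cvgr_gt x).
  rewrite sx (_ : u n - s - (x - s) = u n - x); last ring.
  by rewrite divff// subr_eq0.
near=> n; rewrite /ramp_quot ifF; first by rewrite ltNge sx /= subrr mul0r.
by apply/negbTE; rewrite -leNgt (le_trans (ltW (ux n))).
Unshelve. all: by end_near. Qed.

Lemma ramp_rderiv x :
  diff_quot ramp x t @[t --> x^'+] --> \int[nu]_s (if s <= x then phi s else 0).
Proof.
have -> : \int[nu]_s (if s <= x then phi s else 0) =
    \int[nu]_s ((if s <= x then 1 else 0) * phi s).
  by apply: eq_Rintegral => s _; case: ifP; rewrite ?mul1r ?mul0r.
apply/cvg_at_rightP => u [ux ucvg].
have un n : u n != x by rewrite gt_eqF.
apply: ramp_seq => // s; apply: cvg_near_cst; case: leP => sx.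
  near=> n; rewrite /ramp_quot ifT; last by rewrite (le_lt_trans sx).
  have -> : (if s < x then x - s else 0) = x - s.
    by case: ltP => // xs; rewrite (@le_anti _ _ x s) ?subrr// xs sx.
  rewrite (_ : u n - s - (x - s) = u n - x); last ring.
  by rewrite divff// subr_eq0.
near=> n; rewrite /ramp_quot ifF; first by rewrite ltNge (ltW sx) /= subrr mul0r.
apply/negbTE; rewrite -leNgt; apply/ltW; near: n; exact: (cvgr_lt x).
Unshelve. all: by end_near. Qed.

End RampDerivative.

(** * Truncated powers *)

Section DiffQuot.
Variable R : realType.
Implicit Types (f g : R -> R) (x d : R).

Lemma is_derive_diff_quotP f x d :
  is_derive x (1 : R) f d <-> diff_quot f x t @[t --> x^'] --> d.
Proof.
split.
  move=> [df <-]; move: df => /cvg_ex [l /= hl].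
  have -> : 'D_1 f x = l by exact: cvg_lim.
  apply/cvgrPdist_lt => e e0; move/cvgrPdist_lt : hl => /(_ e e0) [r /= r0 hr].
  exists r => //= t; rewrite /ball /= => tx tnx.
  have := hr (t - x); rewrite /ball /= sub0r normrN distrC => /(_ tx).
  rewrite subr_eq0 => /(_ tnx); rewrite /GRing.scale /= mulr1 subrK.
  by rewrite /diff_quot [(f t - f x) / _]mulrC.
move=> h.
have hl : h^-1 *: (f (h *: 1 + x) - f x) @[h --> 0^'] --> d.
  apply/cvgrPdist_lt => e e0; move/cvgrPdist_lt : h => /(_ e e0) [r /= r0 hr].
  exists r => //= t; rewrite /ball /= sub0r normrN => tx tnx.
  have := hr (t + x); rewrite /ball /= opprD addrCA subrr addr0 normrN => /(_ tx).
  have -> : t + x != x by rewrite -subr_eq0 addrK.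
  by move=> /(_ isT); rewrite /diff_quot addrK /GRing.scale /= mulr1 mulrC.
apply: DeriveDef; first by apply/cvg_ex; exists d.
exact: cvg_lim.
Qed.

Lemma is_derive_lr f x d : diff_quot f x t @[t --> x^'-] --> d ->
  diff_quot f x t @[t --> x^'+] --> d -> is_derive x (1 : R) f d.
Proof.
move=> hl hr; apply/is_derive_diff_quotP; exact: (@cvg_at_right_left_dnbhs R R^o).
Qed.

Lemma is_derive_left f x d : is_derive x (1 : R) f d ->
  diff_quot f x t @[t --> x^'-] --> d.
Proof.
move/is_derive_diff_quotP => h; apply: cvg_trans h; apply: cvg_app.
by apply: within_subset => t /= h; rewrite lt_eqF.
Qed.

Lemma is_derive_right f x d : is_derive x (1 : R) f d ->
  diff_quot f x t @[t --> x^'+] --> d.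
Proof.
move/is_derive_diff_quotP => h; apply: cvg_trans h; apply: cvg_app.
by apply: within_subset => t /= h; rewrite gt_eqF.
Qed.

Lemma is_deriveM_fun f g x d e : is_derive x (1 : R) f d -> is_derive x (1 : R) g e ->
  is_derive x (1 : R) (fun t => f t * g t) (d * g x + f x * e).
Proof.
move=> F1 f1; apply: (is_derive_eq (is_deriveM F1 f1)).
by rewrite /GRing.scale /=; ring.
Qed.

Lemma is_deriveD_fun f g x d e : is_derive x (1 : R) f d -> is_derive x (1 : R) g e ->
  is_derive x (1 : R) (fun t => f t + g t) (d + e).
Proof. by move=> F1 f1; apply: (is_derive_eq (is_deriveD F1 f1)). Qed.

Lemma is_deriveZ_fun f x k d : is_derive x (1 : R) f d ->
  is_derive x (1 : R) (fun t => k * f t) (k * d).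
Proof. by move=> F1; apply: (is_derive_eq (is_deriveZ k F1)). Qed.

Lemma is_derive_affine x a c : is_derive x (1 : R) (fun t => a * t + c) a.
Proof.
apply: (is_derive_eq (is_deriveD (is_deriveZ a (is_derive_id x 1)) (is_derive_cst c x 1))).
by rewrite /GRing.scale /= mulr1 addr0.
Qed.

Lemma is_derive_reflect f x y d : is_derive (y - x) (1 : R) f d ->
  is_derive x (1 : R) (fun t => f (y - t)) (- d).
Proof.
move=> df; have A := is_derive_affine x (-1) y.
have df' : is_derive (-1 * x + y) (1 : R) f d by rewrite mulN1r addrC.
have := @is_derive1_comp _ f (fun t => -1 * t + y) x _ _ df' A.
rewrite mulrN1.
by have -> : f \o (fun t => -1 * t + y) = (fun t => f (y - t)) by
  apply/funext => t /=; rewrite mulN1r addrC.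
Qed.

Definition trunc_pow (n : nat) (y : R) : R := if 0 < y then y ^+ n / n`!%:R else 0.

Lemma trunc_pow_pos n y : 0 < y -> trunc_pow n y = y ^+ n / n`!%:R.
Proof. by rewrite /trunc_pow => ->. Qed.

Lemma trunc_pow_neg n y : y <= 0 -> trunc_pow n y = 0.
Proof. by rewrite /trunc_pow leNgt => /negbTE ->. Qed.

Lemma is_derive_trunc_pow n y : is_derive y (1 : R) (trunc_pow n.+2) (trunc_pow n.+1 y).
Proof.
have pd (k : nat) : is_derive y (1 : R) (fun t => t ^+ k.+1 / k.+1`!%:R) (y ^+ k / k`!%:R).
  have dX : is_derive y (1 : R) (fun t => t ^+ k.+1) (k.+1%:R * y ^+ k).
    have -> : (fun t : R => t ^+ k.+1) = (id : R -> R) ^+ k.+1.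
      by apply/funext => t; rewrite exprfctE.
    apply: (is_derive_eq (is_deriveX k.+1 (is_derive_id y (1:R)))).
    by rewrite /GRing.scale /= mulr1.
  have := is_deriveZ_fun (k.+1`!%:R^-1) dX.
  under [fun t => _ * _]eq_fun do rewrite mulrC.
  have -> // : k.+1`!%:R^-1 * (k.+1%:R * y ^+ k) = y ^+ k / k`!%:R.
  rewrite factS natrM.
  have h1 : k`!%:R != 0 :> R by rewrite pnatr_eq0 -lt0n fact_gt0.
  have h2 : k.+1%:R != 0 :> R by rewrite pnatr_eq0.
  by field; rewrite h1 addrC natr1 h2.
have [y0|y0|->] := ltgtP y 0.
- rewrite trunc_pow_neg ?ltW//; apply: (near_eq_is_derive _ (is_derive_cst (0 : R) y (1 : R))).
  near=> t; rewrite trunc_pow_neg// ltW//; near: t; exact: lt_nbhsl.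
- rewrite trunc_pow_pos//; apply: (near_eq_is_derive _ (pd n.+1)).
  near=> t; rewrite trunc_pow_pos//; near: t; exact: lt_nbhsr.
- rewrite trunc_pow_neg//; apply/is_derive_diff_quotP/cvgrPdist_lt => e e0.
  exists (Num.min 1 e) => /=; first by rewrite lt_min ltr01.
  move=> t; rewrite /ball /= sub0r normrN lt_min => /andP[t1 te] tn0.
  rewrite sub0r normrN /diff_quot (trunc_pow_neg _ (lexx 0)) !subr0.
  have [t0|t0] := leP t 0; first by rewrite trunc_pow_neg// mul0r normr0.
  rewrite trunc_pow_pos// exprSr mulrAC mulfK// normrM normfV (ger0_norm (ler0n _ _)).
  have F1 : (1 : R) <= n.+2`!%:R by rewrite ler1n fact_gt0.
  rewrite ltr_pdivrMr ?(lt_le_trans ltr01)//.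
  rewrite (@lt_le_trans _ _ e)//; last by rewrite ler_peMr// ltW.
  rewrite (le_lt_trans _ te)// normrX exprS ler_piMr//.
  by rewrite exprn_ile1// ltW.
Unshelve. all: by end_near. Qed.

Lemma continuous_trunc_pow n : continuous (trunc_pow n.+1).
Proof.
case: n => [|n] y; last first.
  by apply/differentiable_continuous/derivable1_diffP; case: (is_derive_trunc_pow n y).
have -> : trunc_pow 1 = (fun t => Num.max t 0).
  by apply/funext => t; rewrite /trunc_pow /= expr1 divr1 maxC; case: ltP.
by apply: continuous_max; [exact: cvg_id|exact: cvg_cst].
Qed.

End DiffQuot.

(** * Regularity of twice weakly differentiable functions *)

Section WeakRegularity.
Variable R : realType.
Notation leb := (@lebesgue_measure R).
Implicit Types (u v w f : R -> R) (x y : R).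

Lemma trunc_pow_le n (y M : R) : y <= M -> trunc_pow n.+1 y <= trunc_pow n.+1 M.
Proof.
move=> yM; have [y0|y0] := leP y 0.
  rewrite (trunc_pow_neg _ y0) /trunc_pow; case: ifP => // M0.
  by rewrite divr_ge0// exprn_ge0// ltW.
rewrite !trunc_pow_pos ?(lt_le_trans y0)// ler_wpM2r ?invr_ge0//.
by rewrite lerXn2r// nnegrE ltW// (lt_le_trans y0).
Qed.

Lemma trunc_pow_ge0 n (y : R) : 0 <= trunc_pow n y.
Proof. by rewrite /trunc_pow; case: ifP => // /ltW y0; rewrite divr_ge0// exprn_ge0. Qed.

Lemma measurable_trunc_pow n y : measurable_fun setT (fun x : R => trunc_pow n.+1 (y - x)).
Proof.
have mt : measurable_fun setT (trunc_pow n.+1 : R -> R).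
  by apply: continuous_measurable_fun; exact: continuous_trunc_pow.
by apply: (measurableT_comp mt); exact: measurable_funB.
Qed.

Section IteratedRamp.
Variables (a c : R).

Lemma ramp_lipschitz f x y : leb.-integrable setT (EFin \o f) ->
  (forall s, s < a -> f s = 0) ->
  `|ramp leb f x - ramp leb f y| <= `|x - y| * \int[leb]_s `|f s|.
Proof.
move=> if_ f0; have [->|xy] := eqVneq x y; first by rewrite !subrr normr0 mul0r.
have mf : measurable_fun setT f by apply/measurable_EFinP; exact: measurable_int if_.
have -> : ramp leb f x - ramp leb f y = (x - y) * diff_quot (ramp leb f) y x.
  by rewrite /diff_quot mulrC divfK// subr_eq0.
rewrite normrM ler_wpM2l// (diff_quot_ramp if_ f0)//.
have i1 : leb.-integrable setT (EFin \o (fun s => ramp_quot y x s * f s)).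
  apply: (@le_integrable _ _ _ leb _ _ _ (EFin \o (fun s => `|f s|))) => //.
  - apply/measurable_EFinP; apply: measurable_funM => //; apply: measurable_funM => //.
    apply: measurable_funB; apply: measurable_fun_ifT => //;
      by [exact: measurable_fun_ltr|exact: measurable_funB].
  - by move=> s _ /=; rewrite lee_fin normr_id normrM ler_piMl// ramp_quot_le.
  - exact: integrable_norm.
rewrite (le_trans (le_normr_Rintegral _ i1))//; apply: le_Rintegral => //.
- exact: integrable_norm.
- exact: integrable_norm.
- by move=> s _; rewrite normrM ler_piMl// ramp_quot_le.
Qed.

Lemma continuous_ramp f : leb.-integrable setT (EFin \o f) ->
  (forall s, s < a -> f s = 0) -> continuous (ramp leb f).
Proof.
move=> if_ f0 x; apply/cvgrPdist_lt => e e0.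
pose M := \int[leb]_s `|f s| + 1.
have M0 : 0 < M by rewrite ltr_pwDr// Rintegral_ge0.
exists (e / M) => /=; first by rewrite divr_gt0.
move=> t; rewrite /ball /= => xt; apply: le_lt_trans (ramp_lipschitz _ _ if_ f0) _.
have xt' : `|x - t| * M < e by rewrite -ltr_pdivlMr.
by apply: le_lt_trans xt'; rewrite ler_wpM2l// /M lerDl.
Qed.

Variable w : R -> R.
Hypothesis iw : leb.-integrable setT (EFin \o w).
Hypothesis w0 : forall x, ~~ (a < x < c) -> w x = 0.

Let wa s : s < a -> w s = 0. Proof. by move=> sa; apply: w0; rewrite ltNge ltW. Qed.

Lemma measurable_ramp_itv : measurable_fun setT (fun x => if a < x < c then ramp leb w x else 0).
Proof.
apply: measurable_fun_ifT => //; first by apply: measurable_and; exact: measurable_fun_ltr.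
by apply: continuous_measurable_fun; exact: continuous_ramp.
Qed.

Lemma integrable_ramp_itv : leb.-integrable setT (EFin \o (fun x => if a < x < c then ramp leb w x else 0)).
Proof.
pose M := (c - a) * \int[leb]_s `|w s|.
apply: (@le_integrable _ _ _ leb _ _ _ (EFin \o (fun x => M * \1_(`]a, c[%classic) x))) => //.
- by apply/measurable_EFinP; exact: measurable_ramp_itv.
- move=> x _ /=; rewrite lee_fin indicE mem_setE in_itv /=.
  case: ifP => [/andP[ax xc]|_]; last by rewrite normr0.
  rewrite mulr1.
  have ra : ramp leb w a = 0.
    rewrite /ramp (_ : (fun s => _) = (fun=> 0)) ?Rintegral_cst ?mul0r//.
    by apply/funext => s; case: ifP => // sa; rewrite wa// mulr0.
  have := ramp_lipschitz x a iw wa; rewrite ra subr0 => /le_trans; apply.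
  rewrite (le_trans _ (ler_norm _))// /M ler_wpM2r ?Rintegral_ge0//.
  by rewrite ger0_norm; lra.
- exact: integrable_cst_itv.
Qed.

(** The convolution of two ramps. *)
Lemma cubic_kernel s y :
  \int[leb]_x (if s < x < y then (x - s) * (y - x) else 0) = trunc_pow 3 (y - s).
Proof.
have [ys|sy] := leP y s.
  rewrite trunc_pow_neg ?subr_le0// (_ : (fun x => _) = (fun=> 0)) ?Rintegral_cst ?mul0r//.
  by apply/funext => x; case: ifP => // /andP[h1 h2]; have := lt_trans h1 h2; rewrite ltNge ys.
pose F x := (y - s) / 2 * ((x - s) * (x - s)) + - 3^-1 * ((x - s) * (x - s) * (x - s)).
have dl x : is_derive x (1 : R) (fun t => t - s) 1.
  by have := is_derive_affine x 1 (- s); under [fun t => _]eq_fun do rewrite mul1r.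
have dF x : is_derive x (1 : R) F ((x - s) * (y - x)).
  apply: (is_derive_eq (is_deriveD_fun
    (is_deriveZ_fun ((y - s) / 2) (is_deriveM_fun (dl x) (dl x)))
    (is_deriveZ_fun (- 3^-1) (is_deriveM_fun (is_deriveM_fun (dl x) (dl x)) (dl x))))).
  by field.
rewrite (Rint_FTC (ltW sy) dF).
  by rewrite trunc_pow_pos ?subr_gt0// /F !subrr (_ : 3`! = 6%N)//; field.
move=> x; apply: cvgM; apply: cvgB; by [exact: cvg_id|exact: cvg_cst].
Qed.

Lemma ramp_iterated y : a < y /\ y < c ->
  \int[leb]_x ((if a < x < c then ramp leb w x else 0) * trunc_pow 1 (y - x)) =
  \int[leb]_x (w x * trunc_pow 3 (y - x)).
Proof.
move=> [ay yc].
have mw : measurable_fun setT w by apply/measurable_EFinP; exact: measurable_int iw.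
pose h (z : R * R) := (if a < z.1 < c then 1 else 0) *
  ((if z.2 < z.1 then (z.1 - z.2) * w z.2 else 0) * trunc_pow 1 (y - z.1)).
have mh : measurable_fun setT h.
  apply: measurable_funM.
    apply: measurable_fun_ifT => //.
    by apply: measurable_and; exact: measurable_fun_ltr.
  apply: measurable_funM.
    apply: measurable_fun_ifT => //; first exact: measurable_fun_ltr.
    apply: measurable_funM; first exact: measurable_funB.
    exact: (measurableT_comp mw).
  exact: (measurableT_comp (measurable_trunc_pow 0 y)).
have hle x s : `|h (x, s)| <= ((c - a) * (c - a) * \1_(`]a, c[%classic) x) * `|w s|.
  rewrite /h /= indicE mem_setE in_itv /=.
  case: ifPn => [/andP[ax xc]|_]; last by rewrite mul0r normr0 mulr0 mul0r.
  rewrite mul1r mulr1 !normrM.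
  have [sa|sa] := ltP s a.
    by rewrite wa// mulr0; case: ifP => _; rewrite normr0 ?mul0r !mulr0.
  have t1 : `|trunc_pow 1 (y - x)| <= c - a.
    rewrite ger0_norm ?trunc_pow_ge0// /trunc_pow expr1 divr1; case: ifP => _; lra.
  have t2 : `|(if s < x then (x - s) * w s else 0)| <= (c - a) * `|w s|.
    case: ifP => sx; last by rewrite normr0 mulr_ge0//; lra.
    by rewrite normrM ler_wpM2r// ger0_norm; lra.
  rewrite (le_trans (ler_pM _ _ t2 t1))//.
  by rewrite mulrAC.
transitivity (\int[leb]_x (\int[leb]_s h (x, s))).
  apply: eq_Rintegral => x _; rewrite /h /=.
  case: ifPn => xac; last first.
    by rewrite mul0r; under eq_Rintegral do rewrite mul0r; rewrite Rintegral_cst// mul0r.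
  under [RHS]eq_Rintegral do rewrite mul1r.
  by rewrite RintegralZr//; exact: (integrable_ramp iw wa).
have [FB _] := @RFubini _ _ _ _ _ leb leb h _ _ mh (integrable_cst_itv _ _ _) (integrable_norm iw) hle.
rewrite {}FB; apply: eq_Rintegral => s _; rewrite -cubic_kernel /h /=.
have [sac|sac] := boolP (a < s < c); last first.
  rewrite w0// mul0r (_ : (fun x => _) = (fun=> 0)) ?Rintegral_cst ?mul0r//.
  by apply/funext => x; rewrite mulr0; case: (s < x); rewrite mul0r mulr0.
have /andP[as_ sc] := sac.
rewrite -RintegralZl//; last first.
  apply: (@le_integrable _ _ _ leb _ _ _ (EFin \o (fun x => (c - a) * (c - a) * \1_(`]a, c[%classic) x))) => //.
  - apply/measurable_EFinP; apply: measurable_fun_ifT => //.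
      by apply: measurable_and; exact: measurable_fun_ltr.
    by apply: measurable_funM; exact: measurable_funB.
  - move=> x _ /=; rewrite lee_fin indicE mem_setE in_itv /=.
    case: ifP => [/andP[sx xy]|_]; last by rewrite normr0.
    have -> : a < x < c by apply/andP; split; lra.
    rewrite mulr1 !normrM ler_pM// !ger0_norm; lra.
  - exact: integrable_cst_itv.
apply: eq_Rintegral => x _; rewrite /trunc_pow expr1 divr1 subr_gt0.
case: (ltP s x) => sx /=; last by rewrite mul0r !mulr0.
case: (ltP x y) => xy /=; last by rewrite !mulr0.
by rewrite (lt_trans as_ sx) (lt_trans xy yc) /=; ring.
Qed.

End IteratedRamp.

Section Support.
Variables (a c : R).

Lemma integrable_trunc_pow u n y : leb.-integrable setT (EFin \o u) ->
  (forall x, x <= a -> u x = 0) ->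
  leb.-integrable setT (EFin \o (fun x => u x * trunc_pow n.+1 (y - x))).
Proof.
move=> iu u0.
have mu : measurable_fun setT u by apply/measurable_EFinP; exact: measurable_int iu.
apply: (@le_integrable _ _ _ leb _ _ _ (EFin \o (fun x => trunc_pow n.+1 (y - a) * `|u x|))) => //.
- apply/measurable_EFinP; apply: measurable_funM => //.
  exact: measurable_trunc_pow.
- move=> x _ /=; rewrite lee_fin normrM [leRHS]normrM normr_id mulrC.
  have [xa|xa] := leP x a; first by rewrite u0// normr0 !mulr0.
  rewrite ler_wpM2r// !ger0_norm ?trunc_pow_ge0//; apply: trunc_pow_le; lra.
- by apply: integrableZ_EFin; exact: integrable_norm.
Qed.

Lemma ramp_trunc_pow u y : ramp leb u y = \int[leb]_x (u x * trunc_pow 1 (y - x)).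
Proof.
apply: eq_Rintegral => x _; rewrite /trunc_pow subr_gt0 expr1 divr1.
by case: ifP => _; rewrite ?mulr0// mulrC.
Qed.

(** The Lagrange polynomials of the points [0, 1, 2, 3]. *)
Definition lagrange (i : nat) (z : R) : R :=
  if i == 0%N then - ((z - 1) * (z - 2) * (z - 3)) / 6 else
  if i == 1%N then z * (z - 2) * (z - 3) / 2 else
  if i == 2%N then - (z * (z - 1) * (z - 3)) / 2 else
  z * (z - 1) * (z - 2) / 6.

Let d := (c - a) / 5.
Let p (i : nat) : R := a + (i.+1)%:R * d.

(** A truncated power, minus its cubic interpolation with respect to [y] at four
    points of [(a, c)]. As interpolation reproduces polynomials of degree at most
    [3], for [n <= 3] this function of [x] also vanishes near [a]: its support is
    compact in [(a, c)]. *)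
Definition spline n y x :=
  trunc_pow n (y - x) + - (lagrange 0 ((y - p 0) / d) * trunc_pow n (p 0 - x) +
    lagrange 1 ((y - p 0) / d) * trunc_pow n (p 1 - x) +
    lagrange 2 ((y - p 0) / d) * trunc_pow n (p 2 - x) +
    lagrange 3 ((y - p 0) / d) * trunc_pow n (p 3 - x)).

Hypothesis ac : a < c.

Let d0 : 0 < d. Proof. by rewrite /d divr_gt0 ?subr_gt0. Qed.

Lemma spline_supp n y x : (n < 2)%N -> a < y < c -> spline n.+2 y x != 0 ->
  Num.min y (p 0) <= x <= Num.max y (p 3).
Proof.
move=> n2 /andP[ay yc] sn0.
have p01 : p 0 <= p 1 by rewrite /p; have := d0; lra.
have p12 : p 1 <= p 2 by rewrite /p; have := d0; lra.
have p23 : p 2 <= p 3 by rewrite /p; have := d0; lra.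
apply/andP; split; rewrite leNgt; apply: contra sn0.
  rewrite lt_min => /andP[xy xp]; apply/eqP.
  rewrite /spline !trunc_pow_pos; try lra.
  have yE : y = p 0 + d * ((y - p 0) / d) by field; rewrite lt0r_neq0.
  rewrite {1}yE; move: ((y - p 0) / d) => z.
  have -> : p 1 = p 0 + d by rewrite /p; ring.
  have -> : p 2 = p 0 + 2 * d by rewrite /p; ring.
  have -> : p 3 = p 0 + 3 * d by rewrite /p; ring.
  rewrite /lagrange /=; case: n n2 => [|[|//]] _.
    by rewrite (_ : 2`! = 2%N)//; field.
  by rewrite (_ : 3`! = 6%N)//; field.
rewrite gt_max => /andP[yx px]; apply/eqP.
by rewrite /spline !trunc_pow_neg ?mulr0 ?addr0 ?oppr0//; lra.
Qed.

Lemma is_derive_spline n y x :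
  is_derive x (1 : R) (spline n.+2 y) (- spline n.+1 y x).
Proof.
have D (k q : R) : is_derive x (1 : R) (fun t => k * trunc_pow n.+2 (q - t)) (k * - trunc_pow n.+1 (q - x)).
  by apply: is_deriveZ_fun; apply: is_derive_reflect; exact: is_derive_trunc_pow.
have H := is_deriveD_fun (is_derive_reflect (is_derive_trunc_pow n (y - x)))
  (is_deriveZ_fun (-1) (is_deriveD_fun (is_deriveD_fun (is_deriveD_fun
    (D (lagrange 0 ((y - p 0) / d)) (p 0)) (D (lagrange 1 ((y - p 0) / d)) (p 1)))
    (D (lagrange 2 ((y - p 0) / d)) (p 2))) (D (lagrange 3 ((y - p 0) / d)) (p 3)))).
have -> : spline n.+2 y = (fun t => trunc_pow n.+2 (y - t) + -1 *
   (lagrange 0 ((y - p 0) / d) * trunc_pow n.+2 (p 0 - t) + lagrange 1 ((y - p 0) / d) * trunc_pow n.+2 (p 1 - t) +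
    lagrange 2 ((y - p 0) / d) * trunc_pow n.+2 (p 2 - t) + lagrange 3 ((y - p 0) / d) * trunc_pow n.+2 (p 3 - t))).
  by apply/funext => t; rewrite /spline mulN1r.
by apply: (is_derive_eq H); rewrite /spline; ring.
Qed.

Lemma continuous_spline n y : continuous (spline n.+1 y).
Proof.
have ct (q : R) : continuous (fun x => trunc_pow n.+1 (q - x)).
  move=> x; apply: (@continuous_comp _ _ _ (fun x => q - x) (trunc_pow n.+1)).
    by apply: cvgB; [exact: cvg_cst|exact: cvg_id].
  exact: continuous_trunc_pow.
have cz (k q : R) : continuous (fun x => k * trunc_pow n.+1 (q - x)).
  by move=> x; apply: cvgM; [exact: cvg_cst|exact: ct].
move=> x; apply: cvgD; first exact: ct.
by apply: cvgN; do 3 (apply: cvgD; last exact: cz); exact: cz.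
Qed.

Variables u v w : R -> R.
Hypotheses (iu : leb.-integrable setT (EFin \o u))
  (iv : leb.-integrable setT (EFin \o v)) (iw : leb.-integrable setT (EFin \o w)).
Hypothesis u0 : forall x, ~~ (a < x < c) -> u x = 0.
Hypothesis v0 : forall x, ~~ (a < x < c) -> v x = 0.
Hypothesis w0 : forall x, ~~ (a < x < c) -> w x = 0.
Hypothesis uv : forall phi, C1c a c phi ->
  \int[leb]_x (u x * derive1 phi x) = - \int[leb]_x (v x * phi x).
Hypothesis vw : forall phi, C1c a c phi ->
  \int[leb]_x (v x * derive1 phi x) = - \int[leb]_x (w x * phi x).

Lemma C1c_spline n y : (n < 2)%N -> a < y < c -> C1c a c (spline n.+2 y).
Proof.
move=> n2 acy; split.
- by move=> x; case: (is_derive_spline n y x).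
- have -> : derive1 (spline n.+2 y) = (fun x => - spline n.+1 y x).
    by apply/funext => x; rewrite derive1E; case: (is_derive_spline n y x).
  by move=> x; apply: cvgN; exact: continuous_spline.
- exists (Num.min y (p 0)), (Num.max y (p 3)); have /andP[ay yc] := acy; split.
  + by rewrite lt_min ay /p; have := d0; lra.
  + by rewrite gt_max yc /p /d; have := d0; lra.
  + by move=> x; exact: spline_supp.
Qed.

Lemma Rint_spline f n y : leb.-integrable setT (EFin \o f) ->
  (forall x, ~~ (a < x < c) -> f x = 0) ->
  let J q := \int[leb]_x (f x * trunc_pow n.+1 (q - x)) in
  leb.-integrable setT (EFin \o (fun x => f x * spline n.+1 y x)) /\
  \int[leb]_x (f x * spline n.+1 y x) = J y - (lagrange 0 ((y - p 0) / d) * J (p 0) +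
    lagrange 1 ((y - p 0) / d) * J (p 1) + lagrange 2 ((y - p 0) / d) * J (p 2) +
    lagrange 3 ((y - p 0) / d) * J (p 3)).
Proof.
move=> if_ f0 J.
have fa x : x <= a -> f x = 0.
  by move=> xa; apply: f0; rewrite ltNge xa.
have i1 q := integrable_trunc_pow n q if_ fa.
pose l i := lagrange i ((y - p 0) / d).
have i2 i := integrableZ_EFin (l i) (i1 (p i)).
have i01 := integrableD_EFin (i2 0) (i2 1).
have i012 := integrableD_EFin i01 (i2 2).
have i0123 := integrableD_EFin i012 (i2 3).
have E x : f x * spline n.+1 y x = f x * trunc_pow n.+1 (y - x) -
   (l 0 * (f x * trunc_pow n.+1 (p 0 - x)) + l 1 * (f x * trunc_pow n.+1 (p 1 - x)) +
    l 2 * (f x * trunc_pow n.+1 (p 2 - x)) + l 3 * (f x * trunc_pow n.+1 (p 3 - x))).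
  by rewrite /spline /l; ring.
split; first by under eq_fun do rewrite E; exact: integrableB_EFin.
under eq_Rintegral do rewrite E.
rewrite RintegralB//; congr (_ - _).
rewrite RintegralD//; congr (_ + _); last by rewrite RintegralZl.
rewrite RintegralD//; congr (_ + _); last by rewrite RintegralZl.
by rewrite RintegralD//; congr (_ + _); rewrite RintegralZl.
Qed.

Lemma weak_spline y : a < y < c ->
  \int[leb]_x (u x * spline 1 y x) = \int[leb]_x (w x * spline 3 y x).
Proof.
move=> acy.
have E1 : derive1 (spline 3 y) = (fun x => - spline 2 y x).
  by apply/funext => x; rewrite derive1E; case: (is_derive_spline 1 y x).
have E2 : derive1 (spline 2 y) = (fun x => - spline 1 y x).
  by apply/funext => x; rewrite derive1E; case: (is_derive_spline 0 y x).
have := uv (@C1c_spline 0 y isT acy); have := vw (@C1c_spline 1 y isT acy).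
rewrite E1 E2.
have N f n : leb.-integrable setT (EFin \o f) -> (forall x, ~~ (a < x < c) -> f x = 0) ->
    \int[leb]_x (f x * - spline n.+1 y x) = - \int[leb]_x (f x * spline n.+1 y x).
  move=> if_ f0; have [ifs _] := Rint_spline n y if_ f0.
  rewrite -mulN1r -RintegralZl//; apply: eq_Rintegral => x _; ring.
by rewrite (N u 0%N)// (N v 1%N)// => /oppr_inj vw' /oppr_inj ->.
Qed.

(** Testing against splines shows that [gap] coincides with its own cubic
    interpolation. *)
Definition gap y := ramp leb u y - \int[leb]_x (w x * trunc_pow 3 (y - x)).

Lemma gap_cubic : exists k0 k1 k2 k3 : R, forall y, a < y < c ->
  gap y = k0 + k1 * y + k2 * y ^+ 2 + k3 * y ^+ 3.
Proof.
have L y : a < y < c -> gap y = lagrange 0 ((y - p 0) / d) * gap (p 0) +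
    lagrange 1 ((y - p 0) / d) * gap (p 1) + lagrange 2 ((y - p 0) / d) * gap (p 2) +
    lagrange 3 ((y - p 0) / d) * gap (p 3).
  move=> acy; have := weak_spline acy.
  have [_ ->] := Rint_spline 0 y iu u0; have [_ ->] := Rint_spline 2 y iw w0.
  by rewrite /gap !ramp_trunc_pow => h; lra.
pose m := p 0; pose e := d^-1.
have zE y : (y - m) / d = y * e - m * e by rewrite mulrBl.
have e1 y : lagrange 0 ((y - m) / d) = - ((y * e - m * e - 1) * (y * e - m * e - 2) * (y * e - m * e - 3)) / 6.
  by rewrite zE.
have e2 y : lagrange 1 ((y - m) / d) = (y * e - m * e) * (y * e - m * e - 2) * (y * e - m * e - 3) / 2.
  by rewrite zE.
have e3 y : lagrange 2 ((y - m) / d) = - ((y * e - m * e) * (y * e - m * e - 1) * (y * e - m * e - 3)) / 2.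
  by rewrite zE.
have e4 y : lagrange 3 ((y - m) / d) = (y * e - m * e) * (y * e - m * e - 1) * (y * e - m * e - 2) / 6.
  by rewrite zE.
move: L; rewrite -/m; move: (gap m) (gap (p 1)) (gap (p 2)) (gap (p 3)) => g0 g1 g2 g3 L.
have quad (q0 q1 q2 A : R) : exists k0 k1 k2 k3 : R, forall y,
    A * ((y * e - q0) * (y * e - q1) * (y * e - q2)) = k0 + k1 * y + k2 * y ^+ 2 + k3 * y ^+ 3.
  exists (- A * q0 * q1 * q2), (A * e * (q0 * q1 + q1 * q2 + q0 * q2)),
    (- A * e ^+ 2 * (q0 + q1 + q2)), (A * e ^+ 3) => y; ring.
have [a0 [a1 [a2 [a3 Ha]]]] := quad (m * e + 1) (m * e + 2) (m * e + 3) (- g0 / 6).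
have [b0 [b1 [b2 [b3 Hb]]]] := quad (m * e) (m * e + 2) (m * e + 3) (g1 / 2).
have [c0 [c1 [c2 [c3 Hc]]]] := quad (m * e) (m * e + 1) (m * e + 3) (- g2 / 2).
have [f0 [f1 [f2 [f3 Hf]]]] := quad (m * e) (m * e + 1) (m * e + 2) (g3 / 6).
exists (a0 + b0 + c0 + f0), (a1 + b1 + c1 + f1), (a2 + b2 + c2 + f2), (a3 + b3 + c3 + f3).
move=> y acy; rewrite L// e1 e2 e3 e4.
transitivity ((a0 + a1 * y + a2 * y ^+ 2 + a3 * y ^+ 3) + (b0 + b1 * y + b2 * y ^+ 2 + b3 * y ^+ 3)
  + (c0 + c1 * y + c2 * y ^+ 2 + c3 * y ^+ 3) + (f0 + f1 * y + f2 * y ^+ 2 + f3 * y ^+ 3)); last ring.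
by rewrite -Ha -Hb -Hc -Hf; field.
Qed.

Definition residue x := if a < x < c then u x - ramp leb w x else 0.

Lemma integrable_residue : leb.-integrable setT (EFin \o residue).
Proof.
have -> : residue = (fun x => u x - (if a < x < c then ramp leb w x else 0)).
  by apply/funext => x; rewrite /residue; case: ifPn => // xac; rewrite u0// subrr.
exact: (integrableB_EFin iu (integrable_ramp_itv iw w0)).
Qed.

Lemma ramp_residue y : a < y < c -> ramp leb residue y = gap y.
Proof.
move=> /andP[ay yc].
have -> : ramp leb residue y = \int[leb]_x (u x * trunc_pow 1 (y - x) -
    (if a < x < c then ramp leb w x else 0) * trunc_pow 1 (y - x)).
  rewrite ramp_trunc_pow; apply: eq_Rintegral => x _; rewrite /residue.
  by case: ifPn => xac; [rewrite mulrBl|rewrite u0// !mul0r subrr].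
have ua x : x <= a -> u x = 0 by move=> xa; apply: u0; rewrite ltNge xa.
rewrite RintegralB//; last 2 first.
- exact: (integrable_trunc_pow _ _ iu ua).
- by apply: (integrable_trunc_pow _ _ (integrable_ramp_itv iw w0)) => x xa; rewrite ltNge xa.
rewrite /gap ramp_trunc_pow; congr (_ - _).
exact: (ramp_iterated iw w0 (conj ay yc)).
Qed.

Hypothesis cu : forall x, a < x < c -> {for x, continuous u}.

Let wa s : s < a -> w s = 0. Proof. by move=> sa; apply: w0; rewrite ltNge ltW. Qed.

(** The second primitive of [residue] is the cubic [gap]; differentiating twice,
    by the fundamental theorem of calculus at points of continuity, gives an affine
    function. *)
Lemma residue_affine : exists k0 k1 : R, forall y, a < y < c ->
  residue y = k0 + k1 * y.
Proof.
have [q0 [q1 [q2 [q3 Q]]]] := gap_cubic.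
have ra s : s < a -> residue s = 0.
  by move=> sa; rewrite /residue ltNge (ltW sa).
exists (2 * q2), (6 * q3) => y /andP[ay yc].
pose P (t : R) := \int[leb]_s (if s <= t then residue s else 0).
have near_ac (t : R) : a < t < c -> \forall s \near t, a < s < c.
  move=> /andP[at_ tc]; near=> s; apply/andP; split; near: s.
    exact: lt_nbhsr.
  exact: lt_nbhsl.
have dpow (t : R) (n : nat) : is_derive t (1 : R) (fun s => s ^+ n.+1) (n.+1%:R * t ^+ n).
  have -> : (fun t : R => t ^+ n.+1) = (id : R -> R) ^+ n.+1.
    by apply/funext => s; rewrite exprfctE.
  apply: (is_derive_eq (is_deriveX n.+1 (is_derive_id t (1:R)))).
  by rewrite /GRing.scale /= mulr1.
have PE t : a < t < c -> P t = q1 + 2 * q2 * t + 3 * q3 * t ^+ 2.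
  move=> tac.
  have h1 := @ramp_rderiv _ _ _ integrable_residue _ ra t.
  have dq : is_derive t (1 : R) (ramp leb residue) (q1 + 2 * q2 * t + 3 * q3 * t ^+ 2).
    apply: (@near_eq_is_derive _ _ _ (fun y => q0 + q1 * y + q2 * y ^+ 2 + q3 * y ^+ 3)).
      by apply: filterS (near_ac t tac) => s sac; rewrite ramp_residue// Q.
    apply: (is_derive_eq (is_deriveD_fun (is_deriveD_fun
      (is_deriveD_fun (is_derive_cst q0 t (1 : R)) (is_deriveZ_fun q1 (is_derive_id t (1 : R))))
      (is_deriveZ_fun q2 (dpow t 1%N))) (is_deriveZ_fun q3 (dpow t 2%N)))).
    ring.
  have h2 := is_derive_right dq.
  exact: (cvg_unique _ h1 h2).
have yac : a < y < c by rewrite ay yc.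
have d1 : is_derive y (1 : R) P (2 * q2 + 6 * q3 * y).
  apply: (@near_eq_is_derive _ _ _ (fun t => q1 + 2 * q2 * t + 3 * q3 * t ^+ 2)).
    by apply: filterS (near_ac y yac) => s sac; rewrite PE.
  apply: (is_derive_eq (is_deriveD_fun
      (is_deriveD_fun (is_derive_cst q1 y (1 : R)) (is_deriveZ_fun (2 * q2) (is_derive_id y (1 : R))))
      (is_deriveZ_fun (3 * q3) (dpow y 1%N)))).
  ring.
have cr : {for y, continuous residue}.
  have cb : {for y, continuous (fun x => u x - ramp leb w x)}.
    by apply: cvgB; [exact: cu|exact: (continuous_ramp iw wa)].
  have Ey : u y - ramp leb w y = residue y by rewrite /residue yac.
  have cb' : (u x - ramp leb w x) @[x --> y] --> residue y by rewrite -Ey; exact: cb.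
  apply: cvg_trans cb'; apply: near_eq_cvg.
  by apply: filterS (near_ac y yac) => s sac; rewrite /residue sac.
have [dP P'] : derivable P y 1 /\ derive1 P y = residue y.
  have PF : P = (fun t => \int[leb]_(s in [set` Interval -oo%O (BRight t)]) residue s).
    apply/funext => t; rewrite [RHS]Rintegral_mkcond; congr (Rintegral _ _ _).
    by apply/funext => s; rewrite /patch mem_setE in_itv.
  rewrite PF; apply: (@continuous_FTC1 _ residue -oo%O y (y + 1)) => //.
  - by rewrite ltrDl.
  - by apply: integrableS integrable_residue.
  - exact: ltNyr.
rewrite -P' derive1E; by case: d1 => _ ->.
Unshelve. all: by end_near. Qed.

(** The elementary one-dimensional case of elliptic regularity. *)
Lemma weak_regularity : exists k0 k1 : R, forall y, a < y < c ->
  u y = k0 + k1 * y + ramp leb w y.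
Proof.
have [k0 [k1 H]] := residue_affine; exists k0, k1 => y yac.
by rewrite -H// /residue yac subrK.
Qed.

End Support.
End WeakRegularity.

(** * Lebesgue measure with atoms *)

Section AtomicMeasure.
Variables (R : realType) (p : nat -> R).
Notation leb := (@lebesgue_measure R).

Fixpoint add_atoms (n : nat) : {measure set (measurableTypeR R) -> \bar R} :=
  if n is m.+1 then measure_add (add_atoms m) (dirac (p m : measurableTypeR R))
  else leb.

(** A constant of its own, to carry the instance of sigma-finite measure that
    Fubini's theorem asks for. *)
Definition atoms_measure (n : nat) (A : set (measurableTypeR R)) : \bar R := add_atoms n A.

HB.instance Definition _ n := isMeasure.Build _ _ _ (atoms_measure n)
  (@measure0 _ _ _ (add_atoms n)) (@measure_ge0 _ _ _ (add_atoms n))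
  (@measure_semi_sigma_additive _ _ _ (add_atoms n)).

Lemma add_atomsS n A : add_atoms n.+1 A =
  (add_atoms n A + dirac (p n : measurableTypeR R) A)%E.
Proof. exact: measure_addE. Qed.

Lemma atoms_sigma_finite n : sigma_finite setT (atoms_measure n).
Proof.
exists (fun k => `[- k%:R, k%:R]%classic).
  apply/esym; rewrite -subTset => x _; exists (Num.truncn `|x|).+1 => //=.
  by rewrite in_itv /= -ler_norml ltW// truncnS_gt.
move=> k; split => //; rewrite /atoms_measure; elim: n => [|n IH].
  have -> : add_atoms 0 `[- k%:R, k%:R]%classic = lebesgue_measure ([set` `[- k%:R, k%:R]] : set R) by [].
  by rewrite lebesgue_measure_itv; case: ifP => //= _; rewrite ltry.
rewrite add_atomsS lte_add_pinfty//.
by rewrite diracE ltry.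
Qed.

HB.instance Definition _ n := @Measure_isSigmaFinite.Build _ _ _ (atoms_measure n) (atoms_sigma_finite n).

Lemma integrable_dirac (a : R) (f : R -> R) : measurable_fun setT f ->
  (dirac (a : measurableTypeR R) : {measure set _ -> \bar R}).-integrable setT (EFin \o f).
Proof.
move=> mf; have mf' : measurable_fun setT (EFin \o f) by exact/measurable_EFinP.
apply/integrableP; split => //.
rewrite integral_dirac//; last exact: measurableT_comp.
by rewrite diracT mul1e /= ltry.
Qed.

Lemma Rint_atoms (f : R -> R) n : leb.-integrable setT (EFin \o f) ->
  (atoms_measure n).-integrable setT (EFin \o f) /\
  \int[atoms_measure n]_x f x = \int[leb]_x f x + \sum_(k < n) f (p k).
Proof.
move=> if_; suff [h1 h2] : (add_atoms n).-integrable setT (EFin \o f) /\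
    \int[add_atoms n]_x f x = \int[leb]_x f x + \sum_(k < n) f (p k).
  have E (h : R -> \bar R) : (\int[atoms_measure n]_x h x = \int[add_atoms n]_x h x)%E.
    exact: eq_measure_integral.
  split; last by rewrite -h2 /Rintegral E.
  by case/integrableP: h1 => h11 h12; apply/integrableP; split => //; rewrite E.
have mf : measurable_fun setT f by apply/measurable_EFinP; exact: measurable_int if_.
have mf' : measurable_fun setT (EFin \o f) by exact/measurable_EFinP.
elim: n => [|n [IH1 IH2]]; first by rewrite big_ord0 addr0.
have id_ := integrable_dirac (p n) mf.
split.
  apply/integrableP; split => //.
  rewrite ge0_integral_measure_add//; last exact: measurableT_comp.
  by rewrite lte_add_pinfty//; [case/integrableP: IH1|case/integrableP: id_].
rewrite big_ord_recr /= addrA -IH2 /Rintegral integral_measure_add// fineD.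
- congr (_ + _); rewrite integral_dirac// diracT mul1e//.
- exact: integrable_fin_num.
- exact: integrable_fin_num.
Qed.

Lemma cint_atoms (f : R -> R[i]) n : cintegrable leb f ->
  cintegrable (atoms_measure n) f /\
  cint (atoms_measure n) f = cint leb f + \sum_(k < n) f (p k).
Proof.
move=> [i1 i2]; have [j1 e1] := Rint_atoms n i1; have [j2 e2] := Rint_atoms n i2.
split; first by [].
have sR : Re (\sum_(k < n) f (p k)) = \sum_(k < n) Re (f (p k)).
  by apply: (big_morph (@complex.Re R)) => // x y; rewrite Re_add.
have sI : Im (\sum_(k < n) f (p k)) = \sum_(k < n) Im (f (p k)).
  by apply: (big_morph (@complex.Im R)) => // x y; rewrite Im_add.
by apply: complexP; rewrite ?Re_add ?Im_add /= ?e1 ?e2 ?sR ?sI.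
Qed.

End AtomicMeasure.

(** * Ramp integrals of complex densities *)

Section ComplexRamp.
Variables (R : realType) (m : {measure set (measurableTypeR R) -> \bar R}).
Variables (a : R).
Implicit Types (phi : R -> R[i]) (x : R).

Definition cramp phi x := cint m (fun s => if s < x then (x - s)%:C * phi s else 0).

Lemma Re_cramp phi x : Re (cramp phi x) = ramp m (fun s => Re (phi s)) x.
Proof.
rewrite /cramp /ramp /=; apply: eq_Rintegral => s _; case: ifP => // _.
by rewrite mulrC Re_mulr mulrC.
Qed.

Lemma Im_cramp phi x : Im (cramp phi x) = ramp m (fun s => Im (phi s)) x.
Proof.
rewrite /cramp /ramp /=; apply: eq_Rintegral => s _; case: ifP => // _.
by rewrite mulrC Im_mulr mulrC.
Qed.

Lemma cintegrable_cramp phi x : cintegrable m phi -> (forall s, s < a -> phi s = 0) ->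
  cintegrable m (fun s => if s < x then (x - s)%:C * phi s else 0).
Proof.
move=> [i1 i2] phi0; split.
  have -> : (fun s => Re (if s < x then (x - s)%:C * phi s else 0)) =
      (fun s => if s < x then (x - s) * Re (phi s) else 0).
    by apply/funext => s; case: ifP => // _; rewrite mulrC Re_mulr mulrC.
  by apply: (integrable_ramp i1 (a := a)) => s /phi0 ->.
have -> : (fun s => Im (if s < x then (x - s)%:C * phi s else 0)) =
    (fun s => if s < x then (x - s) * Im (phi s) else 0).
  by apply/funext => s; case: ifP => // _; rewrite mulrC Im_mulr mulrC.
by apply: (integrable_ramp i2 (a := a)) => s /phi0 ->.
Qed.

Lemma has_lderiv_cramp phi x : cintegrable m phi -> (forall s, s < a -> phi s = 0) ->
  has_lderiv (cramp phi) x (cint m (fun s => if s < x then phi s else 0)).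
Proof.
move=> [i1 i2] phi0; split => /=.
  have -> : (fun t => Re (cramp phi t)) = ramp m (fun s => Re (phi s)).
    by apply/funext => t; rewrite Re_cramp.
  under eq_Rintegral do rewrite (fun_if (@complex.Re R)).
  by apply: (@ramp_lderiv _ _ _ i1 a) => s /phi0 ->.
have -> : (fun t => Im (cramp phi t)) = ramp m (fun s => Im (phi s)).
  by apply/funext => t; rewrite Im_cramp.
under eq_Rintegral do rewrite (fun_if (@complex.Im R)).
by apply: (@ramp_lderiv _ _ _ i2 a) => s /phi0 ->.
Qed.

Lemma has_rderiv_cramp phi x : cintegrable m phi -> (forall s, s < a -> phi s = 0) ->
  has_rderiv (cramp phi) x (cint m (fun s => if s <= x then phi s else 0)).
Proof.
move=> [i1 i2] phi0; split => /=.
  have -> : (fun t => Re (cramp phi t)) = ramp m (fun s => Re (phi s)).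
    by apply/funext => t; rewrite Re_cramp.
  under eq_Rintegral do rewrite (fun_if (@complex.Re R)).
  by apply: (@ramp_rderiv _ _ _ i1 a) => s /phi0 ->.
have -> : (fun t => Im (cramp phi t)) = ramp m (fun s => Im (phi s)).
  by apply/funext => t; rewrite Im_cramp.
under eq_Rintegral do rewrite (fun_if (@complex.Im R)).
by apply: (@ramp_rderiv _ _ _ i2 a) => s /phi0 ->.
Qed.

Lemma crampD phi psi x : cintegrable m phi -> (forall s, s < a -> phi s = 0) ->
  cintegrable m psi -> (forall s, s < a -> psi s = 0) ->
  cramp (fun s => phi s + psi s) x = cramp phi x + cramp psi x.
Proof.
move=> i1 h1 i2 h2; rewrite /cramp -cintD; [|exact: cintegrable_cramp..].
by apply: eq_cint => s; case: ifP => _; rewrite ?mulrDr ?addr0.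
Qed.

Lemma cintegrable_restr (P : R -> bool) phi : measurable_fun setT P ->
  cintegrable m phi -> cintegrable m (fun s => if P s then phi s else 0).
Proof.
move=> mP i1; apply: (@cintegrable_le _ _ _ m _ (fun s => norm1 (phi s))).
- apply: (@cmeas_if _ _ _ P) => //; exact: cintegrable_cmeas i1.
- exact: cintegrable_norm1.
- by move=> s; case: ifP => // _; rewrite norm1_0 norm1_ge0.
Qed.

(** The second derivative of the ramp is [phi m], which does not charge [(c, d)]. *)
Lemma cramp_affine phi (c d : R) : cintegrable m phi ->
  (forall s, s < a -> phi s = 0) -> (forall s, c < s < d -> phi s = 0) ->
  exists k0 k1 : R[i], forall y, c < y < d -> cramp phi y = k0 + k1 * y%:C.
Proof.
move=> i1 phi0 phicd.
have mc : measurable_fun setT (fun s : R => s <= c) by exact: measurable_fun_ler.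
pose chi s := if s <= c then phi s else 0.
have ichi : cintegrable m chi by exact: cintegrable_restr.
have is_ : cintegrable m (fun s => s%:C * chi s).
  apply: (@cintegrable_le _ _ _ m _ (fun s => (`|a| + `|c|) * norm1 (chi s))).
  - by apply: cmeasM; [exact: cmeas_real|exact: cintegrable_cmeas ichi].
  - by apply: integrableZ_EFin; exact: cintegrable_norm1.
  - move=> s; rewrite mulrC norm1Mr mulrC.
    have [sa|sa] := ltP s a.
      have -> : chi s = 0 by rewrite /chi phi0//; case: ifP.
      by rewrite norm1_0 !mulr0.
    rewrite /chi; case: ifP => sc; last by rewrite norm1_0 !mulr0.
    rewrite ler_wpM2r ?norm1_ge0// ler_norml.
    have := ler_norm c; have := ler_norm (- a); rewrite normrN.
    have := normr_ge0 a; have := normr_ge0 c.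
    by move=> h1 h2 h3 h4; apply/andP; split; lra.
exists (- cint m (fun s => s%:C * chi s)), (cint m chi) => y /andP[cy yd].
have -> : cramp phi y = cint m (fun s => y%:C * chi s - s%:C * chi s).
  apply: eq_cint => s; rewrite /chi; case: (ltP s y) => sy; last first.
    rewrite ifF ?mulr0 ?subrr//; apply/negbTE; rewrite -ltNge; lra.
  case: leP => sc; first by rewrite -mulrBl -rmorphB.
  by rewrite phicd ?mulr0 ?subrr// sc (lt_trans sy yd).
rewrite cintB//; last exact: cintegrableZ.
by rewrite cintZ// addrC [X in _ + X = _]mulrC.
Qed.

End ComplexRamp.

(** * Absolutely continuous and square-integrable functions *)

Lemma norm1_distC (R : realType) (z w : R[i]) : norm1 (z - w) = norm1 (w - z).
Proof. by rewrite -(norm1N (z - w)) opprB. Qed.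

Section AbsCont.
Variables (R : realType) (b : R) (e : R -> R[i]).
Hypothesis (b0 : 0 < b) (ace : abs_cont 0 b e).

Lemma abs_cont_dist (eps : R) : 0 < eps -> exists2 delta : R, 0 < delta &
  forall s t, 0 <= s <= b -> 0 <= t <= b -> `|s - t| < delta -> norm1 (e s - e t) < eps.
Proof.
move=> eps0; have [|delta d0 H] := ace (eps := eps / 2); first by rewrite divr_gt0.
exists delta => //.
have le s t : 0 <= s <= b -> 0 <= t <= b -> s <= t -> `|s - t| < delta -> norm1 (e t - e s) < eps.
  move=> /andP[s0 sb] /andP[t0 tb] st std.
  have := H 1%N (fun=> s) (fun=> t); rewrite !big_ord1 => H1.
  apply: le_lt_trans (norm1_normc _) _; rewrite mulrC -ltr_pdivlMr//; apply: H1.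
  - by move=> i; rewrite s0 st tb.
  - by move=> i j; rewrite !ord1 eqxx.
  - by rewrite distrC ger0_norm in std => //; rewrite subr_ge0.
move=> s t hs ht st; have [l|l] := leP s t.
  by rewrite norm1_distC; apply: le.
by apply: le => //; [exact: ltW|rewrite distrC].
Qed.

(** Composed with the projection onto [[0, b]], a function that is controlled on
    [[0, b]] only becomes continuous on the whole line. *)
Definition clamp (x : R) : R := Num.max 0 (Num.min b x).

Lemma clamp_itv x : 0 <= clamp x <= b.
Proof.
by rewrite /clamp le_max lexx /= ge_max ltW//= ge_min lexx.
Qed.

Lemma clamp_id x : 0 <= x <= b -> clamp x = x.
Proof. by move=> /andP[x0 xb]; rewrite /clamp min_r// max_r. Qed.

Lemma clamp_lip x y : `|clamp x - clamp y| <= `|x - y|.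
Proof.
rewrite ler_norml; have := ler_norm (x - y); have := ler_norm (y - x).
rewrite distrC => h1 h2; have := normr_ge0 (x - y) => h0.
rewrite /clamp /Num.max /Num.min.
by case: (ltP b x) => h3; case: (ltP b y) => h4; case: ltP => h5; case: ltP => h6;
  apply/andP; split; lra.
Qed.

Lemma continuous_clamped (f : R[i] -> R) :
  (forall z w, `|f z - f w| <= norm1 (z - w)) -> continuous (fun x => f (e (clamp x))).
Proof.
move=> fl x; apply/cvgrPdist_lt => eps eps0.
have [delta d0 H] := abs_cont_dist eps0; exists delta => //= t xt.
apply: le_lt_trans (fl _ _) _; apply: H; try exact: clamp_itv.
exact: le_lt_trans (clamp_lip _ _) xt.
Qed.

Lemma lipRe (z w : R[i]) : `|Re z - Re w| <= norm1 (z - w).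
Proof. by rewrite -raddfB norm1_Re. Qed.

Lemma lipIm (z w : R[i]) : `|Im z - Im w| <= norm1 (z - w).
Proof. by rewrite -raddfB norm1_Im. Qed.

Lemma lip_norm1 (z w : R[i]) : `|norm1 z - norm1 w| <= norm1 (z - w).
Proof.
rewrite ler_norml; have h1 := norm1D (z - w) w; have h2 := norm1D (w - z) z.
rewrite subrK in h1; rewrite subrK norm1_distC in h2.
by apply/andP; split; lra.
Qed.

Lemma continuous_in (f : R[i] -> R) x : (forall z w, `|f z - f w| <= norm1 (z - w)) ->
  0 < x < b -> {for x, continuous (fun t => f (e t))}.
Proof.
move=> fl /andP[x0 xb].
have cx : f (e (clamp t)) @[t --> x] --> f (e x).
  have := @continuous_clamped f fl x; rewrite /continuous_at clamp_id//.
  by rewrite !ltW.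
apply: cvg_trans cx; apply: near_eq_cvg.
near=> t; rewrite clamp_id//; apply/andP; split; apply/ltW; near: t.
  exact: lt_nbhsr.
exact: lt_nbhsl.
Unshelve. all: by end_near. Qed.

Lemma cvg_left (f : R[i] -> R) x : (forall z w, `|f z - f w| <= norm1 (z - w)) ->
  0 < x <= b -> f (e t) @[t --> x^'-] --> f (e x).
Proof.
move=> fl /andP[x0 xb].
have cx : f (e (clamp t)) @[t --> x^'-] --> f (e x).
  have := @continuous_clamped f fl x; rewrite /continuous_at clamp_id ?(ltW x0)// => h.
  exact: cvg_at_left_filter.
apply: cvg_trans cx; apply: near_eq_cvg.
near=> t; rewrite clamp_id//; apply/andP; split.
  by apply/ltW; near: t; exact: nbhs_left_gt.
by rewrite (le_trans _ xb)// ltW//; near: t; exact: nbhs_left_lt.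
Unshelve. all: by end_near. Qed.

Definition zext (s : R) : R[i] := if 0 <= s <= b then e s else 0.

Lemma cmeas_zext : cmeas zext.
Proof.
have -> : zext = (fun s => if 0 <= s <= b then e (clamp s) else 0).
  by apply/funext => s; rewrite /zext; case: ifP => // h; rewrite clamp_id.
apply: (@cmeas_if _ _ _ (fun s : R => 0 <= s <= b)) => //.
  by apply: measurable_and; exact: measurable_fun_ler.
by split; apply: continuous_measurable_fun; apply: continuous_clamped; [exact: lipRe|exact: lipIm].
Qed.

Lemma zext_bound : exists2 M : R, 0 <= M & forall s, norm1 (zext s) <= M.
Proof.
have [c cb H] := @EVT_max R (fun x => norm1 (e (clamp x))) 0 b (ltW b0)
  (continuous_subspaceT (continuous_clamped lip_norm1)).
exists (norm1 (e (clamp c))); first exact: norm1_ge0.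
move=> s; rewrite /zext; case: ifP => sb; last by rewrite norm1_0 norm1_ge0.
by have := H s; rewrite in_itv /= sb clamp_id// => /(_ isT).
Qed.

End AbsCont.

Lemma cint_ae (R : realType) (f g : R -> R[i]) : cmeas f -> cmeas g ->
  {ae (@lebesgue_measure R), forall s : R, f s = g s} ->
  cint (@lebesgue_measure R) f = cint (@lebesgue_measure R) g.
Proof.
move=> [f1 f2] [g1 g2] fg; rewrite /cint; congr (_ +i* _); congr fine; apply: ae_eq_integral => //;
  try exact/measurable_EFinP.
- by apply: (@filterS _ _ (ae_filter_ringOfSetsType (@lebesgue_measure R)) _ _ _ fg) => x fgx _; rewrite fgx.
- by apply: (@filterS _ _ (ae_filter_ringOfSetsType (@lebesgue_measure R)) _ _ _ fg) => x fgx _; rewrite fgx.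
Qed.

Section WeakComplex.
Variables (R : realType) (a c : R).
Notation leb := (@lebesgue_measure R).
Implicit Types (u v w : R -> R[i]).

Definition restr u (s : R) : R[i] := if a < s < c then u s else 0.

Lemma normc_sqr (z : R[i]) : ComplexField.Normc.normc z ^+ 2 = Re z ^+ 2 + Im z ^+ 2.
Proof. by case: z => x y /=; rewrite sqr_sqrtr// addr_ge0// sqr_ge0. Qed.

Lemma L2_cmeas u : L2 a c u -> cmeas (restr u).
Proof.
move=> [mR mI _].
have mitv : measurable (`]a, c[%classic : set (measurableTypeR R)) by [].
have mx (h : R -> R) : measurable_fun `]a, c[ h ->
    measurable_fun setT (fun s => if a < s < c then h s else 0).
  move=> mh; have -> : (fun s => if a < s < c then h s else 0) = h \_ `]a, c[%classic.
    by apply/funext => s; rewrite patch_itv.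
  exact: (measurable_restrictT h mitv).1.
split; rewrite /restr.
  by under eq_fun do rewrite (fun_if (@complex.Re R)); exact: mx.
by under eq_fun do rewrite (fun_if (@complex.Im R)); exact: mx.
Qed.

Lemma norm1_sqr_le (z : R[i]) : norm1 z ^+ 2 <= 2 * ComplexField.Normc.normc z ^+ 2.
Proof.
rewrite normc_sqr /norm1 -[Re z ^+ 2]real_normK ?num_real// -[Im z ^+ 2]real_normK ?num_real//.
by have := sqr_ge0 (`|Re z| - `|Im z|); lra.
Qed.

Lemma L2_norm1_sqr u : L2 a c u ->
  leb.-integrable setT (EFin \o (fun s => norm1 (restr u s) ^+ 2)).
Proof.
move=> hu; have mu := L2_cmeas hu; have [mR mI fin] := hu.
have mn : measurable_fun setT (fun s => norm1 (restr u s) ^+ 2).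
  by apply: measurable_funX; exact: cmeas_norm1.
pose G s : R := ComplexField.Normc.normc (restr u s) ^+ 2.
have iG : leb.-integrable setT (EFin \o G).
  apply/integrableP; split.
    have [m1 m2] := mu; apply/measurable_EFinP; rewrite /G.
    under eq_fun do rewrite normc_sqr.
    by apply: measurable_funD; apply: measurable_funX.
  apply: le_lt_trans fin; rewrite [leRHS]integral_mkcond.
  rewrite le_eqVlt; apply/orP; left; apply/eqP.
  apply: eq_integral => s _; rewrite /G /restr /patch mem_setE in_itv /=.
  case: ifP => _; first by rewrite ger0_norm// sqr_ge0.
  by rewrite normc_sqr /= expr0n addr0 normr0.
apply: (le_integrable _ _ _ (integrableZ_EFin 2 iG)) => //; first exact/measurable_EFinP.
move=> s _; rewrite /= lee_fin ger0_norm ?sqr_ge0//; apply: le_trans (ler_norm _).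
exact: norm1_sqr_le.
Qed.

Lemma L2_restr u : L2 a c u -> cintegrable leb (restr u).
Proof.
move=> hu.
apply: (@cintegrable_le _ _ _ leb _ (fun s => 1 * \1_(`]a, c[%classic) s + norm1 (restr u s) ^+ 2) (L2_cmeas hu)).
  by apply: integrableD_EFin; [exact: integrable_cst_itv|exact: L2_norm1_sqr].
move=> s; rewrite indicE mem_setE in_itv /= mul1r /restr.
case: ifP => _; last by rewrite norm1_0 expr0n addr0.
(* [n <= 1 + n ^+ 2] *)
by rewrite mulr1n; move: (norm1 (u s)) => n; have := sqr_ge0 (n - 2^-1); lra.
Qed.

Lemma weak_deriv_parts u v phi : weak_deriv a c u v -> C1c a c phi ->
  (\int[leb]_x (Re (restr u x) * derive1 phi x) = - (\int[leb]_x (Re (restr v x) * phi x))) /\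
  (\int[leb]_x (Im (restr u x) * derive1 phi x) = - (\int[leb]_x (Im (restr v x) * phi x))).
Proof.
move=> [_ _ H] /H; rewrite /cintegral => /eqP; rewrite eq_complex /= => /andP[/eqP hR /eqP hI].
have ER (z : R -> R[i]) (k : R -> R) : \int[leb]_(x in `]a, c[) Re (z x * (k x)%:C) =
    \int[leb]_x (Re (restr z x) * k x).
  rewrite Rintegral_mkcond; congr (Rintegral _ _ _); apply/funext => x.
  rewrite (patch_itv (fun x => Re (z x * (k x)%:C))) /restr Re_mulr.
  by case: ifP; rewrite ?mul0r.
have EI (z : R -> R[i]) (k : R -> R) : \int[leb]_(x in `]a, c[) Im (z x * (k x)%:C) =
    \int[leb]_x (Im (restr z x) * k x).
  rewrite Rintegral_mkcond; congr (Rintegral _ _ _); apply/funext => x.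
  rewrite (patch_itv (fun x => Im (z x * (k x)%:C))) /restr Im_mulr.
  by case: ifP; rewrite ?mul0r.
by rewrite -!ER -!EI.
Qed.

Lemma weak2_regular u w : a < c -> weak_deriv2 a c u w ->
  (forall x, a < x < c -> {for x, continuous (fun t => Re (u t))}) ->
  (forall x, a < x < c -> {for x, continuous (fun t => Im (u t))}) ->
  cintegrable leb (restr w) /\
  exists k0 k1 : R[i], forall y, a < y < c -> u y = k0 + k1 * y%:C + cramp leb (restr w) y.
Proof.
move=> ac [v uv vw] cR cI.
have [L2u L2v _] := uv; have [_ L2w _] := vw.
have [iuR iuI] := L2_restr L2u; have [ivR ivI] := L2_restr L2v.
have [iwR iwI] := L2_restr L2w.
split; first by [].
have z0 (z : R -> R[i]) x : ~~ (a < x < c) -> restr z x = 0.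
  by rewrite /restr => /negbTE ->.
have zR (z : R -> R[i]) x : ~~ (a < x < c) -> Re (restr z x) = 0 by move=> /(z0 z) ->.
have zI (z : R -> R[i]) x : ~~ (a < x < c) -> Im (restr z x) = 0 by move=> /(z0 z) ->.
have near_ac (t : R) : a < t < c -> \forall s \near t, a < s < c.
  move=> /andP[at_ tc]; near=> s; apply/andP; split; near: s.
    exact: lt_nbhsr.
  exact: lt_nbhsl.
have cR' x : a < x < c -> {for x, continuous (fun t => Re (restr u t))}.
  move=> xac; have cx : Re (u t) @[t --> x] --> Re (restr u x).
    by rewrite /restr xac; exact: cR.
  apply: cvg_trans cx; apply: near_eq_cvg.
  by apply: filterS (near_ac x xac) => s sac; rewrite /restr sac.
have cI' x : a < x < c -> {for x, continuous (fun t => Im (restr u t))}.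
  move=> xac; have cx : Im (u t) @[t --> x] --> Im (restr u x).
    by rewrite /restr xac; exact: cI.
  apply: cvg_trans cx; apply: near_eq_cvg.
  by apply: filterS (near_ac x xac) => s sac; rewrite /restr sac.
have [r0 [r1 HR]] := weak_regularity ac iuR ivR iwR (zR u) (zR v) (zR w)
  (fun phi h => (weak_deriv_parts uv h).1) (fun phi h => (weak_deriv_parts vw h).1) cR'.
have [i0 [i1 HI]] := weak_regularity ac iuI ivI iwI (zI u) (zI v) (zI w)
  (fun phi h => (weak_deriv_parts uv h).2) (fun phi h => (weak_deriv_parts vw h).2) cI'.
exists (r0 +i* i0), (r1 +i* i1) => y yac; apply: complexP.
  by have := HR y yac; rewrite /restr yac !Re_add Re_mulr Re_cramp.
by have := HI y yac; rewrite /restr yac !Im_add Im_mulr Im_cramp.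
Unshelve. all: by end_near. Qed.

Lemma cramp_ae u v y : cmeas (restr u) -> cmeas (restr v) ->
  {ae leb, forall x : R, a < x < c -> u x = v x} ->
  cramp leb (restr u) y = cramp leb (restr v) y.
Proof.
move=> mu mv uv.
have mk (z : R -> R[i]) : cmeas (restr z) -> cmeas (fun s : R => if s < y then (y - s)%:C * restr z s else 0).
  move=> mz; apply: (@cmeas_if _ _ _ (fun s : R => s < y)) => //; first exact: measurable_fun_ltr.
  by apply: cmeasM => //; apply: cmeas_real; exact: measurable_funB.
rewrite /cramp; apply: (cint_ae (mk u mu) (mk v mv)).
apply: (@filterS _ _ (ae_filter_ringOfSetsType leb) _ _ _ uv) => x uvx.
by rewrite /restr; case: ifP => // _; case: ifP => // h; rewrite uvx.
Qed.

End WeakComplex.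

(** * One-sided derivatives and gluing *)

Section Glue.
Variable R : realType.
Lemma diff_quotD (f g : R -> R) x t :
  diff_quot (fun t => f t + g t) x t = diff_quot f x t + diff_quot g x t.
Proof. by rewrite /diff_quot -mulrDl; congr (_ / _); ring. Qed.

Lemma has_lderivD (f g : R -> R[i]) x d e : has_lderiv f x d -> has_lderiv g x e ->
  has_lderiv (fun t => f t + g t) x (d + e).
Proof.
move=> [f1 f2] [g1 g2]; split.
  rewrite Re_add; under [fun t => Re (_ + _)]eq_fun do rewrite Re_add.
  by under eq_fun do rewrite diff_quotD; exact: cvgD.
rewrite Im_add; under [fun t => Im (_ + _)]eq_fun do rewrite Im_add.
by under eq_fun do rewrite diff_quotD; exact: cvgD.
Qed.

Lemma has_rderivD (f g : R -> R[i]) x d e : has_rderiv f x d -> has_rderiv g x e ->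
  has_rderiv (fun t => f t + g t) x (d + e).
Proof.
move=> [f1 f2] [g1 g2]; split.
  rewrite Re_add; under [fun t => Re (_ + _)]eq_fun do rewrite Re_add.
  by under eq_fun do rewrite diff_quotD; exact: cvgD.
rewrite Im_add; under [fun t => Im (_ + _)]eq_fun do rewrite Im_add.
by under eq_fun do rewrite diff_quotD; exact: cvgD.
Qed.

Lemma has_deriv_l (f : R -> R[i]) x d : has_deriv f x d -> has_lderiv f x d.
Proof. by move=> [f1 f2]; split; exact: is_derive_left. Qed.

Lemma has_deriv_r (f : R -> R[i]) x d : has_deriv f x d -> has_rderiv f x d.
Proof. by move=> [f1 f2]; split; exact: is_derive_right. Qed.

Lemma has_deriv_lr (f : R -> R[i]) x d : has_lderiv f x d -> has_rderiv f x d -> has_deriv f x d.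
Proof. by move=> [f1 f2] [g1 g2]; split; exact: is_derive_lr. Qed.

Lemma has_lderiv_unique (f : R -> R[i]) x d e : has_lderiv f x d -> has_lderiv f x e -> d = e.
Proof.
by move=> [f1 f2] [g1 g2]; apply: complexP; [exact: (cvg_unique _ f1 g1)|exact: (cvg_unique _ f2 g2)].
Qed.

Lemma has_lderiv_eq (f g : R -> R[i]) a x d : a < x ->
  (forall t, a <= t <= x -> f t = g t) -> has_lderiv f x d -> has_lderiv g x d.
Proof.
move=> ax fg [f1 f2]; have gx : f x = g x by apply: fg; rewrite lexx ltW.
split; [apply: cvg_trans f1|apply: cvg_trans f2]; apply: near_eq_cvg; near=> t;
  rewrite /diff_quot gx fg//; apply/andP; split; rewrite ltW//; near: t;
  by [exact: nbhs_left_gt|exact: nbhs_left_lt].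
Unshelve. all: by end_near. Qed.

Lemma has_rderiv_eq (f g : R -> R[i]) x b d : x < b ->
  (forall t, x <= t <= b -> f t = g t) -> has_rderiv f x d -> has_rderiv g x d.
Proof.
move=> ax fg [f1 f2]; have gx : f x = g x by apply: fg; rewrite lexx ltW.
split; [apply: cvg_trans f1|apply: cvg_trans f2]; apply: near_eq_cvg; near=> t;
  rewrite /diff_quot gx fg//; apply/andP; split; rewrite ltW//; near: t;
  by [exact: nbhs_right_gt|exact: nbhs_right_lt].
Unshelve. all: by end_near. Qed.

(** The difference is affine and vanishes to first order at [a]. *)
Lemma glue_real (f F : R -> R) (a c k0 k1 d : R) : a < c -> f a = F a ->
  diff_quot f a t @[t --> a^'+] --> d -> diff_quot F a t @[t --> a^'+] --> d ->
  (forall y, a < y < c -> f y - F y = k0 + k1 * y) ->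
  forall y, a < y < c -> f y = F y.
Proof.
move=> ac fa hf hF H.
pose D t := diff_quot f a t - diff_quot F a t.
have D0 : D t @[t --> a^'+] --> (0 : R) by rewrite -(subrr d); exact: cvgB.
have DE t : a < t < c -> D t * (t - a) = k0 + k1 * t.
  move=> tac; have /andP[at_ tc] := tac.
  rewrite -H// /D /diff_quot -mulrBl divfK ?subr_eq0 ?gt_eqF// fa; ring.
have near_ac : \forall t \near a^'+, a < t < c.
  near=> t; apply/andP; split; near: t; by [exact: nbhs_right_gt|exact: nbhs_right_lt].
have c1 : (t : R) @[t --> a^'+] --> a by apply: cvg_at_right_filter; exact: cvg_id.
have A0 : k0 + k1 * a = 0.
  have l1 : D t * (t - a) @[t --> a^'+] --> (0 * (a - a) : R).
    by apply: cvgM => //; apply: cvgB => //; exact: cvg_cst.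
  have l2 : D t * (t - a) @[t --> a^'+] --> (k0 + k1 * a : R).
    have l3 : k0 + k1 * t @[t --> a^'+] --> (k0 + k1 * a : R).
      by apply: cvgD; [exact: cvg_cst|apply: cvgM => //; exact: cvg_cst].
    apply: cvg_trans l3; apply: near_eq_cvg.
    by apply: filterS near_ac => t tac; rewrite DE.
  by rewrite mul0r in l1; rewrite (cvg_unique _ l2 l1).
have K1 : k1 = 0.
  have l2 : D t @[t --> a^'+] --> k1.
    apply: cvg_near_cst; apply: filterS near_ac => t tac.
    have /andP[at_ tc] := tac; have ta : t - a != 0 by rewrite subr_eq0 gt_eqF.
    apply: (mulIf ta); rewrite DE// mulrBr -[k0](addrK (k1 * a)) A0; ring.
  exact: (cvg_unique _ l2 D0).
move=> y yac; apply/eqP; rewrite -subr_eq0 H//.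
by move: A0; rewrite K1 !mul0r !addr0 => ->.
Unshelve. all: by end_near. Qed.

Lemma glue (f F : R -> R[i]) (a c : R) (k0 k1 d : R[i]) : a < c -> f a = F a ->
  has_rderiv f a d -> has_rderiv F a d ->
  (forall y, a < y < c -> f y - F y = k0 + k1 * y%:C) ->
  forall y, a < y < c -> f y = F y.
Proof.
move=> ac fa [f1 f2] [F1 F2] H y yac; apply: complexP.
  apply: (@glue_real (fun t => Re (f t)) (fun t => Re (F t)) a c (Re k0) (Re k1)) f1 F1 _ _ yac => //.
    by rewrite fa.
  by move=> t tac; rewrite -raddfB /= H// Re_add Re_mulr.
apply: (@glue_real (fun t => Im (f t)) (fun t => Im (F t)) a c (Im k0) (Im k1)) f2 F2 _ _ yac => //.
  by rewrite fa.
by move=> t tac; rewrite -raddfB /= H// Im_add Im_mulr.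
Qed.

End Glue.

(** * Order of the nodes *)

Section Nodes.
Variables (R : realType) (b : R) (N : nat) (xs : 'I_N -> R) (alpha : 'I_N -> R[i]).
Hypotheses (hb : 0 < b) (hI : interactions b xs alpha).
Notation nd := (node b xs).

Lemma node_last : nd N.+1 = b.
Proof. by rewrite /node insubF ?ltnn. Qed.

Lemma nodeS (k : 'I_N) : nd k.+1 = xs k.
Proof. by rewrite /node /= valK. Qed.

Lemma node_step k : (k <= N)%N -> nd k < nd k.+1.
Proof.
have [h1 h2 _] := hI.
case: k => [_|k kN].
  have [N0|N0] := posnP N.
    by rewrite /= insubF ?N0.
  by rewrite -[1%N]/((Ordinal N0).+1) nodeS; have /andP[] := h1 (Ordinal N0).
rewrite -[k.+1]/((Ordinal kN).+1) nodeS.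
have [kN1|kN1] := ltnP k.+1 N.
  by rewrite -[k.+2]/((Ordinal kN1).+1) nodeS; apply: h2.
have -> : (Ordinal kN).+2 = N.+1 by apply/eqP; rewrite eqn_leq /= ltnS kN ltnS.
by rewrite node_last; have /andP[] := h1 (Ordinal kN).
Qed.

Lemma node_lt j k : (j < k)%N -> (k <= N.+1)%N -> nd j < nd k.
Proof.
elim: k => // k IH; rewrite ltnS leq_eqVlt => /predU1P[->|jk] kN; first exact: node_step.
by rewrite (lt_trans (IH jk (ltnW kN)))// node_step.
Qed.

Lemma node_le j k : (j <= k)%N -> (k <= N.+1)%N -> nd j <= nd k.
Proof. by rewrite leq_eqVlt => /predU1P[->//|jk kN]; exact/ltW/node_lt. Qed.

Lemma node_itv k : (k <= N.+1)%N -> 0 <= nd k <= b.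
Proof.
move=> kN; have := node_le kN (leqnn N.+1); rewrite node_last => ->.
by rewrite andbT; exact: (@node_le 0 k).
Qed.

Lemma node_ltb k : (k <= N)%N -> nd k < b.
Proof. by move=> kN; have := @node_lt k N.+1 kN (leqnn _); rewrite node_last. Qed.

Lemma node_inj j k : (j <= N)%N -> (k <= N)%N -> nd j = nd k -> j = k.
Proof.
move=> jN kN; case: (ltngtP j k) => // jk.
  by have := node_lt jk (leqW kN) => /[swap] ->; rewrite ltxx.
by have := node_lt jk (leqW jN) => /[swap] ->; rewrite ltxx.
Qed.

Lemma node_gap j k : (j <= N)%N -> (k <= N)%N -> ~~ (nd k < nd j < nd k.+1).
Proof.
move=> jN kN; apply/negP => /andP[h1 h2].
have [jk|jk] := leqP j k.
  by have := lt_le_trans h1 (node_le jk (leqW kN)); rewrite ltxx.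
by have := lt_le_trans h2 (node_le jk (leqW jN)); rewrite ltxx.
Qed.

End Nodes.

(** * The potential as a density *)

Section Density.
Variables (R : realType) (b : R) (N : nat) (xs : 'I_N -> R) (alpha : 'I_N -> R[i]).
Hypotheses (hb : 0 < b) (hI : interactions b xs alpha).
Variables (q : R -> R[i]) (hq : L2 0 b q) (h : R[i]).
Notation nd := (node b xs).
Notation leb := (@lebesgue_measure R).

(** The initial slope [i rho + h] is that of [e^{i rho x}] after a point interaction
    of strength [h] at [0]. *)
Definition charge (k : nat) : R[i] := if k is j.+1 then oapp alpha 0 (insub j) else h.

Definition nu : {sigma_finite_measure set (measurableTypeR R) -> \bar R} :=
  atoms_measure nd N.+1.

(** With this density, [density nu] is the measure
    [h delta_0 + q dx + sum_k alpha_k delta_{x_k}]: at the nodes, a null set for [dx],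
    the values of [q] are replaced by the strengths of the atoms. *)
Definition density (s : R) : R[i] := restr 0 b q s +
  \sum_(k < N.+1) (if s == nd k then charge k - restr 0 b q (nd k) else 0).

Lemma density_node k : (k <= N)%N -> density (nd k) = charge k.
Proof.
move=> kN; have kN' : (k < N.+1)%N by [].
have -> : density (nd k) = restr 0 b q (nd k) + (charge k - restr 0 b q (nd k)).
  rewrite /density; congr (_ + _).
  rewrite (bigD1 (Ordinal kN')) // big1; first by rewrite ifT; [exact: addr0|exact: eqxx].
  move=> j jk; case: eqP => // kj; have jN : (j <= N)%N by rewrite -ltnS.
  have := node_inj hb hI kN jN kj => jk'.
  by move: jk; rewrite -(inj_eq val_inj) /= -jk' eqxx.
by rewrite addrC subrK.
Qed.

Lemma density_off s : (forall k, (k <= N)%N -> s != nd k) -> density s = restr 0 b q s.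
Proof.
move=> sk; rewrite /density big1 ?addr0// => j _.
by rewrite (negbTE (sk _ _))// -ltnS.
Qed.

Lemma countable_nodes : countable (range nd).
Proof. exact: card_image_le. Qed.

Lemma ae_off_nodes : {ae leb, forall s : R, forall k, s != nd k}.
Proof.
exists (range nd); split.
- have -> : range nd = \bigcup_k [set nd k] by apply/seteqP; split => s [k _] /=; [move=> <-|move=> ->]; exists k.
  exact: bigcupT_measurable.
- exact: (countable_lebesgue_measure0 countable_nodes).
- move=> s /= /existsNP[k] /negP; rewrite negbK => /eqP ->; by exists k.
Qed.

Lemma ae_density : {ae leb, forall s : R, density s = restr 0 b q s}.
Proof.
apply: (@filterS _ _ (ae_filter_ringOfSetsType leb) _ _ _ ae_off_nodes) => s sk.
by apply: density_off => k _.
Qed.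

Lemma cintegrable_sum (m : {measure set (measurableTypeR R) -> \bar R}) n (F : 'I_n -> R -> R[i]) :
  (forall k, cintegrable m (F k)) -> cintegrable m (fun s => \sum_(k < n) F k s).
Proof.
elim: n F => [|n IH] F iF.
  by under eq_fun do rewrite big_ord0; exact: cintegrable0.
under eq_fun do rewrite big_ord_recr /=.
by apply: cintegrableD; [apply: IH => k; exact: iF|exact: iF].
Qed.

Lemma cintegrable_point (a : R) (z : R[i]) : cintegrable leb (fun s => if s == a then z else 0).
Proof.
apply: (@cintegrable_le _ _ _ leb _ (fun s => norm1 z * \1_(`](a - 1), (a + 1)[%classic) s)).
- apply: (@cmeas_if _ _ _ (fun s : R => s == a)); try exact: cmeas_cst.
  exact: measurable_fun_eqr.
- exact: integrable_cst_itv.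
- move=> s; rewrite indicE mem_setE in_itv /=; case: eqP => [->|_].
    by rewrite ltrBlDr ltrDl ltr01 mulr1.
  by rewrite norm1_0 mulr_ge0// norm1_ge0.
Qed.

Lemma cintegrable_density_leb : cintegrable leb density.
Proof.
apply: cintegrableD; first exact: L2_restr.
by apply: cintegrable_sum => k; exact: cintegrable_point.
Qed.

Lemma cintegrable_density : cintegrable nu density.
Proof. by have [] := cint_atoms nd N.+1 cintegrable_density_leb. Qed.

Lemma density_neg s : s < 0 -> density s = 0.
Proof.
move=> s0; rewrite density_off ?/restr; first by rewrite ltNge (ltW s0).
move=> k kN; rewrite lt_eqF// (lt_le_trans s0)//.
by have /andP[] := node_itv hb hI (leqW kN).
Qed.

Lemma density_big s : b <= s -> density s = 0.
Proof.
move=> bs; rewrite density_off ?/restr; first by rewrite [s < b]ltNge bs andbF.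
by move=> k kN; rewrite gt_eqF// (lt_le_trans _ bs)// (node_ltb hb hI).
Qed.

(** For [phi = density u] the extra sum is the jump of the slope of [u] at a node. *)
Lemma cint_jump (phi : R -> R[i]) x : cintegrable leb phi ->
  cint nu (fun s => if s <= x then phi s else 0) =
  cint nu (fun s => if s < x then phi s else 0) +
  \sum_(k < N.+1) (if nd k == x then phi x else 0).
Proof.
move=> iphi; have [inu _] := cint_atoms nd N.+1 iphi.
have mlt : measurable_fun setT (fun s : R => s < x) by exact: measurable_fun_ltr.
have -> : (fun s => if s <= x then phi s else 0) =
    (fun s => (if s < x then phi s else 0) + (if s == x then phi x else 0)).
  apply/funext => s; rewrite le_eqVlt; case: eqP => [->|_] /=.
    by rewrite ltxx add0r.
  by rewrite addr0.
have [ip Ep] := cint_atoms nd N.+1 (cintegrable_point x (phi x)).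
rewrite cintD//; last exact: cintegrable_restr.
congr (_ + _); rewrite Ep -[RHS]add0r; congr (_ + _).
transitivity (cint leb (fun=> 0)); last exact: cint0.
apply: cint_ae; first exact: (@cintegrable_cmeas _ _ _ leb _ (cintegrable_point x (phi x))).
  exact: cmeas_cst.
exists [set x]; split => //; first exact: lebesgue_measure_set1.
by move=> s /= ; case: eqP => // -> _.
Qed.

Lemma cint_jump_leb (phi : R -> R[i]) x : cintegrable leb phi ->
  cint leb (fun s => if s <= x then phi s else 0) =
  cint leb (fun s => if s < x then phi s else 0).
Proof.
move=> iphi.
apply: cint_ae.
  by apply: (@cintegrable_cmeas _ _ _ leb); apply: cintegrable_restr iphi; exact: measurable_fun_ler.
  by apply: (@cintegrable_cmeas _ _ _ leb); apply: cintegrable_restr iphi; exact: measurable_fun_ltr.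
exists [set x]; split => //; first exact: lebesgue_measure_set1.
by move=> s /=; rewrite le_eqVlt; case: eqP.
Qed.

End Density.

(** * Solutions satisfy the integrated equation *)

Lemma diff_quot_cvg (R : realType) (f : R -> R) (x d : R) :
  diff_quot f x t @[t --> x^'-] --> d -> f t @[t --> x^'-] --> f x.
Proof.
move=> fd.
have c1 : (t : R) @[t --> x^'-] --> x by apply: cvg_at_left_filter; exact: cvg_id.
have l : diff_quot f x t * (t - x) + f x @[t --> x^'-] --> (d * (x - x) + f x : R).
  by apply: cvgD; [apply: cvgM => //; apply: cvgB => //; exact: cvg_cst|exact: cvg_cst].
rewrite subrr mulr0 add0r in l; apply: cvg_trans l; apply: near_eq_cvg.
near=> t.
have tx : t < x by near: t; exact: nbhs_left_lt.
by rewrite /diff_quot divfK ?subrK// subr_eq0 lt_eqF.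
Unshelve. all: by end_near. Qed.

Lemma has_lderiv_cvg (R : realType) (f : R -> R[i]) x d : has_lderiv f x d ->
  (Re (f t) @[t --> x^'-] --> Re (f x)) /\ (Im (f t) @[t --> x^'-] --> Im (f x)).
Proof.
move=> [f1 f2]; split.
  exact: (@diff_quot_cvg _ (fun t => Re (f t)) _ _ f1).
exact: (@diff_quot_cvg _ (fun t => Im (f t)) _ _ f2).
Qed.

Section Solution.
Variables (R : realType) (b : R) (N : nat) (xs : 'I_N -> R) (alpha : 'I_N -> R[i]).
Hypotheses (hb : 0 < b) (hI : interactions b xs alpha).
Variables (q : R -> R[i]) (hq : L2 0 b q) (h : R[i]).
Notation nd := (node b xs).
Notation leb := (@lebesgue_measure R).
Notation nu := (nu b xs).
Notation density := (density b xs alpha q h).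
Notation charge := (charge alpha h).
Variables (rho : R[i]) (e : R -> R[i]).

Definition forcing (s : R) : R[i] := density s * zext b e s.
Definition spectral (s : R) : R[i] := restr 0 b (fun s => - rho ^+ 2 * e s) s.
(** The equation [u'' = (density nu - rho^2 dx) u] integrated twice, with value [1] at
    [0] and slope [i rho] to the left of [0]. *)
Definition picard (x : R) : R[i] :=
  1 + 'i%C * rho * x%:C + cramp nu forcing x + cramp leb spectral x.
Definition picard_slope (x : R) : R[i] := 'i%C * rho +
  cint nu (fun s => if s < x then forcing s else 0) +
  cint leb (fun s => if s < x then spectral s else 0).

Hypothesis ace : abs_cont 0 b e.

Lemma cintegrable_forcing_leb : cintegrable leb forcing.
Proof.
have [M _ eM] := zext_bound hb ace.
exact: (cintegrable_mulb (cintegrable_density_leb xs alpha hq h) (cmeas_zext hb ace) eM).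
Qed.

Lemma cintegrable_forcing : cintegrable nu forcing.
Proof. by have [] := cint_atoms nd N.+1 cintegrable_forcing_leb. Qed.

Lemma forcing_neg s : s < 0 -> forcing s = 0.
Proof. by move=> s0; rewrite /forcing density_neg// mul0r. Qed.

Lemma cintegrable_spectral : cintegrable leb spectral.
Proof.
have [M M0 eM] := zext_bound hb ace.
have E s : spectral s = if 0 < s < b then - rho ^+ 2 * zext b e s else 0.
  by rewrite /spectral /restr /zext; case: ifP => // /andP[s0 sb]; rewrite !ltW.
have mi : measurable_fun setT (fun s : R => 0 < s < b).
  by apply: measurable_and; exact: measurable_fun_ltr.
apply: (@cintegrable_le _ _ _ leb _ (fun s => norm1 (- rho ^+ 2) * M * \1_(`]0, b[%classic) s)).
- have -> : spectral = (fun s => if 0 < s < b then - rho ^+ 2 * zext b e s else 0).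
    by apply/funext => s; exact: E.
  apply: (@cmeas_if _ _ _ (fun s : R => 0 < s < b)) => //.
  by apply: cmeasM; [exact: cmeas_cst|exact: cmeas_zext].
- exact: integrable_cst_itv.
- move=> s; rewrite E indicE mem_setE in_itv /=; case: ifP => _; last by rewrite norm1_0 mulr0.
  by rewrite mulr1; apply: le_trans (norm1M _ _) _; rewrite ler_wpM2l// norm1_ge0.
Qed.

Lemma spectral_neg s : s < 0 -> spectral s = 0.
Proof. by move=> s0; rewrite /spectral /restr ltNge (ltW s0). Qed.

Lemma has_deriv_line (z w : R[i]) x : has_deriv (fun t : R => z + w * t%:C) x w.
Proof.
have A : has_deriv (fun t : R => t%:C) x 1.
  have := has_deriv_affine x 1 0.
  by under [fun t => (_ * t + _)%:C]eq_fun do rewrite mul1r addr0.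
have := has_derivD (has_deriv_cst z x) (has_derivZ w A).
by rewrite add0r mulr1.
Qed.

Lemma picard_lderiv x : has_lderiv picard x (picard_slope x).
Proof.
apply: has_lderivD.
  apply: has_lderivD; first exact/has_deriv_l/has_deriv_line.
  exact: (has_lderiv_cramp x cintegrable_forcing forcing_neg).
exact: (has_lderiv_cramp x cintegrable_spectral spectral_neg).
Qed.

Lemma picard_rderiv x : has_rderiv picard x
  (picard_slope x + \sum_(k < N.+1) (if nd k == x then forcing x else 0)).
Proof.
have -> : picard_slope x + \sum_(k < N.+1) (if nd k == x then forcing x else 0) =
    'i%C * rho + cint nu (fun s => if s <= x then forcing s else 0) +
    cint leb (fun s => if s <= x then spectral s else 0).
  rewrite (@cint_jump _ _ _ _ _ x cintegrable_forcing_leb) (@cint_jump_leb _ _ x cintegrable_spectral).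
  by rewrite /picard_slope; ring.
apply: has_rderivD.
  apply: has_rderivD; first exact/has_deriv_r/has_deriv_line.
  exact: (has_rderiv_cramp x cintegrable_forcing forcing_neg).
exact: (has_rderiv_cramp x cintegrable_spectral spectral_neg).
Qed.

Lemma picard_0 : picard 0 = 1.
Proof.
rewrite /picard /cramp mulr0 addr0.
rewrite (_ : (fun s => _) = (fun=> 0)); last first.
  by apply/funext => s; case: ifP => // s0; rewrite forcing_neg// mulr0.
rewrite [X in _ + cint leb X](_ : _ = (fun=> 0)); last first.
  by apply/funext => s; case: ifP => // s0; rewrite spectral_neg// mulr0.
by rewrite !cint0 !addr0.
Qed.

Lemma picard_slope0 : picard_slope 0 = 'i%C * rho.
Proof.
rewrite /picard_slope (_ : (fun s => _) = (fun=> 0)); last first.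
  by apply/funext => s; case: ifP => // s0; rewrite forcing_neg.
rewrite [X in _ + cint leb X](_ : _ = (fun=> 0)); last first.
  by apply/funext => s; case: ifP => // s0; rewrite spectral_neg.
by rewrite !cint0 !addr0.
Qed.

(** Between two nodes the measure [density nu] is [q dx], and the second derivative
    of [picard] is that of the solution. *)
Lemma picard_piece k (w : R -> R[i]) : (k <= N)%N ->
  cmeas (restr (nd k) (nd k.+1) w) ->
  {ae leb, forall x : R, nd k < x < nd k.+1 -> w x = (q x - rho ^+ 2) * e x} ->
  exists k0 k1 : R[i], forall y, nd k < y < nd k.+1 ->
    picard y = k0 + k1 * y%:C + cramp leb (restr (nd k) (nd k.+1) w) y.
Proof.
move=> kN mw wE.
have [_ bk] : 0 <= nd k.+1 /\ nd k.+1 <= b by apply/andP; exact: (node_itv hb hI).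
have [k0_ _] : 0 <= nd k /\ nd k <= b by apply/andP; exact: (node_itv hb hI (leqW kN)).
set A := nd k; set B := nd k.+1.
have mAB : measurable_fun setT (fun s : R => A < s < B).
  by apply: measurable_and; exact: measurable_fun_ltr.
pose f1 s := if A < s < B then forcing s else 0.
pose f2 s := if ~~ (A < s < B) then forcing s else 0.
pose c1 s := if A < s < B then spectral s else 0.
pose c2 s := if ~~ (A < s < B) then spectral s else 0.
have mNAB : measurable_fun setT (fun s : R => ~~ (A < s < B)) by exact: measurable_neg.
have if1 : cintegrable nu f1 by exact: cintegrable_restr cintegrable_forcing.
have if1l : cintegrable leb f1 by exact: cintegrable_restr cintegrable_forcing_leb.
have if2 : cintegrable nu f2 by exact: cintegrable_restr cintegrable_forcing.
have ic1 : cintegrable leb c1 by exact: cintegrable_restr cintegrable_spectral.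
have ic2 : cintegrable leb c2 by exact: cintegrable_restr cintegrable_spectral.
have nf1 s : s < 0 -> f1 s = 0 by move=> s0; rewrite /f1 forcing_neg//; case: ifP.
have nf2 s : s < 0 -> f2 s = 0 by move=> s0; rewrite /f2 forcing_neg//; case: ifP.
have nc1 s : s < 0 -> c1 s = 0 by move=> s0; rewrite /c1 spectral_neg//; case: ifP.
have nc2 s : s < 0 -> c2 s = 0 by move=> s0; rewrite /c2 spectral_neg//; case: ifP.
have zf2 s : A < s < B -> f2 s = 0 by rewrite /f2 => ->.
have zc2 s : A < s < B -> c2 s = 0 by rewrite /c2 => ->.
have [a0 [a1 Ha]] := @cramp_affine _ nu 0 f2 A B if2 nf2 zf2.
have [b0 [b1 Hb]] := @cramp_affine _ leb 0 c2 A B ic2 nc2 zc2.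
exists (1 + a0 + b0), ('i%C * rho + a1 + b1) => y yAB.
have Ef : cramp nu forcing y = cramp nu f1 y + cramp nu f2 y.
  rewrite -(crampD y if1 nf1 if2 nf2); congr cramp; apply/funext => s.
  by rewrite /f1 /f2; case: (A < s < B); rewrite ?addr0 ?add0r.
have Ec : cramp leb spectral y = cramp leb c1 y + cramp leb c2 y.
  rewrite -(crampD y ic1 nc1 ic2 nc2); congr cramp; apply/funext => s.
  by rewrite /c1 /c2; case: (A < s < B); rewrite ?addr0 ?add0r.
have E1 : cramp nu f1 y = cramp leb f1 y.
  rewrite /cramp.
  have [_ ->] := cint_atoms nd N.+1 (cintegrable_cramp y if1l nf1).
  rewrite big1 ?addr0// => j _; rewrite /f1.
  have jN : (j <= N)%N by rewrite -ltnS.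
  by rewrite (negbTE (node_gap hb hI jN kN)) mulr0; case: ifP.
have Efc : (fun s => f1 s + c1 s) = restr A B (fun s => (q s - rho ^+ 2) * e s).
  apply/funext => s; rewrite /f1 /c1 /restr; case: ifP => sAB; last by rewrite addr0.
  have [s1 s2] : A < s /\ s < B by apply/andP.
  have s0b : 0 < s < b by rewrite (le_lt_trans k0_ s1) (lt_le_trans s2 bk).
  rewrite /forcing density_off; last first.
    move=> j jN; apply/eqP => sj; have := node_gap hb hI jN kN.
    by rewrite -sj sAB.
  rewrite /spectral /restr s0b /zext; have /andP[s0 sb] := s0b.
  by rewrite (ltW s0) (ltW sb) /=; ring.
have Ew : cramp leb (restr A B w) y = cramp leb f1 y + cramp leb c1 y.
  rewrite -(crampD y if1l nf1 ic1 nc1) Efc.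
  apply: cramp_ae => //; rewrite -Efc.
  by apply: cmeasD; apply: (@cintegrable_cmeas _ _ _ leb).
rewrite /picard Ef Ec E1 Ew (Ha y yAB) (Hb y yAB); ring.
Qed.

Hypothesis sol : is_solution b xs alpha q (rho ^+ 2) e.
Hypothesis e0 : e 0 = 1.
Hypothesis e'0 : has_rderiv e 0 ('i%C * rho + h).

Lemma atom_sum k : (k <= N)%N ->
  \sum_(j < N.+1) (if nd j == nd k then forcing (nd k) else 0) = charge k * e (nd k).
Proof.
move=> kN; have kN' : (k < N.+1)%N by [].
rewrite (bigD1 (Ordinal kN')) // big1; last first.
  move=> j jk; case: eqP => // kj; have jN : (j <= N)%N by rewrite -ltnS.
  have := node_inj hb hI jN kN kj => jk'.
  by move: jk; rewrite -(inj_eq val_inj) /= jk' eqxx.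
rewrite ifT; last exact: eqxx.
transitivity (forcing (nd k)); first exact: addr0.
by rewrite /forcing density_node// /zext (node_itv hb hI (leqW kN)).
Qed.

Lemma solution_rderiv k : (k <= N)%N ->
  (forall x, 0 <= x <= nd k -> e x = picard x) ->
  has_rderiv e (nd k) (picard_slope (nd k) + charge k * e (nd k)).
Proof.
move=> kN IH; case: k kN IH => [_ _|k kN IH].
  by rewrite picard_slope0 /charge /= e0 mulr1.
have [[_ _ J] _] := sol.
have [dl [dr [hl hr jump]]] := J (Ordinal kN).
have xE : nd k.+1 = xs (Ordinal kN) by rewrite -(nodeS b xs (Ordinal kN)).
rewrite -xE in hl hr jump.
have x0 : 0 < nd k.+1 by exact: (node_lt hb hI (ltn0Sn k) (leqW kN)).
have lE : dl = picard_slope (nd k.+1).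
  have pl : has_lderiv e (nd k.+1) (picard_slope (nd k.+1)).
    apply: (has_lderiv_eq x0 _ (picard_lderiv _)) => t t0; by rewrite IH.
  exact: has_lderiv_unique hl pl.
have -> : charge k.+1 = alpha (Ordinal kN).
  by rewrite /charge /= insubT.
by rewrite -jump -lE addrC subrK.
Qed.

(** By induction on the pieces: between two nodes [e] and [picard] differ by an affine
    function; at the left node they have the same value and, the jump of the slope
    of [e] being the strength of the atom times [e], the same right slope. *)
Lemma solution_picard x : 0 <= x <= b -> e x = picard x.
Proof.
suff H k : (k <= N.+1)%N -> forall x, 0 <= x <= nd k -> e x = picard x.
  by move=> xb; apply: (H N.+1) => //; rewrite node_last.
elim: k => [_ y /andP[y0 y1]|k IH kN].
  by have -> : y = 0; [apply/le_anti/andP|rewrite picard_0].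
have {}IH := IH (ltnW kN).
have AB : nd k < nd k.+1 by rewrite (node_step hb hI).
have /andP[A0 Ab] := node_itv hb hI (ltnW kN).
have /andP[B0 Bb] := node_itv hb hI kN.
have [_ /(_ k kN) [u2 wu aeu]] := sol.
have lip1 := @lipRe R; have lip2 := @lipIm R.
have piece y : nd k < y < nd k.+1 -> 0 < y < b.
  by move=> /andP[y1 y2]; rewrite (le_lt_trans A0 y1) (lt_le_trans y2 Bb).
have [iw [p0 [p1 Hp]]] := weak2_regular AB wu
  (fun y hy => continuous_in hb ace lip1 (piece y hy))
  (fun y hy => continuous_in hb ace lip2 (piece y hy)).
have mw : cmeas (restr (nd k) (nd k.+1) u2) by exact: cintegrable_cmeas iw.
have wE : {ae leb, forall x : R, nd k < x < nd k.+1 -> u2 x = (q x - rho ^+ 2) * e x}.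
  apply: (@filterS _ _ (ae_filter_ringOfSetsType leb) _ _ _ aeu) => y hy yAB.
  have := hy yAB => /eqP; rewrite addrC subr_eq => /eqP E.
  by rewrite mulrBl E; ring.
have [k0 [k1 Hk]] := picard_piece kN mw wE.
have open y : nd k < y < nd k.+1 -> e y = picard y.
  have eA : e (nd k) = picard (nd k) by apply: IH; rewrite A0 lexx.
  have rp := picard_rderiv (nd k); rewrite (atom_sum kN) in rp.
  apply: (glue AB eA (solution_rderiv kN IH) rp (k0 := p0 - k0) (k1 := p1 - k1)) => t tAB.
  by rewrite Hp// Hk//; ring.
move=> y /andP[y0 yB]; have [yA|yA] := leP y (nd k); first by apply: IH; rewrite y0.
move: yB; rewrite le_eqVlt => /predU1P[->|yB]; last by apply: open; rewrite yA.
have B1 : 0 < nd k.+1 <= b by rewrite (le_lt_trans A0 AB).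
have nearB : \forall t \near (nd k.+1)^'-, nd k < t < nd k.+1.
  near=> t; apply/andP; split; near: t; by [exact: nbhs_left_gt|exact: nbhs_left_lt].
have [pR pI] := has_lderiv_cvg (picard_lderiv (nd k.+1)).
have eR := cvg_left hb ace lip1 B1; have eI := cvg_left hb ace lip2 B1.
apply: complexP.
  have l : Re (e t) @[t --> (nd k.+1)^'-] --> Re (picard (nd k.+1)).
    by apply: cvg_trans pR; apply: near_eq_cvg; apply: filterS nearB => t tAB; rewrite open.
  exact: (cvg_unique _ eR l).
have l : Im (e t) @[t --> (nd k.+1)^'-] --> Im (picard (nd k.+1)).
  by apply: cvg_trans pI; apply: near_eq_cvg; apply: filterS nearB => t tAB; rewrite open.
exact: (cvg_unique _ eI l).
Unshelve. all: by end_near. Qed.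

Lemma solution_lderiv x : 0 < x <= b -> has_lderiv e x (picard_slope x).
Proof.
move=> /andP[x0 xb]; apply: (has_lderiv_eq x0 _ (picard_lderiv x)) => t /andP[t0 tx].
by rewrite solution_picard// t0 (le_trans tx).
Qed.

Lemma solution_deriv x : 0 < x < b -> (forall k, x != xs k) -> has_deriv e x (picard_slope x).
Proof.
move=> /andP[x0 xb] xk; apply: has_deriv_lr.
  by apply: solution_lderiv; rewrite x0 ltW.
have := picard_rderiv x; rewrite big1 ?addr0 => [hr|j _].
  apply: (has_rderiv_eq xb _ hr) => t /andP[tx tb].
  by rewrite solution_picard// tb (le_trans (ltW x0)).
rewrite ifF//; apply/negbTE; rewrite eq_sym.
case: j => -[|j] jN; first by rewrite /= gt_eqF.
have jN' : (j < N)%N by [].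
by have := nodeS b xs (Ordinal jN'); rewrite /= => ->.
Qed.

End Solution.

(** * Uniqueness for the integrated equation *)

Section PicardUniqueness.
Variables (R : realType).
Notation leb := (@lebesgue_measure R).

(** [(x - s)_+ e^{lam s}] is at most [e^{lam x} / lam]. *)
Lemma cramp_weighted (m : {sigma_finite_measure set (measurableTypeR R) -> \bar R})
    (g d : R -> R[i]) (lam C x : R) : cintegrable m g -> cmeas d -> 0 < lam ->
  wbound (fun s => expR (lam * s)) C d ->
  norm1 (cramp m (fun s => g s * d s) x) <= C * expR (lam * x) / lam * mass m g.
Proof.
move=> ig md l0 dC.
have C0 : 0 <= C.
  by have := le_trans (norm1_ge0 _) (dC 0); rewrite mulr0 expR0 mulr1.
have mg := cintegrable_cmeas ig.
rewrite /mass -RintegralZl//; last exact: cintegrable_norm1.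
apply: cint_le; last 2 first.
- by apply: integrableZ_EFin; exact: cintegrable_norm1.
- move=> s; case: ifP => sx; last first.
    by rewrite norm1_0 mulr_ge0 ?norm1_ge0// divr_ge0 ?mulr_ge0 ?expR_ge0// ltW.
  rewrite [_ * (g s * d s)]mulrC norm1Mr gtr0_norm ?subr_gt0//.
  have h1 : norm1 (g s * d s) <= norm1 (g s) * (C * expR (lam * s)).
    apply: le_trans (norm1M _ _) _; apply: ler_wpM2l; [exact: norm1_ge0|exact: dC].
  apply: (@le_trans _ _ (norm1 (g s) * (C * expR (lam * s)) * (expR (lam * (x - s)) / lam))).
    apply: ler_pM => //; [exact: norm1_ge0|by rewrite subr_ge0 ltW|].
    by apply: le_trans (ramp_le_expR (x - s) l0); rewrite le_max lexx.
  rewrite (_ : lam * x = lam * s + lam * (x - s)); last by ring.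
  by rewrite expRD le_eqVlt; apply/orP; left; apply/eqP; ring.
apply: (@cmeas_if _ _ _ (fun s : R => s < x)); first exact: measurable_fun_ltr.
  apply: (cmeasM _ (cmeasM mg md)); apply: cmeas_real; exact: measurable_funB.
exact: cmeas_cst.
Qed.

(** With the growth rate [lam] above twice the total mass of both densities, the
    right-hand side halves the weighted norm of [d]. *)
Lemma picard_unique (nu : {sigma_finite_measure set (measurableTypeR R) -> \bar R})
    (g c d : R -> R[i]) (M : R) : cintegrable nu g -> cintegrable leb c -> cmeas d ->
  (forall s, s < 0 -> d s = 0) -> (forall s, norm1 (d s) <= M) ->
  (forall x, d x = 0 \/
     d x = cramp nu (fun s => g s * d s) x + cramp leb (fun s => c s * d s) x) ->
  forall x, d x = 0.
Proof.
move=> ig ic md d0 dM dE.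
have M0 : 0 <= M by apply: le_trans (norm1_ge0 _) (dM 0).
have mm : 0 <= mass nu g + mass leb c by exact: addr_ge0 (mass_ge0 nu g) (mass_ge0 leb c).
pose lam := 2 * (mass nu g + mass leb c) + 1.
have l0 : 0 < lam by rewrite ltr_wpDl// mulr_ge0.
have dw : wbound (fun s => expR (lam * s)) M d.
  move=> s; have [s0|s0] := ltP s 0.
    by rewrite d0// norm1_0 mulr_ge0// expR_ge0.
  apply: le_trans (dM s) _; rewrite ler_peMr// (le_trans _ (expR_ge1Dx _))// lerDl.
  by rewrite mulr_ge0// ltW.
apply: (halving_eq0 dw) => C dC x.
have C0 : 0 <= C.
  by have := le_trans (norm1_ge0 _) (dC 0); rewrite mulr0 expR0 mulr1.
have E0 := expR_ge0 (lam * x).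
case: (dE x) => ->; first by rewrite norm1_0 mulr_ge0// divr_ge0.
apply: le_trans (norm1D _ _) _.
apply: le_trans (lerD (cramp_weighted x ig md l0 dC) (@cramp_weighted leb c d lam C x ic md l0 dC)) _.
rewrite -mulrDr (_ : C / 2 * _ = C * expR (lam * x) / lam * (lam / 2)); last first.
  by field; exact: lt0r_neq0.
apply: ler_wpM2l; first by rewrite divr_ge0 ?mulr_ge0// ltW.
by rewrite ler_pdivlMr// mulrC /lam lerDl.
Qed.

End PicardUniqueness.

(** * The solution is the transmuted exponential *)

Section Growth.
Variables (R : realType) (nu : {sigma_finite_measure set (measurableTypeR R) -> \bar R}).
Variables (g : R -> R[i]).
Notation wt := (weight nu g).
Notation leb := (@lebesgue_measure R).
Variables (K : R * R -> R[i]) (gK : good wt K).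
Hypothesis Ksupp : forall z, ~~ (`|z.2| < z.1) -> K z = 0.
Variable rho : R[i].

Lemma cmeas_psi : cmeas (psi K rho).
Proof.
have [mK _] := gK.
apply: cmeasD; first exact: cmeas_ex.
apply: (@cmeas_param _ _ _ _ _ leb (fun z : R * measurableTypeR R => K z * ex rho z.2)).
exact: (cmeasM mK (cmeas_comp (cmeas_ex rho) measurable_snd)).
Qed.

Lemma psi_bound (b : R) : exists2 M, 0 <= M &
  forall x, 0 <= x <= b -> norm1 (psi K rho x) <= M.
Proof.
have [mK [C KC]] := gK; have C0 := wbound_ge0 KC.
have EE x y : x <= y -> expbound rho x <= expbound rho y.
  by move=> xy; rewrite /expbound ler_wpM2l// ler_expR ler_wpM2l.
have E0 := expbound_ge0 rho.
have W0 z : 0 <= wt z by exact/ltW/weight_gt0.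
exists (expbound rho b + C * wt (b, 0) * expbound rho b * (2 * `|b|)).
  by rewrite addr_ge0// !mulr_ge0.
move=> x /andP[x0 xb].
have b0 : 0 <= b by exact: le_trans xb.
rewrite (le_trans (norm1D _ _))// lerD//.
  by rewrite (le_trans (ex_bound rho (x := b) _))// ger0_norm.
have mKx : cmeas (fun t : R => K (x, t)) by apply: (cmeas_comp mK); exact: measurable_fun_pair.
have Kx t : norm1 (K (x, t)) <= C * wt (x, 0) by exact: (KC (x, t)).
rewrite (psiK_cut Ksupp).
have Le t : norm1 (K (x, t) * cut rho x t) <= C * wt (x, 0) * expbound rho x * \1_(`]- x, x[%classic) t.
  rewrite -mulrA; apply: le_trans (norm1M _ _) _.
  exact: (ler_pM (norm1_ge0 _) (norm1_ge0 _) (Kx t) (cut_le rho x t)).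
have le := @cint_le _ _ _ leb _ _ (cmeasM mKx (cmeas_cut rho x)) (integrable_cst_itv _ _ _) Le.
apply: le_trans le _.
rewrite Rintegral_cst_itv ler_pM// ?mulr_ge0//.
- by rewrite le_max lexx orbT.
- rewrite ler_pM// ?mulr_ge0 ?EE//; rewrite ler_wpM2l// /weight ler_expR ler_wpM2l//=.
  by have := mass_ge0 nu g; lra.
- by rewrite (ger0_norm b0) ge_max; apply/andP; split; lra.
Qed.

End Growth.

Section Identification.
Variables (R : realType) (b : R) (N : nat) (xs : 'I_N -> R) (alpha : 'I_N -> R[i]).
Hypotheses (hb : 0 < b) (hI : interactions b xs alpha).
Variables (q : R -> R[i]) (hq : L2 0 b q) (h : R[i]).
Notation leb := (@lebesgue_measure R).
Notation nu := (nu b xs).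
Notation density := (density b xs alpha q h).
Variables (K : R * R -> R[i]) (gK : good (weight nu density) K).
Hypothesis Ksupp : forall z, ~~ (`|z.2| < z.1) -> K z = 0.
Hypothesis KE : forall z, K z = source nu density z + transport nu density K z.
Variable (rho : R[i]).
Notation psi := (psi K rho).

Let ig : cintegrable nu density. Proof. exact: cintegrable_density. Qed.
Let g_neg s : s < 0 -> density s = 0. Proof. exact: density_neg. Qed.

Definition spectral_coef (s : R) : R[i] := restr 0 b (fun=> - rho ^+ 2) s.

Lemma cintegrable_spectral_coef : cintegrable leb spectral_coef.
Proof.
apply: (@cintegrable_le _ _ _ leb _ (fun s => norm1 (- rho ^+ 2) * \1_(`]0, b[%classic) s)).
- apply: (@cmeas_if _ _ _ (fun s : R => 0 < s < b)); try exact: cmeas_cst.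
  by apply: measurable_and; exact: measurable_fun_ltr.
- exact: integrable_cst_itv.
- move=> s; rewrite indicE mem_setE in_itv /= /spectral_coef /restr.
  by case: ifP => _; rewrite ?mulr1 // mulr0 norm1_0.
Qed.

Lemma density_zext (u : R -> R[i]) s : density s * zext b u s = density s * u s.
Proof.
rewrite /zext; case: ifPn => // sb; rewrite mulr0.
have [s0|s0] := ltP s 0; first by rewrite density_neg// mul0r.
rewrite density_big ?mul0r//; move: sb; rewrite s0 /= -ltNge; exact: ltW.
Qed.

Lemma cmeas_zext_psi : cmeas (zext b psi).
Proof.
apply: (@cmeas_if _ _ _ (fun s : R => 0 <= s <= b)); last exact: cmeas_cst.
  by apply: measurable_and; exact: measurable_fun_ler.
exact: (cmeas_psi gK).
Qed.

Lemma zext_psi_bound : exists M, forall s, norm1 (zext b psi s) <= M.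
Proof.
have [M M0 HM] := psi_bound gK Ksupp rho b.
by exists M => s; rewrite /zext; case: ifP => [/HM//|_]; rewrite norm1_0.
Qed.

Lemma cintegrable_density_psi : cintegrable nu (fun s => density s * zext b psi s).
Proof.
by have [M HM] := zext_psi_bound; exact: (cintegrable_mulb ig cmeas_zext_psi HM).
Qed.

Lemma cintegrable_spectral_coef_psi : cintegrable leb (fun s => spectral_coef s * zext b psi s).
Proof.
have [M HM] := zext_psi_bound.
exact: (cintegrable_mulb cintegrable_spectral_coef cmeas_zext_psi HM).
Qed.

Lemma density_psi_neg s : s < 0 -> density s * zext b psi s = 0.
Proof. by move=> s0; rewrite g_neg// mul0r. Qed.

Lemma psi_response x : psi x = response nu rho (fun s => density s * zext b psi s) x.
Proof.
rewrite (psi_volterra ig g_neg gK Ksupp KE) /response; congr (_ + _).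
by apply: eq_cint => s; case: ifP => // _; rewrite density_zext.
Qed.

Lemma psi_picard x : 0 <= x <= b -> psi x = 1 + 'i%C * rho * x%:C +
  cramp nu (fun s => density s * zext b psi s) x +
  cramp leb (fun s => spectral_coef s * zext b psi s) x.
Proof.
move=> /andP[x0 xb].
have := response_ramp rho cintegrable_density_psi density_psi_neg x0.
rewrite -psi_response => RR.
have -> : cramp leb (fun s => spectral_coef s * zext b psi s) x =
   cint leb (fun s => if 0 < s < x then - rho ^+ 2 * ((x - s)%:C * psi s) else 0).
  apply: eq_cint => s; rewrite /spectral_coef /restr /zext.
  have [sx|sx] := ltP s x; last by rewrite andbF.
  rewrite andbT (lt_le_trans sx xb) andbT; case: ifPn => s0; last by rewrite mul0r mulr0.
  by rewrite (ltW s0) (ltW (lt_le_trans sx xb)) /=; ring.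
under eq_cint do rewrite psi_response.
rewrite {}RR /cramp; ring.
Qed.

Variable (e : R -> R[i]).
Hypothesis sol : is_solution b xs alpha q (rho ^+ 2) e.
Hypothesis e0 : e 0 = 1.
Hypothesis e'0 : has_rderiv e 0 ('i%C * rho + h).

Let ace : abs_cont 0 b e. Proof. by have [[]] := sol. Qed.

(** Both solve the same integrated equation. *)
Lemma solution_psi x : 0 <= x <= b -> e x = psi x.
Proof.
move=> xb.
pose d s := zext b e s - zext b psi s.
have md : cmeas d by exact: (cmeasB (cmeas_zext hb ace) cmeas_zext_psi).
have [M1 _ H1] := zext_bound hb ace; have [M2 H2] := zext_psi_bound.
have dM s : norm1 (d s) <= M1 + M2 by apply: le_trans (norm1B _ _) (lerD (H1 s) (H2 s)).
have d_neg s : s < 0 -> d s = 0.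
  by move=> s0; rewrite /d /zext leNgt s0 /= subrr.
suff : d x = 0 by rewrite /d /zext xb => /eqP; rewrite subr_eq0 => /eqP.
apply: (picard_unique ig cintegrable_spectral_coef md d_neg dM) => y.
have [yb|yb] := boolP (0 <= y <= b); last by left; rewrite /d /zext (negbTE yb) subrr.
right.
have id1 := cintegrable_mulb ig md dM.
have id2 := cintegrable_mulb cintegrable_spectral_coef md dM.
have nd1 s : s < 0 -> density s * d s = 0 by move=> s0; rewrite g_neg// mul0r.
have np u s : s < 0 -> spectral_coef s * u = 0.
  by move=> s0; rewrite /spectral_coef /restr ltNge (ltW s0) mul0r.
have sE : spectral b rho e = (fun s => spectral_coef s * zext b e s).
  apply/funext => s; rewrite /spectral /spectral_coef /restr /zext.
  by case: ifP => [/andP[h1 h2]|]; rewrite ?mul0r// (ltW h1) (ltW h2).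
have C1 := crampD y id1 nd1 cintegrable_density_psi density_psi_neg.
have C2 := crampD y id2 (fun s => np _ s) cintegrable_spectral_coef_psi (fun s => np _ s).
have L1 : (fun s => density s * d s + density s * zext b psi s) = forcing b xs alpha q h e.
  by apply/funext => s; rewrite /d /forcing -mulrDr subrK.
have L2 : (fun s => spectral_coef s * d s + spectral_coef s * zext b psi s) = spectral b rho e.
  by rewrite sE; apply/funext => s; rewrite /d -mulrDr subrK.
rewrite {}L1 in C1; rewrite {}L2 in C2.
have E1 := solution_picard hb hI hq ace sol e0 e'0 yb.
rewrite /picard {}C1 {}C2 in E1.
rewrite {1}/d /zext yb E1 (psi_picard yb); ring.
Qed.

Lemma solution_slope x : 0 < x <= b -> picard_slope b xs alpha q h rho e x =
  'i%C * rho * ex rho x +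
  cint nu (fun s => if s < x then Cs rho (x - s) * (density s * psi s) else 0).
Proof.
move=> /andP[x0 xb].
have := response_slope rho cintegrable_density_psi density_psi_neg (ltW x0).
under eq_cint do rewrite -psi_response.
under [fun s => if s < x then Cs rho (x - s) * _ else 0]eq_fun do rewrite density_zext.
move=> RR.
have E1 : cint leb (fun s => if s < x then spectral b rho e s else 0) =
   cint leb (fun s => if 0 < s < x then - rho ^+ 2 * psi s else 0).
  apply: eq_cint => s; rewrite /spectral /restr.
  have [sx|sx] := ltP s x; last by rewrite andbF.
  rewrite andbT (lt_le_trans sx xb) andbT; case: ifPn => // s0.
  by rewrite solution_psi// (ltW s0) (ltW (lt_le_trans sx xb)).
have E2 : cint nu (fun s => if s < x then forcing b xs alpha q h e s else 0) =
   cint nu (fun s => if s < x then density s * zext b psi s else 0).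
  apply: eq_cint => s; case: ifP => // _; rewrite /forcing /zext.
  by case: ifP => // sb; rewrite solution_psi.
rewrite /picard_slope {}E1 {}E2 {}RR; ring.
Qed.

End Identification.

(** * The kernel of the derivative *)

Section ShiftedKernel.
Variables (R : realType) (nu : {sigma_finite_measure set (measurableTypeR R) -> \bar R}).
Variables (g : R -> R[i]) (ig : cintegrable nu g).
Hypothesis g_ge0 : forall s : R, s < 0 -> g s = 0.
Notation leb := (@lebesgue_measure R).
Notation wt := (weight nu g).
Variables (K : R * R -> R[i]) (gK : good wt K).
Hypothesis Ksupp : forall z, ~~ (`|z.2| < z.1) -> K z = 0.

Let mK : cmeas K. Proof. by case: gK. Qed.

(** As [cos (rho y)] averages [e^{i rho y}] and [e^{- i rho y}], multiplying
    [int K(s,t) e^{i rho t} dt] by [cos (rho (x - s))] averages the translates of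
    [K(s,_)] by [x - s] and [s - x]. *)
Definition shifted (x : R) (z : R * R) : R[i] :=
  if z.1 < x then K (z.1, z.2 - (x - z.1)) + K (z.1, z.2 + (x - z.1)) else 0.

Lemma cmeas_shifted x : cmeas (shifted x).
Proof.
apply: (@cmeas_if _ _ _ (fun z : R * R => z.1 < x)); first exact: measurable_fun_ltr.
  apply: cmeasD.
    apply: (cmeas_comp mK (phi := fun z : R * R => (z.1, z.2 - (x - z.1)))).
    apply: measurable_fun_pair => //; apply: measurable_funB => //; exact: measurable_funB.
  apply: (cmeas_comp mK (phi := fun z : R * R => (z.1, z.2 + (x - z.1)))).
  apply: measurable_fun_pair => //; apply: measurable_funD => //; exact: measurable_funB.
exact: cmeas_cst.
Qed.

Lemma shifted_bound x : exists2 D, 0 <= D & forall z, norm1 (shifted x z) <= D.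
Proof.
have [_ [C KC]] := gK; have C0 := wbound_ge0 KC.
have W0 z : 0 <= wt z by exact/ltW/weight_gt0.
exists (C * wt (x, 0) + C * wt (x, 0)); first by rewrite addr_ge0// mulr_ge0.
move=> [s t]; rewrite /shifted /=; case: ifP => sx; last by rewrite norm1_0 addr_ge0// mulr_ge0.
have H u : norm1 (K (s, u)) <= C * wt (x, 0).
  apply: le_trans (KC (s, u)) _; rewrite ler_wpM2l// /weight ler_expR; apply: ler_wpM2l; last exact: ltW.
  by rewrite addr_ge0// mulr_ge0// mass_ge0.
by apply: le_trans (norm1D _ _) _; exact: lerD.
Qed.

Variable rho : R[i].
Notation ex := (ex rho).
Notation cut := (cut rho).

Lemma cintegrable_mulcut (f : R -> R[i]) (D x : R) : cmeas f -> (forall t, norm1 (f t) <= D) ->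
  cintegrable leb (fun t => f t * cut x t).
Proof.
move=> mf fD.
apply: (@cintegrable_le _ _ _ leb _ (fun t => D * (expbound rho x * \1_(`]- x, x[%classic) t))).
- exact: (cmeasM mf (cmeas_cut rho x)).
- by apply: integrableZ_EFin; exact: integrable_cst_itv.
- move=> t; apply: le_trans (norm1M _ _) _.
  exact: (ler_pM (norm1_ge0 _) (norm1_ge0 _) (fD t) (cut_le rho x t)).
Qed.

Let mKs s : cmeas (fun t : R => K (s, t)).
Proof. by apply: (cmeas_comp mK); exact: measurable_fun_pair. Qed.

Let Ks_bound : exists C, forall s t, norm1 (K (s, t)) <= C * wt (s, 0).
Proof. by have [_ [C KC]] := gK; exists C => s t; exact: (KC (s, t)). Qed.

Let mKsy s y : cmeas (fun t : R => K (s, t - y)).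
Proof. apply: (cmeas_comp (mKs s) (phi := fun t : R => t - y)); exact: measurable_funB. Qed.

Lemma psiK_shift (s x y : R) : s + `|y| <= x ->
  cint leb (fun t : R => K (s, t - y) * cut x t) = ex y * psiK K rho s.
Proof.
move=> sxy; have [C KC] := Ks_bound.
rewrite (psiK_cut Ksupp).
have I1 := @cintegrable_mulcut _ _ s (mKs s) (KC s).
rewrite -cintZ//.
have ml : cmeas (fun t : R => K (s, t - y) * cut x t) by exact: (cmeasM (mKsy s y) (cmeas_cut rho x)).
rewrite (@cint_affine _ _ y ltr01 _ ml) mul1r; apply: eq_cint => t.
rewrite mul1r addrK /cut.
have [ts|ts] := boolP (`|t| < s); last first.
  have Kz : K (s, t) = 0 by exact: Ksupp.
  by rewrite Kz !mul0r mulr0.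
rewrite (_ : _ < x); last by rewrite (le_lt_trans (ler_normD _ _))//; lra.
by rewrite exD; ring.
Qed.

Lemma shifted_cut (s x : R) : 0 <= s -> cint leb (fun t => shifted x (s, t) * cut x t) =
  if s < x then 2 * (Cs rho (x - s) * psiK K rho s) else 0.
Proof.
move=> s0; rewrite /shifted /=; case: ifPn => sx; last first.
  by under eq_fun do rewrite mul0r; rewrite cint0.
have [C KC] := Ks_bound.
transitivity (cint leb (fun t : R => K (s, t - (x - s)) * cut x t + K (s, t - (- (x - s))) * cut x t)).
  by apply: eq_cint => t; rewrite mulrDl opprK.
rewrite cintD.
- rewrite !psiK_shift; first by rewrite /Cs; field.
    by rewrite normrN ger0_norm; lra.
  by rewrite ger0_norm; lra.
- exact: (@cintegrable_mulcut _ _ x (mKsy s _) (fun t : R => KC s (t - _))).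
- exact: (@cintegrable_mulcut _ _ x (mKsy s _) (fun t : R => KC s (t - _))).
Qed.

Lemma slope_kernel (x : R) :
  cintegrable leb (fun t => ((2^-1)%:C * cint nu (fun s => g s * shifted x (s, t))) * cut x t) /\
  cintegrable nu (fun s => if s < x then Cs rho (x - s) * (g s * psiK K rho s) else 0) /\
  cint leb (fun t => ((2^-1)%:C * cint nu (fun s => g s * shifted x (s, t))) * cut x t) =
  cint nu (fun s => if s < x then Cs rho (x - s) * (g s * psiK K rho s) else 0).
Proof.
have [D D0 FD] := shifted_bound x.
have S1 := swap ig (cmeas_shifted x) FD (cmeas_cut rho x) (cut_le rho x).
have I1 := swap_integrable_leb ig (cmeas_shifted x) FD (cmeas_cut rho x) (cut_le rho x).
have J1 := swap_integrable_nu ig (cmeas_shifted x) FD (cmeas_cut rho x) (cut_le rho x).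
have E : (fun s => if s < x then Cs rho (x - s) * (g s * psiK K rho s) else 0) =
   (fun s => (2^-1)%:C * (g s * cint leb (fun t => shifted x (s, t) * cut x t))).
  apply/funext => s.
  have [s0|s0] := ltP s 0; first by rewrite g_ge0// !mul0r !mulr0; case: ifP.
  rewrite shifted_cut//; case: ifP => _; last by rewrite !mulr0.
  by field.
by rewrite E.
Qed.

End ShiftedKernel.


(** * The explicit terms *)

Lemma cintegral_restr (R : realType) (a c : R) (u : R -> R[i]) :
  cintegral `]a, c[ u = cint (@lebesgue_measure R) (restr a c u).
Proof.
apply: complexP => /=; rewrite [LHS]Rintegral_mkcond; congr (Rintegral _ _ _);
  apply/funext => s.
  by rewrite (patch_itv (fun s => Re (u s))) /restr; case: ifP.
by rewrite (patch_itv (fun s => Im (u s))) /restr; case: ifP.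
Qed.

Lemma ex_cexp (R : realType) (rho : R[i]) t : ex rho t = cexp ('i%C * rho * t%:C).
Proof. by []. Qed.

Section AffineIntegrable.
Variables (R : realType) (a c : R) (a0 : 0 < a).
Notation leb := (@lebesgue_measure R).

Lemma integral_affine_lty (f : R -> \bar R) : measurable_fun setT f ->
  (forall x, 0 <= f x)%E -> (\int[leb]_x f x < +oo)%E ->
  (\int[leb]_x f (a * x + c)%R < +oo)%E.
Proof.
move=> mf f0; rewrite (ge0_integral_affine c a0 mf f0).
case: (\int[leb]_x f (a * x + c)%R)%E => [r _| |].
- exact: ltry.
- by rewrite gt0_muley ?lte_fin.
- by [].
Qed.

Lemma integrable_affine (k : R -> R) : leb.-integrable setT (EFin \o k) ->
  leb.-integrable setT (EFin \o (fun x => k (a * x + c))).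
Proof.
have m : measurable_fun setT (fun t : R => a * t + c : measurableTypeR R).
  by apply: measurable_funD => //; exact: measurable_funM.
move=> /integrableP[/measurable_EFinP mk lk]; apply/integrableP; split.
  by apply/measurable_EFinP; exact: (measurableT_comp mk m).
apply: (@integral_affine_lty (fun x => (`|k x|)%:E)) => //.
by apply/measurable_EFinP; apply: measurableT_comp => //; exact: normr_measurable.
Qed.

Lemma cintegrable_affine (f : R -> R[i]) : cintegrable leb f ->
  cintegrable leb (fun x => f (a * x + c)).
Proof.
move=> [i1 i2]; split.
  exact: (@integrable_affine (fun x => Re (f x))).
exact: (@integrable_affine (fun x => Im (f x))).
Qed.

End AffineIntegrable.

Lemma half_window (R : realType) (t x : R) :
  (0 < 2^-1 * t + 2^-1 * x < x) = (- x < t < x).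
Proof. by apply/idP/idP => /andP[h1 h2]; apply/andP; split; lra. Qed.

Section FreePart.
Variables (R : realType) (b : R) (N : nat) (xs : 'I_N -> R) (alpha : 'I_N -> R[i]).
Hypotheses (hb : 0 < b) (hI : interactions b xs alpha).
Variables (q : R -> R[i]) (hq : L2 0 b q) (h : R[i]).
Notation nd := (node b xs).
Notation leb := (@lebesgue_measure R).
Notation nu := (nu b xs).
Notation density := (density b xs alpha q h).
Notation charge := (charge alpha h).
Variables (rho : R[i]) (x : R).
Hypothesis x0b : 0 < x <= b.
Notation ex := (ex rho).

Let x0 : 0 < x. Proof. by have /andP[] := x0b. Qed.
Let xb : x <= b. Proof. by have /andP[] := x0b. Qed.

(** [cos (rho (x - s)) e^{i rho s}] for [0 <= s < x], as a sum of exponentials *)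
Definition reflect_ex (s : R) : R[i] :=
  if 0 <= s < x then (2^-1)%:C * (ex x + ex (2 * s - x)) else 0.

Lemma reflect_exE s : density s * reflect_ex s =
  if s < x then Cs rho (x - s) * (density s * ex s) else 0.
Proof.
rewrite /reflect_ex; have [s0|s0] := ltP s 0.
  by rewrite density_neg// !mul0r mulr0; case: ifP.
rewrite /=; case: ifP => _; last by rewrite mulr0.
rewrite /Cs (_ : ex x = ex (x - s) * ex s); last by rewrite -exD subrK.
rewrite (_ : 2 * s - x = - (x - s) + s); last by ring.
by rewrite (exD rho (- (x - s)) s); ring.
Qed.

Lemma reflect_ex_bound s : norm1 (reflect_ex s) <= expbound rho x.
Proof.
have E0 := expbound_ge0 rho x.
rewrite /reflect_ex; case: ifP => [/andP[s0 sx]|_]; last by rewrite norm1_0.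
apply: le_trans (norm1M _ _) _; rewrite norm1_half ler_pdivrMl//.
rewrite [leRHS](_ : _ = expbound rho x + expbound rho x); last by ring.
apply: le_trans (norm1D _ _) _; apply: lerD.
  by apply: ex_bound; rewrite ger0_norm// ltW.
apply: ex_bound.
by rewrite ler_norml; apply/andP; split; lra.
Qed.

Lemma cmeas_ex_reflected : cmeas (fun s : R => ex (2 * s - x)).
Proof.
apply: (cmeas_comp (cmeas_ex rho) (phi := fun s : R => 2 * s - x)).
by apply: measurable_funB => //; exact: measurable_funM.
Qed.

Lemma cmeas_reflect_ex : cmeas reflect_ex.
Proof.
apply: (@cmeas_if _ _ _ (fun s : R => 0 <= s < x)); last exact: cmeas_cst.
  by apply: measurable_and; [exact: measurable_fun_ler|exact: measurable_fun_ltr].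
apply: cmeasM; first exact: cmeas_cst.
by apply: cmeasD; [exact: cmeas_cst|exact: cmeas_ex_reflected].
Qed.

Let L2x : cintegrable leb (restr 0 x q).
Proof.
have -> : restr 0 x q = (fun s => if s < x then restr 0 b q s else 0).
  apply/funext => s; rewrite /restr.
  by have [sx|sx] := ltP s x; rewrite ?andbF ?andbT// (lt_le_trans sx xb) andbT.
by apply: cintegrable_restr (L2_restr hq); exact: measurable_fun_ltr.
Qed.

(** The substitution [t = 2 s - x] turns [q(s) e^{i rho (2 s - x)} / 2 ds] into
    [q_reflected t e^{i rho t} dt]. *)
Definition q_reflected (t : R) : R[i] := (4^-1)%:C * restr 0 b q (2^-1 * t + 2^-1 * x).

Lemma cint_reflect_leb :
  cint leb (fun s => density s * reflect_ex s) =
  wint q 0 x * ex x + cint leb (fun t => q_reflected t * cut rho x t).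
Proof.
have mr : cmeas (fun s => restr 0 b q s * reflect_ex s).
  by apply: cmeasM cmeas_reflect_ex; exact: cintegrable_cmeas (L2_restr hq).
have md : cmeas (fun s => density s * reflect_ex s).
  by apply: cmeasM cmeas_reflect_ex; exact: (@cintegrable_cmeas _ _ _ leb _ (cintegrable_density_leb xs alpha hq h)).
have -> : cint leb (fun s => density s * reflect_ex s) = cint leb (fun s => restr 0 b q s * reflect_ex s).
  apply: (cint_ae md mr).
  apply: (@filterS _ _ (ae_filter_ringOfSetsType leb) _ _ _ (ae_density b xs alpha q h)) => s ds.
  by rewrite ds.
have i2 : cintegrable leb (fun s => restr 0 x q s * ex (2 * s - x)).
  have := @cintegrable_mulb _ _ _ leb _
    (fun s => if 0 < s < x then ex (2 * s - x) else 0) (expbound rho x) L2x.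
  have -> : (fun s => restr 0 x q s * (if 0 < s < x then ex (2 * s - x) else 0)) =
    (fun s => restr 0 x q s * ex (2 * s - x)).
    by apply/funext => s; rewrite /restr; case: ifP; rewrite ?mul0r.
  apply.
  - apply: (@cmeas_if _ _ _ (fun s : R => 0 < s < x)); last exact: cmeas_cst.
      by apply: measurable_and; exact: measurable_fun_ltr.
    exact: cmeas_ex_reflected.
  - move=> s; have E0 := expbound_ge0 rho x.
    case: ifP => [/andP[s0 sx]|_]; last by rewrite norm1_0.
    by apply: ex_bound; rewrite ler_norml; apply/andP; split; lra.
transitivity (cint leb (fun s => ((2^-1)%:C * ex x) * restr 0 x q s +
    (2^-1)%:C * (restr 0 x q s * ex (2 * s - x)))).
  apply: eq_cint => s; rewrite /reflect_ex /restr.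
  have [s0|s0] := ltP 0 s; last first.
    by rewrite /= !mul0r !mulr0 addr0.
  have [sx|sx] := ltP s x; last by rewrite !andbF !mulr0 mul0r mulr0 addr0.
  by rewrite (ltW s0) (lt_le_trans sx xb) /=; ring.
rewrite cintD; [|exact: cintegrableZ|exact: cintegrableZ].
rewrite (cintZ _ L2x) (cintZ _ i2); congr (_ + _).
  have -> : wint q 0 x = (2^-1)%:C * cint leb (restr 0 x q).
    rewrite /wint; congr (_ * _); first by rewrite rmorphV ?unitfE// rmorph_nat.
    exact: cintegral_restr.
  by ring.
have h0 : (0 : R) < 2^-1 by rewrite invr_gt0.
rewrite (@cint_affine _ _ (2^-1 * x) h0 _ (cintegrable_cmeas i2)) mulrA.
rewrite -cintZ; last exact: (cintegrable_affine (2^-1 * x) h0 i2).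
apply: eq_cint => t; rewrite /q_reflected /cut.
rewrite (_ : 2 * (2^-1 * t + 2^-1 * x) - x = t); last by field.
rewrite /restr ltr_norml.
rewrite half_window.
case: ifP => [/andP[h1 h2]|_]; last by rewrite mul0r !mulr0.
have /andP[k1 k2] : 0 < 2^-1 * t + 2^-1 * x < x by rewrite half_window h1 h2.
rewrite ifT; last by rewrite k1 (lt_le_trans k2 xb).
rewrite mulrA; congr (_ * _); congr (_ * _).
by rewrite -rmorphM; congr (_%:C); field.
Qed.

Lemma cintegrable_q_reflected : cintegrable leb q_reflected.
Proof.
have h0 : (0 : R) < 2^-1 by rewrite invr_gt0.
by apply: cintegrableZ; exact: (cintegrable_affine (2^-1 * x) h0 (L2_restr hq)).
Qed.

Lemma q_reflected_norm1_sqr :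
  leb.-integrable setT (EFin \o (fun t => norm1 (q_reflected t) ^+ 2)).
Proof.
have h0 : (0 : R) < 2^-1 by rewrite invr_gt0.
have := integrableZ_EFin (4^-1 ^+ 2) (integrable_affine (2^-1 * x) h0 (L2_norm1_sqr hq)).
congr integrable; apply/funext => t; congr EFin.
by rewrite /q_reflected [_%:C * _]mulrC norm1Mr exprMn real_normK ?num_real// mulrC.
Qed.

Lemma cintegrable_reflect_ex : cintegrable leb (fun s => density s * reflect_ex s).
Proof.
exact: (cintegrable_mulb (cintegrable_density_leb xs alpha hq h) cmeas_reflect_ex reflect_ex_bound).
Qed.

Lemma reflect_ex_0 : reflect_ex 0 = ccos (rho * x%:C).
Proof.
rewrite /reflect_ex lexx x0 /= mulr0 sub0r /ccos !ex_cexp mulrC.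
by rewrite rmorphV ?unitfE// rmorph_nat !mulrA rmorphN mulrN.
Qed.

Lemma charge_reflect (k : 'I_N) : alpha k * reflect_ex (xs k) =
  2%:R^-1 * (alpha k * heaviside (x - xs k)) * cexp ('i%C * rho * x%:C) +
  alpha k / 2%:R * heaviside (x - xs k)
    * cexp (- (2%:R * 'i%C * rho * (x / 2%:R - xs k)%:C)).
Proof.
have [/(_ k)/andP[k0 kb] _ _] := hI.
rewrite /reflect_ex (ltW k0) /= /heaviside subr_gt0; case: ifP => _; last by rewrite !mulr0 !mul0r addr0.
have -> : - (2%:R * 'i%C * rho * (x / 2%:R - xs k)%:C) = 'i%C * rho * (2 * xs k - x)%:C.
  have -> : 2 * xs k - x = - (2 * (x / 2 - xs k)) by field.
  by rewrite rmorphN rmorphM rmorph_nat; ring.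
rewrite -!ex_cexp rmorphV ?unitfE// rmorph_nat.
by rewrite !mulr1; ring.
Qed.

(** The part of the slope that is not an integral over [K]: each atom contributes the
    value of [reflect_ex] at its node, the absolutely continuous part [q dx] the
    terms with [wint] and [q_reflected]. *)
Lemma cint_reflect_ex : cint nu (fun s => density s * reflect_ex s) =
  (wint q 0 x + 2%:R^-1 * sigma xs alpha x) * ex x + h * ccos (rho * x%:C) +
  \sum_(k < N) alpha k / 2%:R * heaviside (x - xs k)
     * cexp (- (2%:R * 'i%C * rho * (x / 2%:R - xs k)%:C)) +
  cint leb (fun t => q_reflected t * cut rho x t).
Proof.
have [_ ->] := cint_atoms nd N.+1 cintegrable_reflect_ex.
rewrite cint_reflect_leb.
have -> : \sum_(k < N.+1) density (nd k) * reflect_ex (nd k) =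
    h * ccos (rho * x%:C) + \sum_(k < N) alpha k * reflect_ex (xs k).
  rewrite big_ord_recl; congr (_ + _).
    by rewrite (density_node hb hI q h (leq0n N)) -reflect_ex_0.
  apply: eq_bigr => k _; have kN : (k.+1 <= N)%N by exact: ltn_ord.
  rewrite [nat_of_ord _]/= /bump add1n (density_node hb hI q h kN) nodeS.
  by rewrite /charge valK.
rewrite (eq_bigr _ (fun k _ => charge_reflect k)) big_split /=.
rewrite -mulr_suml -mulr_sumr ex_cexp /sigma; ring.
Qed.

End FreePart.

(** * The representation *)

Section KernelL2.
Variables (R : realType).
Notation leb := (@lebesgue_measure R).

Lemma L2_bounded_perturbation (a c D : R) (u v : R -> R[i]) : cmeas u -> cmeas v ->
  (forall t, norm1 (v t) <= D) ->
  leb.-integrable setT (EFin \o (fun t => norm1 (u t) ^+ 2)) ->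
  L2 a c (fun t => u t + v t).
Proof.
move=> mu mv vD uL2.
have [m1 m2] := cmeasD mu mv.
split; [exact: measurable_funTS|exact: measurable_funTS|].
have D0 : 0 <= D by apply: le_trans (vD 0); exact: norm1_ge0.
pose G (t : R) := 2 * (norm1 (u t)) ^+ 2 + 2 * D ^+ 2 * \1_(`]a, c[%classic) t.
have iG : leb.-integrable setT (EFin \o G).
  by apply: integrableD_EFin; [exact: integrableZ_EFin|exact: integrable_cst_itv].
have /integrableP[mG finG] := iG.
have mitv : measurable (`]a, c[%classic : set (measurableTypeR R)) by [].
have mN : measurable_fun setT (fun t => ((ComplexField.Normc.normc (u t + v t)) ^+ 2)%:E).
  apply/measurable_EFinP; under eq_fun do rewrite normc_sqr.
  by apply: measurable_funD; apply: measurable_funX.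
have mA : measurable_fun setT (fun t => `|(EFin \o G) t|%E) by exact: measurableT_comp.
apply: (@le_lt_trans _ _ (\int[leb]_(t in `]a, c[) `|(EFin \o G) t|)%E); last first.
  by apply: le_lt_trans finG; apply: ge0_subset_integral.
apply: ge0_le_integral => //.
- by move=> t _; rewrite lee_fin sqr_ge0.
- exact: measurable_funTS.
- exact: measurable_funTS.
- move=> t tac; rewrite /= lee_fin; apply: le_trans (ler_norm _).
  rewrite /G indicE mem_set// mulr1.
  have h1 : ComplexField.Normc.normc (u t + v t) <= norm1 (u t) + D.
    apply: le_trans (normc_norm1 _) _; apply: le_trans (norm1D _ _) _.
    by rewrite lerD2l.
  apply: (@le_trans _ _ ((norm1 (u t) + D) ^+ 2)).
    rewrite ler_sqr// ?nnegrE ?addr_ge0 ?norm1_ge0//.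
    by case: (u t + v t) => ? ? /=; exact: sqrtr_ge0.
  by have := sqr_ge0 (norm1 (u t) - D); lra.
Qed.

End KernelL2.

Section Representation.
Variables (R : realType) (b : R) (N : nat) (xs : 'I_N -> R) (alpha : 'I_N -> R[i]).
Hypotheses (hb : 0 < b) (hI : interactions b xs alpha).
Variables (q : R -> R[i]) (hq : L2 0 b q) (h : R[i]).
Notation leb := (@lebesgue_measure R).
Notation nu := (nu b xs).
Notation density := (density b xs alpha q h).
Variables (K : R * R -> R[i]) (gK : good (weight nu density) K).
Hypothesis Ksupp : forall z, ~~ (`|z.2| < z.1) -> K z = 0.

Let ig : cintegrable nu density. Proof. exact: cintegrable_density. Qed.
Let g_neg (s : R) : s < 0 -> density s = 0. Proof. exact: density_neg. Qed.

Definition slope_remainder (x t : R) : R[i] :=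
  (2^-1)%:C * cint nu (fun s => density s * shifted K x (s, t)).

Definition slope_ker (x t : R) : R[i] := q_reflected b q x t + slope_remainder x t.

Lemma cmeas_slope_remainder x : cmeas (slope_remainder x).
Proof.
apply: cmeasM; first exact: cmeas_cst.
apply: (@cmeas_param _ _ _ _ _ nu (fun z : R * measurableTypeR R => density z.2 * shifted K x (z.2, z.1))).
apply: cmeasM.
  exact: (cmeas_comp (cintegrable_cmeas ig) measurable_snd).
apply: (cmeas_comp (cmeas_shifted gK x) (phi := fun z : R * R => (z.2, z.1))).
exact: measurable_fun_pair.
Qed.

Lemma slope_remainder_bound x : exists D, forall t, norm1 (slope_remainder x t) <= D.
Proof.
have [D D0 FD] := shifted_bound gK x.
exists (2^-1 * \int[nu]_s (D * norm1 (density s))) => t.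
apply: le_trans (norm1M _ _) _; rewrite norm1_half ler_wpM2l//.
have iD : nu.-integrable setT (EFin \o (fun s => D * norm1 (density s))).
  by apply: integrableZ_EFin; exact: cintegrable_norm1.
apply: (cint_le _ iD).
- apply: (cmeasM (cintegrable_cmeas ig)).
  by apply: (cmeas_comp (cmeas_shifted gK x)); exact: measurable_fun_pair.
- move=> s; apply: le_trans (norm1M _ _) _; rewrite mulrC.
  by apply: ler_wpM2r; [exact: norm1_ge0|exact: FD].
Qed.

Lemma slope_ker_L2 x : L2 (- x) x (slope_ker x).
Proof.
have [D HD] := slope_remainder_bound x.
have mq := cintegrable_cmeas (cintegrable_q_reflected hq x).
exact: (@L2_bounded_perturbation _ _ _ _ (q_reflected b q x) (slope_remainder x) mq
  (cmeas_slope_remainder x) HD (q_reflected_norm1_sqr hq x)).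
Qed.

Hypothesis KE : forall z, K z = source nu density z + transport nu density K z.
Variables (rho : R[i]) (e : R -> R[i]).
Hypothesis sol : is_solution b xs alpha q (rho ^+ 2) e.
Hypothesis e0 : e 0 = 1.
Hypothesis e'0 : has_rderiv e 0 ('i%C * rho + h).

Lemma slope_representation (x : R) : 0 < x <= b ->
  picard_slope b xs alpha q h rho e x =
  ('i%C * rho + wint q 0 x + 2%:R^-1 * sigma xs alpha x) * cexp ('i%C * rho * x%:C)
  + h * ccos (rho * x%:C)
  + \sum_(k < N) alpha k / 2%:R * heaviside (x - xs k)
      * cexp (- (2%:R * 'i%C * rho * (x / 2%:R - xs k)%:C))
  + cintegral `]- x, x[ (fun t => slope_ker x t * cexp ('i%C * rho * t%:C)).
Proof.
move=> x0b.
rewrite (solution_slope hb hI hq gK Ksupp KE sol e0 e'0 x0b).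
have [I1 [I2 E2]] := slope_kernel ig g_neg gK Ksupp rho x.
have ir := cintegrable_reflect_ex xs alpha hq h rho x0b.
have -> : cint nu (fun s => if s < x then Cs rho (x - s) * (density s * psi K rho s) else 0) =
  cint nu (fun s => density s * reflect_ex rho x s) +
  cint nu (fun s => if s < x then Cs rho (x - s) * (density s * psiK K rho s) else 0).
  rewrite -cintD//; last by have [] := cint_atoms (node b xs) N.+1 ir.
  apply: eq_cint => s; rewrite (reflect_exE hb hI).
  by case: ifP => _; rewrite ?addr0// /psi; ring.
rewrite (cint_reflect_ex hb hI hq h rho x0b) -E2.
have -> : cintegral `]- x, x[ (fun t => slope_ker x t * cexp ('i%C * rho * t%:C)) =
  cint leb (fun t => q_reflected b q x t * cut rho x t) +
  cint leb (fun t => slope_remainder x t * cut rho x t).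
  rewrite cintegral_restr -cintD//; last first.
    exact: (cintegrable_mulb (cintegrable_q_reflected hq x) (cmeas_cut rho x) (cut_bound rho x)).
  apply: eq_cint => t; rewrite /restr -ltr_norml /cut.
  by case: ifP => _; rewrite ?mulr0 ?addr0// -mulrDl ex_cexp.
rewrite /slope_remainder ex_cexp; ring.
Qed.

End Representation.

Theorem theorem42 (R : realType) (b : R) (hb : 0 < b)
    (q : R -> R[i]) (hq : L2 0 b q)
    (N : nat) (xs : 'I_N -> R) (alpha : 'I_N -> R[i])
    (hI : interactions b xs alpha) (h : R[i]) :
  exists E : R -> R -> R[i],
    (forall x : R, 0 < x <= b -> L2 (- x) x (E x)) /\
    (forall (rho : R[i]) (e : R -> R[i]),
      is_solution b xs alpha q (rho ^+ 2) e ->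
      e 0 = 1 ->
      has_rderiv e 0 ('i%C * rho + h) ->
      forall x : R, 0 < x <= b ->
        pw_deriv b xs e x
          (('i%C * rho + wint q 0 x + 2%:R^-1 * sigma xs alpha x)
             * cexp ('i%C * rho * x%:C)
           + h * ccos (rho * x%:C)
           + \sum_(k < N) alpha k / 2%:R * heaviside (x - xs k)
               * cexp (- (2%:R * 'i%C * rho * (x / 2%:R - xs k)%:C))
           + cintegral `]- x, x[ (fun t => E x t * cexp ('i%C * rho * t%:C)))).
Proof.
have ig := cintegrable_density xs alpha hq h.
have g_neg := density_neg hb hI q h.
have [K [gK Ksupp KE]] := kernel_exists ig g_neg.
exists (slope_ker b xs alpha q h K); split.
  by move=> x _; exact: slope_ker_L2.
move=> rho e sol e0 e'0 x x0b.
have ace : abs_cont 0 b e by have [[]] := sol.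
rewrite -(slope_representation hb hI hq gK Ksupp KE sol e0 e'0 x0b).
split; first exact: (solution_lderiv hb hI hq ace sol e0 e'0 x0b).
move=> xb xk; have /andP[x0 _] := x0b.
by apply: (solution_deriv hb hI hq ace sol e0 e'0) => //; rewrite x0.
Qed.
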